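(* Let $d\ge2$ be an integer and let $p,n$ be real with $p\ge n>d/2+1$. Choose $\rho\in(2\sqrt d,+\infty)$, $\mu\in(1,+\infty)$ and $m\in\mathbf N=\{0,1,2,\dots\}$. With $\mathcal G_{pn}:\mathbf Z^d_0\to(0,+\infty)$, $\mathcal G_{pn}(k):=4\sum_{h\in\mathbf Z^d_{0k}}\frac{(|k|^p-|k-h|^p)^2|P_{h,k-h}|^2}{(|h|^p|k-h|^{n-1}+|h|^n|k-h|^{p-1})^2}$, the following holds. (i) For all $k\in\mathbf Z^d_0$, $$\mathscr G_{pn}(k)<\mathcal G_{pn}(k)\le\mathscr G_{pn}(k)+\delta\mathscr G_{pn},$$ where $$\mathscr G_{pn}(k):=4\sum_{h\in\mathbf Z^d_{0k},\ |h|<\rho\text{ or }|k-h|<\rho}\frac{(|k|^p-|k-h|^p)^2|P_{h,k-h}|^2}{(|h|^p|k-h|^{n-1}+|h|^n|k-h|^{p-1})^2},$$ $$\delta\mathscr G_{pn}:=\frac{2\pi^{d/2}C_{pn}}{\Gamma(d/2)}\sum_{i=0}^{d-1}\binom{d-1}{i}\frac{d^{\,d/2-1/2-i/2}}{(2n-3-i)(\rho-2\sqrt d)^{2n-3-i}}.$$ Moreover $$\mathscr G_{pn}(k)=4\sum_{h\in\mathbf Z^d_{0k},\ |h|<\rho}\Big(\frac{(|k|^p-|k-h|^p)^2|P_{h,k-h}|^2}{(|h|^p|k-h|^{n-1}+|h|^n|k-h|^{p-1})^2}+\frac{H(|k-h|-\rho)(|k|^p-|h|^p)^2|P_{k-h,h}|^2}{(|k-h|^p|h|^{n-1}+|k-h|^n|h|^{p-1})^2}\Big),$$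 and if $|k|\ge2\rho$, in this last formula one can replace $\mathbf Z^d_{0k}$ with $\mathbf Z^d_0$ and $H(|k-h|-\rho)$ with $1$. (ii) For each $r\in\{1,\dots,d\}$, each permutation $\sigma$ of $\{1,\dots,d\}$ and each $k\in\mathbf Z^d_0$: $\mathscr G_{pn}(R_rk)=\mathscr G_{pn}(k)$ and $\mathscr G_{pn}(P_\sigma k)=\mathscr G_{pn}(k)$. (iii) For all $k\in\mathbf Z^d_0$, $$\mathscr G_{pn}(k)\le4\sum_{h\in\mathbf Z^d_{0k},\ |h|<\rho}\frac1{|h|^{2n-2}}F_{pn}\Big(\cos\vartheta_{hk},\frac{|h|}{|k|}\Big).$$ Furthermore, for all $k\in\mathbf Z^d$ with $|k|\ge\mu\rho$, $$\mathscr G_{pn}(k)\le4\sum_{j=0}^m\frac{\mathcal P_{pnj}(\widehat k)}{|k|^{\lambda_{pnj}}}+4\,\frac{W_{pn}Z_{pn}}{|k|^{\lambda_{pn,m+1}}}\le\mathfrak G_{pn},$$ where $\widehat k=k/|k|$ and $$\mathcal P_{pnj}:\mathbf S^{d-1}\to\mathbf R,\quad\mathcal P_{pnj}(u):=\sum_{h\in\mathbf Z^d_0,|h|<\rho}\frac{P_{pnj}(\cos\vartheta_{hu})}{|h|^{2n-2-\lambda_{pnj}}}$$ (these are polynomials in the components of $u$), $$W_{pn}:=\max_{c\in[-1,1],\,\xi\in[0,1/\mu]}R_{pn,m+1}(c,\xi),\qquad Z_{pn}:=\sum_{h\in\mathbf Z^d_0,|h|<\rho}\frac1{|h|^{2n-2-\lambda_{pn,m+1}}},$$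 $$\mathfrak G_{pn}:=4\max_{u\in\mathbf S^{d-1},\,\epsilon\in[0,1/(\mu\rho)]}\Big(\sum_{j=0}^m\epsilon^{\lambda_{pnj}}\mathcal P_{pnj}(u)+\epsilon^{\lambda_{pn,m+1}}W_{pn}Z_{pn}\Big).$$ (iv) One has $$\sup_{k\in\mathbf Z^d_0}\mathcal G_{pn}(k)\le\max\Big(\max_{k\in\mathbf Z^d_0,|k|<\mu\rho}\mathscr G_{pn}(k),\ \mathfrak G_{pn}\Big)+\delta\mathscr G_{pn}.$$
   Context: Notation. For $a,b\in\mathbf C^d$: $a\cdot b=\sum_ra_rb_r$, $|a|=\sqrt{\overline a\cdot a}$. $\mathbf Z^d_0=\mathbf Z^d\setminus\{0\}$, $\mathbf Z^d_{0k}=\mathbf Z^d\setminus\{0,k\}$. $\mathbf S^{d-1}$ is the unit sphere of $\mathbf R^d$. $\Gamma(\cdot)$ is the Euler Gamma function. $H$ is the Heaviside function: $H(z)=0$ for $z<0$, $H(z)=1$ for $z\ge0$. For $q,r\in\mathbf R^d\setminus\{0\}$, $\vartheta_{qr}\in[0,\pi]$ is the angle between them: $\cos\vartheta_{qr}=\frac{q\cdot r}{|q||r|}$. $R_r(k_1,\dots,k_r,\dots,k_d)=(k_1,\dots,-k_r,\dots,k_d)$ and $P_\sigma(k_1,\dots,k_d)=(k_{\sigma(1)},\dots,k_{\sigma(d)})$. Convention: $\xi^0=1$ for all $\xi\ge 0$, including $\xi=0$. For $k\in\mathbf R^d$, $k^\perp=\{a\in\mathbf C^d:k\cdot a=0\}$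 and $\mathfrak L_k$ is the orthogonal projection of $\mathbf C^d$ onto $k^\perp$ ($\mathfrak L_0$ is the identity). For $h,\ell\in\mathbf Z^d_0$, $P_{h\ell}:h^\perp\times\ell^\perp\to(h+\ell)^\perp$, $P_{h\ell}(a,b)=\frac{a\cdot\ell}{|\ell|}\mathfrak L_{h+\ell}b$, and $|P_{h\ell}|=\min\{Q\ge0:|P_{h\ell}(a,b)|\le Q|a||b|\ \forall a\in h^\perp,b\in\ell^\perp\}$. $C_{pn}:=\max_{z\in[0,4],u\in[0,1]}c_{pn}(z,u)$, where $c_{pn}$ is the continuous function on $[0,4]\times[0,1]$ given by $$c_{pn}(z,u)=\frac{2z(4-z)(1-u)^{2n+2}u^{2n}\big[(1-zu+zu^2)^{p/2}-(1-u)^p\big]^2}{[(1-u)^{2n}u^2+(1-u)^2u^{2n}]\,[(1-u)^pu^n+(1-u)^nu^p]^2}\quad(0<u<1),$$ $$c_{pn}(z,0)=\frac{p^2z(4-z)(2-z)^2}{2(1+3\delta_{pn})},\qquad c_{pn}(z,1)=\frac{2z(4-z)}{1+3\delta_{pn}},$$ with $\delta_{pn}=1$ if $p=n$ and $0$ otherwise. Let $\mathscr E=\{(c,\xi)\in\mathbf R^2:c\in[-1,1],\ \xi\in[0,+\infty),\ (c,\xi)\ne(1,1)\}$ and let $F_{pn}:\mathscr E\to[0,+\infty)$ be the continuous function $$F_{pn}(c,\xi)=\frac{1-c^2}{\big[(1-2c\xi+\xi^2)^{p/2}+\xi^{p-n}(1-2c\xi+\xi^2)^{n/2}\big]^2}\Big\{\frac{(1-\xi^p)^2}{1-2c\xi+\xi^2}+\Big[\frac{1-(1-2c\xi+\xi^2)^{p/2}}{\xi}\Big]^2\Big\}\quad(\xi\ne0),$$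 $$F_{pn}(c,0)=\frac{(1-c^2)(1+p^2c^2)}{1+3\delta_{pn}}.$$ Let $0=\lambda_{pn0}<\lambda_{pn1}<\lambda_{pn2}<\cdots$ be the increasing enumeration of $\{r+(p-n)s+pt:r,s\in\mathbf N,\ t\in\{0,1,2\}\}$. There are unique sequences of functions $P_{pnj}\in C([-1,1],\mathbf R)$ ($j\in\mathbf N$) and $R_{pnj}\in C(\mathscr E,\mathbf R)$ ($j\in\mathbf N\setminus\{0\}$) such that for every $m\in\mathbf N$ and all $(c,\xi)\in\mathscr E$: $F_{pn}(c,\xi)=\sum_{j=0}^mP_{pnj}(c)\,\xi^{\lambda_{pnj}}+R_{pn,m+1}(c,\xi)\,\xi^{\lambda_{pn,m+1}}$; the $P_{pnj}$ are polynomials. *)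

(* Defs.v *)
From HB Require Import structures.
From mathcomp Require Import all_boot all_order all_algebra.
From mathcomp Require Import spectral.
From mathcomp Require Import complex.
From mathcomp Require Import all_classical all_reals all_analysis.
From mathcomp Require mpoly.

Set Implicit Arguments.
Unset Strict Implicit.
Unset Printing Implicit Defensive.

Import Order.TTheory GRing.Theory Num.Theory.
Import numFieldTopology.Exports numFieldNormedType.Exports.

Local Open Scope classical_set_scope.
Local Open Scope ring_scope.

(* The greatest (least) element of A, and 0 if A has none. *)
Definition maximum (R : realType) (A : set R) : R := xget 0 (A `&` ubound A).
Definition minimum (R : realType) (A : set R) : R := xget 0 (A `&` lbound A).

Definition Gamma (R : realType) (s : R) : R :=
  \int[lebesgue_measure]_(x in `]0, +oo[) (x `^ (s - 1) * expR (- x)).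

Definition heaviside (R : realType) (z : R) : R := if z < 0 then 0 else 1.

(* [dotv] is bilinear, with no complex conjugation. *)
Definition dotv (K : comNzRingType) (d : nat) (a b : 'rV[K]_d) : K :=
  \sum_(r < d) a 0 r * b 0 r.

(* Euclidean norms on R^d, Z^d and C^d; the library norm of 'rV[R]_d is the
   maximum norm. *)
Definition rnorm (R : realType) (d : nat) (x : 'rV[R]_d) : R :=
  Num.sqrt (dotv x x).
Definition rvec (R : realType) (d : nat) (k : 'rV[int]_d) : 'rV[R]_d :=
  map_mx intr k.
Definition znorm (R : realType) (d : nat) (k : 'rV[int]_d) : R :=
  rnorm (rvec R k).
Definition cnorm (R : realType) (d : nat) (a : 'rV[R[i]]_d) : R :=
  Num.sqrt (complex.Re (dotv (map_mx (@conjc R) a) a)).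
Definition cvec (R : realType) (d : nat) (k : 'rV[int]_d) : 'rV[R[i]]_d :=
  map_mx intr k.

Definition sphere (R : realType) (d : nat) : set 'rV[R]_d :=
  [set u | rnorm u = 1].
Definition angle (R : realType) (d : nat) (q r : 'rV[R]_d) : R :=
  acos (dotv q r / (rnorm q * rnorm r)).
Definition khat (R : realType) (d : nat) (k : 'rV[int]_d) : 'rV[R]_d :=
  (znorm R k)^-1 *: rvec R k.

Definition Z0 (d : nat) : set 'rV[int]_d := [set h | h != 0].
Definition Z0k (d : nat) (k : 'rV[int]_d) : set 'rV[int]_d :=
  [set h | h != 0 /\ h != k].
Definition zball (R : realType) (d : nat) (rho : R) : set 'rV[int]_d :=
  [set h | znorm R h < rho].

(* The map k |-> (k_1, ..., - k_r, ..., k_d); the permutation action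
   k |-> (k_(s 1), ..., k_(s d)) is [col_perm s k]. *)
Definition reflv (d : nat) (r : 'I_d) (k : 'rV[int]_d) : 'rV[int]_d :=
  \row_(j < d) (if j == r then - k 0 j else k 0 j).

Definition perp (R : realType) (d : nat) (k : 'rV[int]_d) : set 'rV[R[i]]_d :=
  [set a | dotv (cvec R k) a = 0].
(* The row space of [kermx (cvec R k)^T] is [perp k]; [proj_ortho] is the matrix,
   acting on row vectors, of the projection orthogonal for the Hermitian product. *)
Definition projperp (R : realType) (d : nat) (k : 'rV[int]_d)
    (b : 'rV[R[i]]_d) : 'rV[R[i]]_d :=
  b *m proj_ortho (kermx (cvec R k)^T).
Definition Pmap (R : realType) (d : nat) (h l : 'rV[int]_d)
    (a b : 'rV[R[i]]_d) : 'rV[R[i]]_d :=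
  (dotv a (cvec R l) / real_complex R (znorm R l)) *: projperp (h + l) b.
Definition Pnorm (R : realType) (d : nat) (h l : 'rV[int]_d) : R :=
  minimum [set Q : R | 0 <= Q /\
    forall a b : 'rV[R[i]]_d, perp h a -> perp l b ->
      cnorm (Pmap h l a b) <= Q * cnorm a * cnorm b].

Definition delta (R : realType) (p n : R) : R := (p == n)%:R.

Definition cpn (R : realType) (p n z u : R) : R :=
  if u == 0 then
    p ^+ 2 * z * (4 - z) * (2 - z) ^+ 2 / (2 * (1 + 3 * delta p n))
  else if u == 1 then 2 * z * (4 - z) / (1 + 3 * delta p n)
  else
    2 * z * (4 - z) * (1 - u) `^ (2 * n + 2) * u `^ (2 * n)
      * ((1 - z * u + z * u ^+ 2) `^ (p / 2) - (1 - u) `^ p) ^+ 2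
    / (((1 - u) `^ (2 * n) * u ^+ 2 + (1 - u) ^+ 2 * u `^ (2 * n))
       * ((1 - u) `^ p * u `^ n + (1 - u) `^ n * u `^ p) ^+ 2).
Definition Cpn (R : realType) (p n : R) : R :=
  maximum [set cpn p n z u | z in `[0, 4] & u in `[0, 1]].

Definition Edom (R : realType) : set (R * R) :=
  [set x | -1 <= x.1 <= 1 /\ 0 <= x.2 /\ x <> (1, 1)].
Definition Fpn (R : realType) (p n c xi : R) : R :=
  let q := 1 - 2 * c * xi + xi ^+ 2 in
  if xi == 0 then (1 - c ^+ 2) * (1 + p ^+ 2 * c ^+ 2) / (1 + 3 * delta p n)
  else (1 - c ^+ 2) / (q `^ (p / 2) + xi `^ (p - n) * q `^ (n / 2)) ^+ 2
    * ((1 - xi `^ p) ^+ 2 / q + ((1 - q `^ (p / 2)) / xi) ^+ 2).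

Definition exponents (R : realType) (p n : R) : set R :=
  [set x | exists r s t : nat,
    (t <= 2)%N /\ x = r%:R + (p - n) * s%:R + p * t%:R].
Definition increasing_enumeration (R : realType) (S : set R) (l : nat -> R) :=
  l 0%N = 0 /\ (forall i j : nat, (i < j)%N -> l i < l j) /\ range l = S.
Definition lambda (R : realType) (p n : R) : nat -> R :=
  xget (fun=> 0) (increasing_enumeration (exponents p n)).

(* [PR.1 j] is P_pnj and [PR.2 j] is R_pnj (j >= 1). On [-1, 1] and on [Edom]
   respectively there is exactly one such pair of sequences, which
   [expansion] picks; its values elsewhere, and [PR.2 0], are junk. *)
Definition is_expansion (R : realType) (p n : R)
    (PR : (nat -> R -> R) * (nat -> R * R -> R)) : Prop :=
  [/\ forall j, {within `[-1, 1], continuous (PR.1 j)},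
      forall j, {within @Edom R, continuous (PR.2 j.+1)} &
      forall (m : nat) (c xi : R), Edom (c, xi) ->
        Fpn p n c xi = \sum_(j < m.+1) PR.1 j c * xi `^ lambda p n j
                       + PR.2 m.+1 (c, xi) * xi `^ lambda p n m.+1].
Definition expansion (R : realType) (p n : R) :
    (nat -> R -> R) * (nat -> R * R -> R) :=
  xget (fun _ _ => 0, fun _ _ => 0) (is_expansion p n).
Definition Ppn (R : realType) (p n : R) (j : nat) (c : R) : R :=
  (expansion p n).1 j c.
Definition Rpn (R : realType) (p n : R) (j : nat) (c xi : R) : R :=
  (expansion p n).2 j (c, xi).

Definition gterm (R : realType) (p n : R) (d : nat) (k h l : 'rV[int]_d) : R :=
  (znorm R k `^ p - znorm R l `^ p) ^+ 2 * Pnorm R h l ^+ 2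
  / (znorm R h `^ p * znorm R l `^ (n - 1)
     + znorm R h `^ n * znorm R l `^ (p - 1)) ^+ 2.

(* Extended-real valued, since convergence is not known beforehand. *)
Definition Gfull (R : realType) (p n : R) (d : nat) (k : 'rV[int]_d) : \bar R :=
  (4%:E * \esum_(h in Z0k k) (gterm p n k h (k - h))%:E)%E.
Definition Gtrunc (R : realType) (p n rho : R) (d : nat) (k : 'rV[int]_d) : R :=
  4 * \sum_(h \in Z0k k `&` [set h | znorm R h < rho \/ znorm R (k - h) < rho])
        gterm p n k h (k - h).
Definition dG (R : realType) (p n rho : R) (d : nat) : R :=
  2 * pi `^ (d%:R / 2) * Cpn p n / Gamma (d%:R / 2)
  * \sum_(i < d) ('C(d.-1, i))%:R
      * (d%:R `^ (d%:R / 2 - 1 / 2 - i%:R / 2)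
         / ((2 * n - 3 - i%:R)
            * (rho - 2 * Num.sqrt d%:R) `^ (2 * n - 3 - i%:R))).

Definition calP (R : realType) (p n rho : R) (d : nat) (j : nat)
    (u : 'rV[R]_d) : R :=
  \sum_(h \in @Z0 d `&` zball rho)
    Ppn p n j (cos (angle (rvec R h) u))
    / znorm R h `^ (2 * n - 2 - lambda p n j).
Definition Wpn (R : realType) (p n mu : R) (m : nat) : R :=
  maximum [set Rpn p n m.+1 c xi | c in `[-1, 1] & xi in `[0, 1 / mu]].
Definition Zpn (R : realType) (p n rho : R) (d m : nat) : R :=
  \sum_(h \in @Z0 d `&` zball rho)
    1 / znorm R h `^ (2 * n - 2 - lambda p n m.+1).
Definition Gfrak (R : realType) (p n rho mu : R) (d m : nat) : R :=
  4 * maximum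
    [set \sum_(j < m.+1) eps `^ lambda p n j * calP p n rho j u
         + eps `^ lambda p n m.+1 * (Wpn p n mu m * Zpn p n rho d m)
      | u in @sphere R d & eps in `[0, 1 / (mu * rho)]].

(* Main.v *)
(* Since a is orthogonal to h, [Pnorm R h l] is at most the sine of the angle of h
   and l. Inserting this bound turns the term of index h, with l = k - h, into
   c_pn(z, u) (|h|^(2-2n) + |l|^(2-2n)) / 8 with z in [0, 4] and u in [0, 1], so four
   times the sum over |h|, |l| >= rho is at most C_pn sum |h|^(2-2n), |h| >= rho. A
   term of the latter sum is compared with the values of a radial function on the
   unit cube with corner h. No measure on R^d is needed: slicing along a coordinate
   and the substitution x = r t reduce the sum to one-dimensional integrals, up to a
   constant that depends only on d and is read off the Gaussian.

   The same bound gives F_pn for the terms with |h| < rho. Near xi = 0 the function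
   F_pn is built from x^a, sums, products and composition with Taylor-expandable
   functions, which all preserve the existence of asymptotic expansions, uniform in
   c, in monomials Q(c) xi^(r + (p-n) s + p t) with polynomial Q. Collecting equal
   exponents yields the coefficients, uniform convergence the continuity of the
   remainders at xi = 0, and uniqueness identifies them with those of [expansion].
   The maxima exist by compactness. *)

Require Import Defs.
From HB Require Import structures.
From mathcomp Require Import all_boot all_order all_algebra.
From mathcomp Require Import perm complex.
From mathcomp Require Import all_classical all_reals all_analysis.
From mathcomp Require Import measurable_realfun.
From mathcomp Require Import zify ring lra.
From mathcomp Require mpoly.

Set Implicit Arguments.
Unset Strict Implicit.
Unset Printing Implicit Defensive.

Import Order.TTheory GRing.Theory Num.Theory.
Import numFieldTopology.Exports numFieldNormedType.Exports.

Local Open Scope classical_set_scope.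
Local Open Scope ring_scope.

(** The number rho - 2 sqrt d charges the diameter sqrt d of a unit cube twice: once because |h| >=
    rho only puts the points of its cube at distance rho - sqrt d from the origin, once because |h|
    is compared with |x| for x in the cube. The binomial sum in [dG] comes from expanding r^(d-1) in
    powers of r - sqrt d under the radial integral. The strict inequality in (i) requires a nonzero
    term with |h|, |k - h| >= rho, hence a positive lower bound for [Pnorm], so its defining minimum
    must be known to be attained. Near xi = 0, F_pn is a quadratic polynomial in xi^p whose
    coefficients only involve xi and xi^(p-n); this is why t ranges over {0, 1, 2}. Expansions are
    built order by order with unrelated coefficients, and linear independence of the powers of xi
    reconciles the orders. For p = n the power xi^(p-n) is 1 and does not become small, which
    accounts for the factor 1 + 3 delta = 4. *)

(** * Powers with real exponents: continuity, limits, derivatives *)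

(** The truncation at 0 discards the default values of powers with negative base; p = 0 is included
    because 0^0 = 1. *)
Lemma powR_max_continuous (R : realType) (p : R) : 0 <= p ->
  continuous (fun x : R => Num.max x 0 `^ p).
Proof.
rewrite le_eqVlt => /predU1P[<- x|p0 x].
  rewrite (_ : (fun _ => _) = cst 1); first exact: cvg_cst.
  by apply/funext => y; rewrite powRr0.
have [x0|x0|<-] := ltgtP 0 x.
- have cp : {for x, continuous (@powR R ^~ p)}.
    by apply: differentiable_continuous; apply/derivable1_diffP; apply: derivable_powR; rewrite in_itv /= andbT.
  rewrite /continuous_at (max_idPl (ltW x0)).
  apply: cvg_trans cp; apply: near_eq_cvg; near=> y.
  rewrite (max_idPl _)//; apply: ltW; near: y; exact: lt_nbhsr.
- rewrite /continuous_at (max_idPr (ltW x0)).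
  apply: cvg_near_cst; near=> y.
  by rewrite (max_idPr _)//; apply: ltW; near: y; apply: (cvgr_lt x) => //; exact: cvg_id.
- rewrite /continuous_at maxxx powR0 ?gt_eqF//.
  apply/cvgrPdist_lt => e e0.
  have e1 : 0 < e `^ p^-1 by exact: powR_gt0.
  near=> y.
  rewrite sub0r normrN ger0_norm ?powR_ge0//.
  have [y0|y0] := leP y 0; first by rewrite powR0// gt_eqF.
  rewrite -[ltRHS](powRr1 (ltW e0)) -(mulVf (lt0r_neq0 p0)) powRrM.
  rewrite gt0_ltr_powR// ?nnegrE ?(ltW y0) ?(ltW e1)//.
  by near: y; apply: (cvgr_lt (0 : R)) => //; exact: cvg_id.
Unshelve. all: by end_near. Qed.

Lemma cvg_powR (R : realType) (T : Type) (F : set_system T) {FF : Filter F} (f : T -> R) (a p : R) :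
  0 < a -> f x @[x --> F] --> a -> f x `^ p @[x --> F] --> a `^ p.
Proof.
move=> a0 fa; apply: (@continuous_cvg _ _ _ _ _ _ (@powR R ^~ p)) fa.
by apply: differentiable_continuous; apply/derivable1_diffP; apply: derivable_powR; rewrite in_itv /= andbT.
Qed.

Lemma cvg_powRN_pinfty (R : realType) (T : Type) (F : set_system T) {FF : Filter F} (f : T -> R) (a : R) :
  0 < a -> f x @[x --> F] --> +oo -> f x `^ (- a) @[x --> F] --> 0.
Proof.
move=> a0 foo; apply/cvgrPdist_le => e e0.
have f1 : \forall x \near F, e `^ (- a^-1) <= f x by move/cvgryPge : foo; apply.
have f2 : \forall x \near F, 1 <= f x by move/cvgryPge : foo; apply.
near=> x.
have x1 : e `^ (- a^-1) <= f x by near: x.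
have x2 : 1 <= f x by near: x.
rewrite sub0r normrN ger0_norm ?powR_ge0// powRN.
rewrite -[leRHS]invrK lef_pV2 ?posrE ?invr_gt0 ?powR_gt0//; last lra.
apply: (@le_trans _ _ ((e `^ (- a^-1)) `^ a)).
  by rewrite -powRrM mulNr mulVf ?gt_eqF// powRN powRr1// ltW.
by rewrite ge0_ler_powR ?nnegrE ?powR_ge0// ?(ltW a0)//; lra.
Unshelve. all: by end_near. Qed.

Lemma is_derive_comp1 (R : realType) (f g : R -> R) (x df dg : R) :
  is_derive x 1 f df -> is_derive (f x) 1 g dg ->
  is_derive x 1 (fun y => g (f y)) (dg * df).
Proof.
move=> [df1 df2] [dg1 dg2].
split.
  apply/derivable1_diffP; apply: differentiable_comp; exact/derivable1_diffP.
by rewrite -derive1E (derive1_comp df1 dg1) !derive1E df2 dg2.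
Qed.

Lemma is_derive_powR_shift (R : realType) (c x a : R) : 0 < x + c ->
  is_derive x 1 (fun r => (r + c) `^ a) (a * (x + c) `^ (a - 1)).
Proof.
move=> xc.
have d1 : is_derive x 1 (fun r => r + c) 1.
  by apply: is_derive_eq; rewrite addr0.
have d2 := @is_derive1_powR R a (x + c) xc.
by have := is_derive_comp1 d1 d2; rewrite mulr1.
Qed.

Lemma cvg_sumr (R : realType) (I T : Type) (F : set_system T) {FF : Filter F} (r : seq I) (P : pred I)
    (f : I -> T -> R) (a : I -> R) :
  (forall i, P i -> f i x @[x --> F] --> a i) ->
  \sum_(i <- r | P i) f i x @[x --> F] --> \sum_(i <- r | P i) a i.
Proof.
move=> fa; elim: r => [|i r IH].
  by under eq_fun do rewrite big_nil; rewrite big_nil; exact: cvg_cst.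
under eq_fun do rewrite big_cons; rewrite big_cons.
by case: ifPn => // Pi; apply: cvgD IH; exact: fa.
Qed.

(** * Lattice vectors and the norm of P_hl *)

Section dot.
Variables (K : comNzRingType) (d : nat).
Implicit Types a b c : 'rV[K]_d.

Lemma dotvC a b : dotv a b = dotv b a.
Proof. by apply: eq_bigr => i _; rewrite mulrC. Qed.

Lemma dotvDl a b c : dotv (a + b) c = dotv a c + dotv b c.
Proof. by rewrite -big_split; apply: eq_bigr => i _; rewrite mxE mulrDl. Qed.

Lemma dotvZl x a b : dotv (x *: a) b = x * dotv a b.
Proof. by rewrite mulr_sumr; apply: eq_bigr => i _; rewrite mxE mulrA. Qed.

Lemma dotvNl a b : dotv (- a) b = - dotv a b.
Proof. by rewrite -scaleN1r dotvZl mulN1r. Qed.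

Lemma dotvBl a b c : dotv (a - b) c = dotv a c - dotv b c.
Proof. by rewrite dotvDl dotvNl. Qed.

Lemma dotvDr a b c : dotv a (b + c) = dotv a b + dotv a c.
Proof. by rewrite dotvC dotvDl !(dotvC a). Qed.

Lemma dotvZr x a b : dotv a (x *: b) = x * dotv a b.
Proof. by rewrite dotvC dotvZl dotvC. Qed.

Lemma dotvNr a b : dotv a (- b) = - dotv a b.
Proof. by rewrite dotvC dotvNl dotvC. Qed.

Lemma dotvBr a b c : dotv a (b - c) = dotv a b - dotv a c.
Proof. by rewrite dotvDr dotvNr. Qed.

Lemma dot0v a : dotv 0 a = 0.
Proof. by rewrite /dotv big1// => i _; rewrite mxE mul0r. Qed.

Lemma dotv_map (L : comNzRingType) (f : {rmorphism K -> L}) a b :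
  dotv (map_mx f a) (map_mx f b) = f (dotv a b).
Proof. by rewrite rmorph_sum; apply: eq_bigr => i _; rewrite !mxE rmorphM. Qed.

End dot.

Section rnorm.
Variable (R : realType).

Lemma dotvv_ge0 d (x : 'rV[R]_d) : 0 <= dotv x x.
Proof. by apply: sumr_ge0 => i _; rewrite -expr2 sqr_ge0. Qed.

Lemma dotvv_eq0 d (x : 'rV[R]_d) : (dotv x x == 0) = (x == 0).
Proof.
apply/eqP/eqP => [|->]; last by rewrite dot0v.
move=> /eqP; rewrite psumr_eq0; last by move=> i _; rewrite -expr2 sqr_ge0.
move=> /allP H; apply/rowP => i; rewrite mxE.
by have := H i (mem_index_enum i); rewrite /= -expr2 sqrf_eq0 => /eqP.
Qed.

Lemma rnorm_ge0 d (x : 'rV[R]_d) : 0 <= rnorm x.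
Proof. exact: sqrtr_ge0. Qed.

Lemma rnorm_sqr d (x : 'rV[R]_d) : rnorm x ^+ 2 = dotv x x.
Proof. by rewrite sqr_sqrtr// dotvv_ge0. Qed.

Lemma rnorm_eq0 d (x : 'rV[R]_d) : (rnorm x == 0) = (x == 0).
Proof. by rewrite -sqrf_eq0 rnorm_sqr dotvv_eq0. Qed.

Lemma rnorm_gt0 d (x : 'rV[R]_d) : (0 < rnorm x) = (x != 0).
Proof. by rewrite lt0r rnorm_ge0 andbT rnorm_eq0. Qed.

Lemma rnormN d (x : 'rV[R]_d) : rnorm (- x) = rnorm x.
Proof. by rewrite /rnorm dotvNl dotvNr opprK. Qed.

Lemma rnormZ d t (x : 'rV[R]_d) : rnorm (t *: x) = `|t| * rnorm x.
Proof. by rewrite /rnorm dotvZl dotvZr mulrA -expr2 sqrtrM ?sqr_ge0// sqrtr_sqr. Qed.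

Lemma dotv_CS d (x y : 'rV[R]_d) : dotv x y ^+ 2 <= dotv x x * dotv y y.
Proof.
have [->|y0] := eqVneq y 0; first by rewrite dotvC !dot0v expr0n mulr0.
have yy : 0 < dotv y y by rewrite lt0r dotvv_eq0 y0 dotvv_ge0.
have := dotvv_ge0 (x - (dotv x y / dotv y y) *: y).
rewrite !(dotvBl, dotvBr, dotvZl, dotvZr) (dotvC y x).
rewrite (_ : _ - _ = dotv x x - dotv x y ^+ 2 / dotv y y); last by field; rewrite gt_eqF.
by rewrite subr_ge0 ler_pdivrMr.
Qed.

Lemma dotv_le d (x y : 'rV[R]_d) : `|dotv x y| <= rnorm x * rnorm y.
Proof.
rewrite -(ler_pXn2r (ltn0Sn 1)) ?nnegrE ?mulr_ge0 ?rnorm_ge0//.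
by rewrite exprMn !rnorm_sqr real_normK ?num_real// dotv_CS.
Qed.

Lemma rnormD d (x y : 'rV[R]_d) : rnorm (x + y) <= rnorm x + rnorm y.
Proof.
rewrite -(ler_pXn2r (ltn0Sn 1)) ?nnegrE ?addr_ge0 ?rnorm_ge0//.
rewrite sqrrD !rnorm_sqr dotvDl !dotvDr (dotvC y x).
have := le_trans (ler_norm _) (dotv_le x y); rewrite -mulr_natl; lra.
Qed.

Lemma rnormB d (x y : 'rV[R]_d) : rnorm x - rnorm y <= rnorm (x - y).
Proof. by rewrite lerBlDr; apply: le_trans (rnormD _ _); rewrite subrK. Qed.

Lemma rnorm_coord d (x : 'rV[R]_d) j : `|x 0 j| <= rnorm x.
Proof.
rewrite -(ler_pXn2r (ltn0Sn 1)) ?nnegrE ?rnorm_ge0//.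
rewrite rnorm_sqr real_normK ?num_real// /dotv (bigD1 j)//= -expr2 lerDl.
by apply: sumr_ge0 => i _; rewrite -expr2 sqr_ge0.
Qed.

Lemma rnorm_le_sqrt d (x : 'rV[R]_d) t : 0 <= t -> (forall j, `|x 0 j| <= t) ->
  rnorm x <= t * Num.sqrt d%:R.
Proof.
move=> t0 xt.
rewrite -(ler_pXn2r (ltn0Sn 1)) ?nnegrE ?mulr_ge0 ?rnorm_ge0 ?sqrtr_ge0//.
rewrite rnorm_sqr exprMn sqr_sqrtr ?ler0n//.
apply: (@le_trans _ _ (\sum_(i < d) t ^+ 2)).
  apply: ler_sum => i _; rewrite -expr2 -[leLHS]real_normK ?num_real//.
  by rewrite ler_pXn2r ?nnegrE.
by rewrite sumr_const card_ord mulr_natr.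
Qed.

Lemma rvecB d (h k : 'rV[int]_d) : rvec R (h - k) = rvec R h - rvec R k.
Proof. by rewrite /rvec map_mxB. Qed.

Lemma rvecD d (h k : 'rV[int]_d) : rvec R (h + k) = rvec R h + rvec R k.
Proof. by rewrite /rvec map_mxD. Qed.

Lemma rvec_eq0 d (h : 'rV[int]_d) : (rvec R h == 0) = (h == 0).
Proof.
apply/eqP/eqP => [/rowP e|->]; last by rewrite /rvec map_mx0.
by apply/rowP => j; have /eqP := e j; rewrite !mxE intr_eq0 => /eqP.
Qed.

Lemma znorm_ge0 d (h : 'rV[int]_d) : 0 <= znorm R h.
Proof. exact: rnorm_ge0. Qed.

Lemma znorm_gt0 d (h : 'rV[int]_d) : (0 < znorm R h) = (h != 0).
Proof. by rewrite rnorm_gt0 rvec_eq0. Qed.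

Lemma znormB_ge d (h k : 'rV[int]_d) : znorm R k - znorm R h <= znorm R (k - h).
Proof. by rewrite /znorm rvecB rnormB. Qed.

Lemma zball_finite d (rho : R) : finite_set (@zball R d rho).
Proof.
pose N := `|Num.ceil rho|%N.
(* The coordinates of a lattice point of the ball lie in [-N, N]; the shift by N codes them by
   ordinals below 2N + 1. *)
pose f (z : 'rV['I_(N.*2.+1)]_d) : 'rV[int]_d := \row_j ((z 0 j)%:Z - N%:Z).
have fT : finite_set (range f) by apply: finite_image; exact: finite_finset.
apply: sub_finite_set fT => h /= hr.
have hj j : `|h 0 j| <= N%:Z.
  have := le_lt_trans (rnorm_coord (rvec R h) j) hr.
  rewrite mxE -intr_norm => hjr.
  have r0 : 0 <= rho by apply: ltW; apply: le_lt_trans hjr; rewrite ler0z.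
  rewrite /N gez0_abs ?ceil_ge0 ?(lt_le_trans _ r0)//.
  by rewrite -(ler_int R); apply: ltW; apply: lt_le_trans hjr _; exact: ceil_ge.
pose g j := absz (h 0 j + N%:Z).
have gj j : (g j < N.*2.+1)%N.
  rewrite ltnS /g -lez_nat abszE -addnn PoszD.
  by apply: le_trans (ler_normD _ _) _; rewrite lerD// ger0_norm.
exists (\row_j Ordinal (gj j)) => //; apply/rowP => j; rewrite !mxE /= /g.
have h0 : 0 <= h 0 j + N%:Z by have := hj j; rewrite ler_norml; lia.
by rewrite gez0_abs// addrK.
Qed.

End rnorm.

(** * The projection onto a hyperplane, in real coordinates *)

Section projperp.
Variable (R : realType).
Local Notation C := R[i].

Lemma dotv_mulmx (K : comNzRingType) d (a b : 'rV[K]_d) : dotv a b = (a *m b^T) 0 0.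
Proof. by rewrite mxE; apply: eq_bigr => i _; rewrite mxE. Qed.

Lemma dotv_cvec d (h l : 'rV[int]_d) : dotv (cvec R h) (cvec R l) = (dotv (rvec R h) (rvec R l))%:C%C.
Proof.
rewrite /cvec /rvec.
rewrite (dotv_map (intr : {rmorphism int -> C})) (dotv_map (intr : {rmorphism int -> R})).
by rewrite /= (rmorph_int (real_complex R)).
Qed.

Lemma cvec_eq0 d (h : 'rV[int]_d) : (cvec R h == 0) = (h == 0).
Proof.
apply/eqP/eqP => [/rowP e|->]; last by rewrite /cvec map_mx0.
by apply/rowP => j; have /eqP := e j; rewrite !mxE intr_eq0 => /eqP.
Qed.

(** Because k has real entries, the kernel of the bilinear form against k is also its Hermitian
    complement, so the projection subtracts the component along k. For k = 0 the kernel is the whole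
    space and the subtracted term is 0. *)
Lemma projperpE d (k : 'rV[int]_d) (b : 'rV[C]_d) :
  projperp k b = b - (dotv b (cvec R k) / dotv (cvec R k) (cvec R k)) *: cvec R k.
Proof.
rewrite /projperp; set K := cvec R k; set U := kermx _.
have [k0|k0] := eqVneq k 0.
  have K0 : K = 0 by apply/eqP; rewrite cvec_eq0 k0.
  rewrite K0 scaler0 subr0; apply: proj_ortho_id.
  by apply/sub_kermxP; rewrite K0 trmx0 mulmx0.
have KK : dotv K K != 0.
  rewrite dotv_cvec eq_complex /= negb_and.
  by rewrite dotvv_eq0 rvec_eq0 k0.
set t := _ / _.
rewrite -{1}(subrK (t *: K) b) mulmxDl proj_ortho_id; last first.
  apply/sub_kermxP; apply/matrixP => i j; rewrite !ord1 -dotv_mulmx mxE.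
  by rewrite dotvBl dotvZl divfK// subrr.
rewrite proj_ortho_0 ?addr0//.
apply: scalemx_sub.
rewrite orthomx1E; apply/eqP.
have UK : U *m K^T = 0 by exact: mulmx_ker.
have KE : map_mx Num.conj K = K.
  by apply/rowP => j; rewrite !mxE rmorph_int.
have := congr1 (fun M => map_mx Num.conj (M^T)) UK.
by rewrite trmx_mul trmxK map_mxM KE trmx0 map_mx0.
Qed.

Definition re_row d (a : 'rV[C]_d) : 'rV[R]_d := map_mx (@complex.Re R) a.
Definition im_row d (a : 'rV[C]_d) : 'rV[R]_d := map_mx (@complex.Im R) a.

Lemma cnorm_sqr d (a : 'rV[C]_d) : cnorm a ^+ 2 = dotv (re_row a) (re_row a) + dotv (im_row a) (im_row a).
Proof.
rewrite sqr_sqrtr; last first.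
  rewrite raddf_sum; apply: sumr_ge0 => i _; rewrite mxE.
  case: (a 0 i) => x y /=; rewrite mulNr opprK -!expr2.
  by rewrite addr_ge0 ?sqr_ge0.
rewrite raddf_sum -big_split; apply: eq_bigr => i _; rewrite !mxE.
by case: (a 0 i) => x y /=; rewrite mulNr opprK.
Qed.

Lemma cnorm_ge0 d (a : 'rV[C]_d) : 0 <= cnorm a.
Proof. exact: sqrtr_ge0. Qed.

Lemma Re_dotv_cvec d (a : 'rV[C]_d) h :
  complex.Re (dotv a (cvec R h)) = dotv (re_row a) (rvec R h).
Proof.
rewrite raddf_sum; apply: eq_bigr => i _; rewrite !mxE -(rmorph_int (real_complex R)).
by case: (a 0 i) => x y /=; rewrite mulr0 subr0.
Qed.

Lemma Im_dotv_cvec d (a : 'rV[C]_d) h :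
  complex.Im (dotv a (cvec R h)) = dotv (im_row a) (rvec R h).
Proof.
rewrite raddf_sum; apply: eq_bigr => i _; rewrite !mxE -(rmorph_int (real_complex R)).
by case: (a 0 i) => x y /=; rewrite mulr0 add0r.
Qed.

(** Projection along a real vector acts on real and imaginary parts separately, so norms on C^d
    reduce to this real projection. *)
Definition rproj d (k : 'rV[int]_d) (x : 'rV[R]_d) : 'rV[R]_d :=
  x - (dotv x (rvec R k) / dotv (rvec R k) (rvec R k)) *: rvec R k.

Lemma re_projperp d k (b : 'rV[C]_d) : re_row (projperp k b) = rproj k (re_row b).
Proof.
rewrite projperpE /rproj dotv_cvec -Re_dotv_cvec; apply/rowP => i; rewrite !mxE.
rewrite -!(rmorph_int (real_complex R)) -fmorphV.
case: (b 0 i) => x y; case: (dotv _ _) => u v /=.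
by rewrite !mulr0 !subr0.
Qed.

Lemma im_projperp d k (b : 'rV[C]_d) : im_row (projperp k b) = rproj k (im_row b).
Proof.
rewrite projperpE /rproj dotv_cvec -Im_dotv_cvec; apply/rowP => i; rewrite !mxE.
rewrite -!(rmorph_int (real_complex R)) -fmorphV.
case: (b 0 i) => x y; case: (dotv _ _) => u v /=.
by rewrite !mulr0 !add0r.
Qed.

Lemma cnormZ_sqr d (c : C) (a : 'rV[C]_d) :
  cnorm (c *: a) ^+ 2 = (complex.Re c ^+ 2 + complex.Im c ^+ 2) * cnorm a ^+ 2.
Proof.
rewrite !cnorm_sqr -!big_split mulr_sumr; apply: eq_bigr => i _; rewrite !mxE.
by case: c => u v; case: (a 0 i) => x y /=; ring.
Qed.

Lemma rproj_sqr d (k : 'rV[int]_d) (x : 'rV[R]_d) :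
  dotv (rproj k x) (rproj k x) =
  dotv x x - dotv x (rvec R k) ^+ 2 / dotv (rvec R k) (rvec R k).
Proof.
rewrite /rproj; have [->|k0] := eqVneq k 0.
  have -> : rvec R (0 : 'rV[int]_d) = 0 by apply/eqP; rewrite rvec_eq0.
  by rewrite scaler0 subr0 dot0v invr0 mulr0 subr0.
have KK : dotv (rvec R k) (rvec R k) != 0 by rewrite dotvv_eq0 rvec_eq0.
rewrite !(dotvBl, dotvBr, dotvZl, dotvZr) (dotvC _ x).
by field.
Qed.

Lemma rproj_le d (k : 'rV[int]_d) (x : 'rV[R]_d) : dotv (rproj k x) (rproj k x) <= dotv x x.
Proof. by rewrite rproj_sqr gerBl mulr_ge0 ?sqr_ge0// invr_ge0 dotvv_ge0. Qed.

Lemma dotv_rproj d (k : 'rV[int]_d) (x y : 'rV[R]_d) :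
  dotv x (rvec R k) = 0 -> dotv x (rproj k y) = dotv x y.
Proof. by move=> xk; rewrite dotvBr dotvZr xk mulr0 subr0. Qed.

Lemma Pmap_sqr d (h l : 'rV[int]_d) (a b : 'rV[C]_d) :
  cnorm (Pmap h l a b) ^+ 2 =
  (dotv (re_row a) (rvec R l) ^+ 2 + dotv (im_row a) (rvec R l) ^+ 2) / znorm R l ^+ 2
  * (dotv (rproj (h + l) (re_row b)) (rproj (h + l) (re_row b))
     + dotv (rproj (h + l) (im_row b)) (rproj (h + l) (im_row b))).
Proof.
rewrite /Pmap cnormZ_sqr cnorm_sqr re_projperp im_projperp; congr (_ * _).
rewrite -Re_dotv_cvec -Im_dotv_cvec -fmorphV.
by case: (dotv a _) => u v /=; rewrite !mulr0 subr0 add0r !exprMn -mulrDl exprVn.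
Qed.

End projperp.

(** * The norm of P_hl: upper bound, attainment, isometries *)

Section Pnorm.
Variable (R : realType).
Local Notation C := R[i].
Local Notation v := (rvec R).

Definition Pbounds d (h l : 'rV[int]_d) : set R := [set Q : R | 0 <= Q /\
    forall a b : 'rV[C]_d, perp h a -> perp l b ->
      cnorm (Pmap h l a b) <= Q * cnorm a * cnorm b].

Lemma PnormE d (h l : 'rV[int]_d) : Pnorm R h l = minimum (Pbounds h l).
Proof. by []. Qed.

Definition sin2 d (h l : 'rV[int]_d) : R :=
  1 - dotv (v h) (v l) ^+ 2 / (znorm R h ^+ 2 * znorm R l ^+ 2).

Lemma sin2_ge0 d (h l : 'rV[int]_d) : 0 <= sin2 h l.
Proof.
rewrite subr_ge0.
have := dotv_CS (v h) (v l); rewrite -!rnorm_sqr -!/(znorm _ _) => H.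
have [h0|h0] := eqVneq (znorm R h ^+ 2 * znorm R l ^+ 2) 0; first by rewrite h0 invr0 mulr0.
by rewrite ler_pdivrMr ?mul1r// lt0r h0 mulr_ge0 ?sqr_ge0.
Qed.

Lemma perp_re d (h : 'rV[int]_d) (a : 'rV[C]_d) : perp h a ->
  dotv (re_row a) (v h) = 0 /\ dotv (im_row a) (v h) = 0.
Proof. by rewrite /perp /= dotvC -Re_dotv_cvec -Im_dotv_cvec => ->. Qed.

(** As x is orthogonal to h, its product with l only sees the component of l orthogonal to h, whose
    squared length is |l|^2 times the squared sine; the rest is Cauchy-Schwarz. *)
Lemma dotv_perp_le d (h l : 'rV[int]_d) (x : 'rV[R]_d) : dotv x (v h) = 0 -> l != 0 ->
  dotv x (v l) ^+ 2 / znorm R l ^+ 2 <= sin2 h l * dotv x x.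
Proof.
move=> xh l0.
have L0 : 0 < znorm R l ^+ 2 by rewrite exprn_gt0// znorm_gt0.
rewrite ler_pdivrMr// -(dotv_rproj _ xh); apply: le_trans (dotv_CS _ _) _.
rewrite (mulrC (sin2 _ _)) -mulrA ler_wpM2l ?dotvv_ge0//.
rewrite rproj_sqr /sin2 -!rnorm_sqr -!/(znorm _ _) (dotvC (v l)) mulrBl mul1r.
rewrite lerD2l lerN2 invfM -mulrA divfK ?gt_eqF//.
Qed.

Lemma Pbounds_sin d (h l : 'rV[int]_d) : l != 0 -> Pbounds h l (Num.sqrt (sin2 h l)).
Proof.
move=> l0; split; first exact: sqrtr_ge0.
move=> a b /perp_re[ra ia] _.
rewrite -(ler_pXn2r (ltn0Sn 1)) ?nnegrE ?mulr_ge0 ?cnorm_ge0 ?sqrtr_ge0//.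
rewrite !exprMn [Num.sqrt (sin2 _ _) ^+ 2]sqr_sqrtr ?sin2_ge0// Pmap_sqr !cnorm_sqr.
apply: ler_pM.
- by rewrite mulr_ge0 ?addr_ge0 ?sqr_ge0// invr_ge0 sqr_ge0.
- by rewrite addr_ge0 ?dotvv_ge0.
- by rewrite mulrDl mulrDr lerD// dotv_perp_le.
- by rewrite lerD// rproj_le.
Qed.

Lemma Pnorm_ge0 d (h l : 'rV[int]_d) : 0 <= Pnorm R h l.
Proof.
by rewrite PnormE /minimum; case: xgetP => [y -> [[]]|].
Qed.

Lemma Pnorm_sin d (h l : 'rV[int]_d) : l != 0 -> Pnorm R h l ^+ 2 <= sin2 h l.
Proof.
move=> l0; rewrite -[leRHS]sqr_sqrtr ?sin2_ge0//.
rewrite ler_pXn2r ?nnegrE ?Pnorm_ge0 ?sqrtr_ge0//.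
(* Without a least bound [minimum] returns 0, which is also below the sine. *)
rewrite PnormE /minimum; case: xgetP => [y -> [_]|_]; last exact: sqrtr_ge0.
by apply; exact: Pbounds_sin.
Qed.

(** For fixed nonzero a and b the condition on Q is a closed half-line, and when a or b is zero it
    does not depend on Q, so the infimum of the admissible Q is admissible. Lower bounds for [Pnorm]
    rest on this. *)
Lemma Pnorm_attained d (h l : 'rV[int]_d) : l != 0 -> Pbounds h l (Pnorm R h l).
Proof.
move=> l0; set A := Pbounds h l.
have A0 : A !=set0 by exists (Num.sqrt (sin2 h l)); exact: Pbounds_sin.
have Alb : lbound A 0 by move=> x [].
have Ai : has_inf A by split => //; exists 0.
suff H : (A `&` lbound A) (inf A).
  by rewrite PnormE /minimum; case: xgetP => [y -> []//|/(_ _ H)].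
split; last by move=> x Ax; apply: ge_inf => //; exists 0.
split; first exact: lb_le_inf.
move=> a b pa pb.
have := cnorm_ge0 a; rewrite le_eqVlt => /predU1P[a0|a0].
  have [x Ax] := A0; have := Ax.2 a b pa pb.
  by rewrite -a0 !mulr0 !mul0r.
have := cnorm_ge0 b; rewrite le_eqVlt => /predU1P[b0|b0].
  have [x Ax] := A0; have := Ax.2 a b pa pb.
  by rewrite -b0 !mulr0.
rewrite -mulrA -ler_pdivrMr ?mulr_gt0//; apply: lb_le_inf => // x Ax.
by rewrite ler_pdivrMr ?mulr_gt0// mulrA; exact: Ax.2.
Qed.

Definition cplx_row d (x : 'rV[R]_d) : 'rV[C]_d := map_mx (real_complex R) x.

Lemma re_cplx_row d (x : 'rV[R]_d) : re_row (cplx_row x) = x.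
Proof. by apply/rowP => j; rewrite !mxE. Qed.

Lemma im_cplx_row d (x : 'rV[R]_d) : im_row (cplx_row x) = 0.
Proof. by apply/rowP => j; rewrite !mxE. Qed.

Lemma perp_cplx_row d (h : 'rV[int]_d) (x : 'rV[R]_d) : dotv x (v h) = 0 -> perp h (cplx_row x).
Proof.
move=> xh; rewrite /perp /= dotvC; apply/eqP; rewrite eq_complex /=.
by rewrite Re_dotv_cvec Im_dotv_cvec re_cplx_row im_cplx_row xh dot0v !eqxx.
Qed.

Lemma dotv_rproj0 d (h : 'rV[int]_d) (x : 'rV[R]_d) : h != 0 -> dotv (rproj h x) (v h) = 0.
Proof.
by move=> h0; rewrite dotvBl dotvZl divfK ?subrr// dotvv_eq0 rvec_eq0.
Qed.

(* Test the bound on a = projection of l onto h^perp and b = projection of h + l onto l^perp. *)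
Lemma Pnorm_gt0 d (h l : 'rV[int]_d) :
  dotv (v h) (v l) ^+ 2 < dotv (v h) (v h) * dotv (v l) (v l) ->
  dotv (v (h + l)) (v l) != 0 -> 0 < Pnorm R h l.
Proof.
move=> CS kl.
have h0 : h != 0.
  apply: contraTneq CS => ->; rewrite (_ : v 0 = 0) ?dot0v ?expr0n ?mul0r ?ltxx//.
  by apply/eqP; rewrite rvec_eq0.
have l0 : l != 0.
  apply: contraTneq CS => ->; rewrite (_ : v 0 = 0) ?(dotvC _ 0) ?dot0v ?expr0n ?mulr0 ?ltxx//.
  by apply/eqP; rewrite rvec_eq0.
rewrite lt0r Pnorm_ge0 andbT; apply/eqP => P0.
have [_ /(_ (cplx_row (rproj h (v l))) (cplx_row (rproj l (v (h + l)))))] := Pnorm_attained h l0.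
rewrite P0 !mul0r => H.
have := H (perp_cplx_row (dotv_rproj0 _ h0)) (perp_cplx_row (dotv_rproj0 _ l0)).
move: {H} (cnorm_ge0 (Pmap h l (cplx_row (rproj h (v l))) (cplx_row (rproj l (v (h + l)))))).
move=> c0 c1; have := Pmap_sqr h l (cplx_row (rproj h (v l))) (cplx_row (rproj l (v (h + l)))).
rewrite (_ : cnorm _ = 0); last by apply: le_anti; rewrite c0 c1.
rewrite !re_cplx_row !im_cplx_row (_ : rproj _ 0 = 0); last first.
  by rewrite /rproj dot0v mul0r scale0r subr0.
rewrite !dot0v !expr0n /= !addr0 rproj_sqr /znorm rnorm_sqr.
rewrite rproj_sqr (dotvC (rproj l _)) {2}/rproj dotvBr dotvZr.
rewrite /rproj dotvBl dotvZl rvecD !(dotvDl, dotvDr) (dotvC (v l) (v h)).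
have hh0 : 0 < dotv (v h) (v h) by rewrite lt0r dotvv_eq0 rvec_eq0 h0 dotvv_ge0.
have ll0 : 0 < dotv (v l) (v l) by rewrite lt0r dotvv_eq0 rvec_eq0 l0 dotvv_ge0.
have := dotvv_ge0 (v (h + l)).
move: kl CS; rewrite rvecD !(dotvDl, dotvDr) (dotvC (v l) (v h)).
move: hh0 ll0.
move: (dotv (v h) (v h)) (dotv (v h) (v l)) (dotv (v l) (v l)) => hh hl ll hh0 ll0 kl CS kk0.
have H : 0 < hh * ll - hl ^+ 2 by rewrite subr_gt0.
have kl2 : 0 < (hl + ll) ^+ 2 by rewrite lt0r sqr_ge0 sqrf_eq0 kl.
set kk := hh + hl + (hl + ll) in kk0 *.
(* The Gram determinant is unchanged when h is replaced by h + l. *)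
have G : kk * ll - (hl + ll) ^+ 2 = hh * ll - hl ^+ 2 by rewrite /kk; ring.
set g := hh * ll - hl ^+ 2 in H G.
have kkp : 0 < kk.
  have : 0 < kk * ll by rewrite -(subrK ((hl + ll) ^+ 2) (kk * ll)) G addr_gt0.
  by rewrite pmulr_lgt0.
rewrite (_ : _ - _ * hl = g / hh); last by rewrite /g; field; rewrite gt_eqF.
rewrite -/kk (_ : kk - _ * _ = g / ll); last by rewrite -G; field; rewrite gt_eqF.
rewrite (_ : kk - _ = g / ll); last by rewrite -G; field; rewrite gt_eqF.
(* This is the squared length of the projection of b onto the complement of h + l; it is positive
   because (h + l) . l is nonzero. *)
rewrite (_ : g / ll - _ = g / ll ^+ 2 / kk * (kk * ll - g)); last first.
  by clearbody g kk; field; rewrite !gt_eqF.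
rewrite (_ : kk * ll - g = (hl + ll) ^+ 2); last by rewrite -G; ring.
move=> /esym/eqP; apply/negP; rewrite gt_eqF//.
apply: mulr_gt0; first by rewrite divr_gt0// exprn_gt0// divr_gt0.
by rewrite mulr_gt0// divr_gt0// divr_gt0// exprn_gt0.
Qed.

(** An integral orthogonal matrix maps Z^d onto itself and, being real, preserves both the bilinear
    and the Hermitian product on C^d; test vectors are pulled back by the transpose. Sign changes
    and permutations of coordinates are of this kind. *)
Lemma Pbounds_isometry d (N : 'M[int]_d) (h l : 'rV[int]_d) : N *m N^T = 1%:M ->
  Pbounds h l `<=` Pbounds (h *m N) (l *m N).
Proof.
move=> NN Q [Q0 HQ]; split => // a b pa pb.
pose M : 'M[C]_d := map_mx intr N.
have NN' : N^T *m N = 1%:M by exact: mulmx1C.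
have MM : M *m M^T = 1%:M by rewrite /M map_trmx -map_mxM NN map_mx1.
have MM' : M^T *m M = 1%:M by exact: mulmx1C.
have cM (x : 'rV[int]_d) : cvec R (x *m N) = cvec R x *m M by rewrite /cvec map_mxM.
have dM (x y : 'rV[C]_d) : dotv (x *m M) (y *m M) = dotv x y.
  by rewrite !dotv_mulmx trmx_mul mulmxA -(mulmxA x) MM mulmx1.
have nM (x : 'rV[C]_d) : cnorm (x *m M) = cnorm x.
  rewrite /cnorm map_mxM (_ : map_mx _ M = M) ?dM//.
  by apply/matrixP => i j; rewrite !mxE rmorph_int.
have zM (x : 'rV[int]_d) : znorm R (x *m N) = znorm R x.
  rewrite /znorm /rnorm !dotv_mulmx /rvec map_mxM trmx_mul mulmxA -(mulmxA (map_mx _ x)).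
  by rewrite map_trmx -map_mxM NN map_mx1 mulmx1.
have pM (x : 'rV[int]_d) : perp (x *m N) `<=` [set a' | perp x (a' *m M^T)].
  by move=> a'; rewrite /perp /= cM -(dM _ (a' *m M^T)) -mulmxA MM' mulmx1.
have := HQ _ _ (pM _ _ pa) (pM _ _ pb).
have aM (x : 'rV[C]_d) : x *m M^T *m M = x by rewrite -mulmxA MM' mulmx1.
have -> : cnorm (a *m M^T) = cnorm a by rewrite -[LHS]nM aM.
have -> : cnorm (b *m M^T) = cnorm b by rewrite -[LHS]nM aM.
suff -> : Pmap (h *m N) (l *m N) a b = Pmap h l (a *m M^T) (b *m M^T) *m M by rewrite nM.
rewrite /Pmap zM -scalemxAl !projperpE -mulmxDl cM.
rewrite -[dotv (a *m M^T) _]dM aM; congr (_ *: _).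
by rewrite mulmxBl aM -scalemxAl cM dM -[dotv (b *m M^T) _]dM aM.
Qed.

Lemma Pnorm_isometry d (N : 'M[int]_d) (h l : 'rV[int]_d) : N *m N^T = 1%:M ->
  Pnorm R (h *m N) (l *m N) = Pnorm R h l.
Proof.
move=> NN; rewrite !PnormE; congr minimum; apply/seteqP; split; last exact: Pbounds_isometry.
have NN' : N^T *m N = 1%:M by exact: mulmx1C.
(* The reverse inclusion is the same statement for the inverse matrix. *)
have := @Pbounds_isometry d N^T (h *m N) (l *m N).
by rewrite -!mulmxA NN !mulmx1; apply; rewrite trmxK.
Qed.

End Pnorm.

(** * Lattice tail sums *)

Section scaling.
Context {R : realType}.
Local Notation mu := (@lebesgue_measure R).
Local Open Scope ereal_scope.

(** Both sides are measures in A that agree on half-open intervals, since the preimage of (b, c] is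
    (b/a, c/a]. *)
Lemma lebesgue_measure_scale (a : R) (A : set (measurableTypeR R)) : (0 < a)%R -> measurable A ->
  mu A = a%:E * pushforward mu ( *%R a : _ -> measurableTypeR R) A.
Proof.
move=> a0 mA.
have ma : measurable_fun setT ( *%R a : measurableTypeR R -> measurableTypeR R).
  exact: mulrl_measurable.
pose f : {mfun (measurableTypeR R) >-> (measurableTypeR R)} := HB.pack ( *%R a : measurableTypeR R -> measurableTypeR R) (isMeasurableFun.Build _ _ _ _ _ ma).
have := @lebesgue_measure_unique R (mscale (NngNum (ltW a0)) (pushforward mu f)).
move=> H0; apply: (H0 ma _ A mA) => _ [[b c]] _ <-.
rewrite /mscale /= /pushforward /=.
rewrite [X in _ = (a%:E * mu X)%E](_ : _ = `](b / a)%R, (c / a)%R]%classic); last first.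
  apply/seteqP; split => x /=; rewrite !in_itv /= ltr_pdivrMr// ler_pdivlMr//.
    by rewrite mulrC.
  by rewrite mulrC.
rewrite !lebesgue_measure_itv /= !lte_fin ltr_pM2r ?invr_gt0//.
case: ifPn => _; last by rewrite mule0.
by rewrite -EFinD -EFinM; congr (_%:E); field; rewrite gt_eqF.
Qed.

Lemma ge0_integral_scale (a : R) (f : R -> \bar R) : (0 < a)%R ->
  measurable_fun setT f -> (forall x, 0 <= f x) ->
  \int[mu]_x f x = a%:E * \int[mu]_x f (a * x)%R.
Proof.
move=> a0 mf f0.
have ma : measurable_fun setT ( *%R a : measurableTypeR R -> measurableTypeR R).
  exact: mulrl_measurable.
pose h := ( *%R a : measurableTypeR R -> measurableTypeR R).
have := @ge0_integral_pushforward _ _ _ _ _ _ ma mu setT f measurableT mf (fun y _ => f0 y).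
rewrite preimage_setT => <-.
have @nu : {measure set (measurableTypeR R) -> \bar R}.
  by refine (pushforward mu h); exact: ma.
transitivity (\int[mscale (NngNum (ltW a0)) nu]_x f x).
  apply: eq_measure_integral => A mA _.
  by rewrite [LHS](lebesgue_measure_scale a0 mA).
by rewrite ge0_integral_mscale.
Qed.
End scaling.

(** * Radial integrals and their recursion over the dimension *)

Section radial.
Context {R : realType}.
Local Notation mu := (@lebesgue_measure R).

(** Extension by 0 keeps every integral on the whole line, so that Tonelli and scaling apply without
    restricting domains. *)
Definition rweight (d : nat) (r : R) : R := if 0 < r then r ^+ d else 0.

Lemma rweight_ge0 d r : 0 <= rweight d r.
Proof. by rewrite /rweight; case: ifPn => // r0; rewrite exprn_ge0// ltW. Qed.

Lemma measurable_rweight d : measurable_fun setT (rweight d).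
Proof.
apply: measurable_fun_ifT => //.
exact: measurable_fun_ltr.
Qed.

Lemma rweight_scale d a r : 0 < a -> rweight d (a * r) = a ^+ d * rweight d r.
Proof.
by move=> a0; rewrite /rweight pmulr_rgt0//; case: ifPn; rewrite ?mulr0// exprMn.
Qed.

Lemma rweightS d r : rweight d.+1 r = r * rweight d r.
Proof. by rewrite /rweight; case: ifPn => _; rewrite ?mulr0// exprS. Qed.

(* [radS d * radint d phi] plays the role of the integral of phi(|x|) over R^(d+1). *)
Definition radint (d : nat) (phi : R -> R) : \bar R :=
  (\int[mu]_r (phi r * rweight d r)%:E)%E.

Definition hypot (x r : R) : R := Num.sqrt (x ^+ 2 + r ^+ 2).

(** The integral of (1 + t^2)^(-(d+2)/2), that is, the ratio of the areas of the unit spheres of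
    R^(d+2) and R^(d+1). It is never evaluated on its own. *)
Definition radK (d : nat) : \bar R := (\int[mu]_t ((hypot 1 t)^-1 ^+ d.+2)%:E)%E.

Lemma hypot1_gt0 t : 0 < hypot 1 t.
Proof. by rewrite sqrtr_gt0 expr1n ltr_pwDl// sqr_ge0. Qed.

Lemma hypot_scale t r : 0 <= r -> hypot (r * t) r = hypot 1 t * r.
Proof.
move=> r0; rewrite /hypot -[in RHS](ger0_norm r0) -sqrtr_sqr -sqrtrM; last first.
  by rewrite addr_ge0// sqr_ge0.
by congr Num.sqrt; ring.
Qed.

Lemma measurable_hypot d (T : measurableType d) (f g : T -> R) :
  measurable_fun setT f -> measurable_fun setT g ->
  measurable_fun setT (fun z => hypot (f z) (g z)).
Proof.
move=> mf mg; apply: (@measurableT_comp _ _ _ _ _ _ (@Num.sqrt R)).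
  by apply: continuous_measurable_fun; exact: sqrt_continuous.
by apply: measurable_funD; apply: measurable_funX.
Qed.

Section recursion.
Variables (phi : R -> R) (mphi : measurable_fun setT phi) (phi0 : forall r, 0 <= phi r).

Let ge0F x r d : (0 <= (phi x * rweight d r)%:E)%E.
Proof. by rewrite lee_fin mulr_ge0// rweight_ge0. Qed.

Lemma measurable_radial2 d : measurable_fun [set: R * R]
  (fun z => (phi (hypot z.1 z.2) * rweight d z.2)%:E).
Proof.
apply/measurable_EFinP; apply: measurable_funM; last first.
  by apply: (measurableT_comp (measurable_rweight d)).
apply: (measurableT_comp mphi); exact: measurable_hypot.
Qed.

Lemma measurable_radint d : measurable_fun setT
  (fun x : R => radint d (fun r => phi (hypot x r))).
Proof.
apply: (measurable_fun_fubini_tonelli_F (m2 := mu) (fun z : R * R => (phi (hypot z.1 z.2) * rweight d z.2)%:E)).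
  exact: measurable_radial2.
by move=> z; exact: ge0F.
Qed.

(* Substitute x = r t, exchange the integrals, and rescale r by (1 + t^2)^(-1/2). *)
Lemma radint_rec d :
  (\int[mu]_x radint d (fun r => phi (hypot x r)) = radK d * radint d.+1 phi)%E.
Proof.
rewrite /radint.
rewrite (fubini_tonelli (m1 := mu) (m2 := mu) (fun z : R * R => (phi (hypot z.1 z.2) * rweight d z.2)%:E))/=; last 2 first.
- exact: measurable_radial2.
- by move=> z; exact: ge0F.
have mt (r : R) : measurable_fun setT (fun x : R => (phi (hypot x r) * rweight d r)%:E).
  apply/measurable_EFinP; apply: measurable_funM => //.
  by apply: (measurableT_comp mphi); exact: measurable_hypot.
transitivity (\int[mu]_y \int[mu]_x (phi (hypot 1 x * y) * rweight d.+1 y)%:E)%E.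
  apply: eq_integral => r _.
  have [r0|r0] := ltP 0 r; last first.
    transitivity (0 : \bar R)%E; [|symmetry]; apply: integral0_eq => x _;
      by rewrite /rweight ltNge r0 mulr0.
  rewrite [LHS](ge0_integral_scale r0)//.
  rewrite -ge0_integralZl_EFin ?(ltW r0)//; last first.
    apply/measurable_EFinP; apply: measurable_funM => //.
    apply: (measurableT_comp mphi); exact: measurable_hypot.
  apply: eq_integral => x _; rewrite -EFinM hypot_scale ?(ltW r0)//.
  by rewrite rweightS; congr EFin; ring.
rewrite (fubini_tonelli (m1 := mu) (m2 := mu) (fun z : R * R => (phi (hypot 1 z.2 * z.1) * rweight d.+1 z.1)%:E))/=; last 2 first.
- apply/measurable_EFinP; apply: measurable_funM; last first.
    by apply: (measurableT_comp (measurable_rweight d.+1)).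
  apply: (measurableT_comp mphi); apply: measurable_funM => //.
  exact: measurable_hypot.
- by move=> z; exact: ge0F.
have mr k : measurable_fun setT (fun r => (phi r * rweight k r)%:E).
  by apply/measurable_EFinP; apply: measurable_funM => //; exact: measurable_rweight.
rewrite /radK -ge0_integralZr//; last 3 first.
- apply/measurable_EFinP; apply: measurable_funX.
  apply: continuous_measurable_fun => t; apply: cvgV; first by rewrite gt_eqF ?hypot1_gt0.
  apply: (@continuous_comp _ _ _ (fun x : R => 1 ^+ 2 + x ^+ 2) (@Num.sqrt R)).
    by apply: cvgD; [exact: cvg_cst|exact: exprn_continuous].
  exact: sqrt_continuous.
- by move=> x _; rewrite lee_fin exprn_ge0// invr_ge0 ltW// hypot1_gt0.
- by apply: integral_ge0.
apply: eq_integral => t _.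
have h0 := hypot1_gt0 t.
rewrite [in RHS](ge0_integral_scale h0)//.
rewrite -ge0_integralZl_EFin//; last 2 first.
- apply/measurable_EFinP; apply: measurable_funM => //.
    by apply: (measurableT_comp mphi); exact: mulrl_measurable.
  by apply: (measurableT_comp (measurable_rweight _)); exact: mulrl_measurable.
- by rewrite ltW.
rewrite -ge0_integralZl_EFin//; last 3 first.
- by move=> r _; rewrite -EFinM lee_fin !mulr_ge0 ?rweight_ge0 ?(ltW h0).
- apply/measurable_EFinP; apply: measurable_funM => //; apply: measurable_funM => //.
    by apply: (measurableT_comp mphi); exact: mulrl_measurable.
  by apply: (measurableT_comp (measurable_rweight _)); exact: mulrl_measurable.
- by rewrite exprn_ge0// invr_ge0 ltW.
apply: eq_integral => r _.
rewrite -EFinM rweight_scale//; congr EFin.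
rewrite exprVn [_ ^+ d.+2]exprS.
have : hypot 1 t ^+ d.+1 != 0 by rewrite expf_neq0// gt_eqF.
move: (hypot 1 t ^+ d.+1) => X X0.
by field; rewrite X0 gt_eqF.
Qed.
End recursion.
End radial.

(** * Comparison of lattice sums with radial integrals *)

Section lattice.
Context {R : realType}.
Local Notation mu := (@lebesgue_measure R).

Lemma radintE d (phi : R -> R) :
  radint d phi = (\int[mu]_(r in `]0%R, +oo[) (phi r * r ^+ d)%:E)%E.
Proof.
rewrite [RHS]integral_mkcond; apply: eq_integral => r _.
rewrite /patch /rweight mem_setE in_itv /= andbT.
by case: ifPn => //; rewrite mulr0.
Qed.

Lemma integral_even (phi : R -> R) : measurable_fun setT phi -> (forall r, 0 <= phi r) ->
  (\int[mu]_x (phi `|x|)%:E = 2%:E * radint 0 phi)%E.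
Proof.
move=> mphi phi0; rewrite radintE.
have mabs : measurable_fun setT (fun x : R => (phi `|x|)%:E).
  by apply/measurable_EFinP; apply: measurableT_comp => //; exact: normr_measurable.
rewrite -(setUv `[0%R, +oo[%classic) ge0_integral_setU//=; last 4 first.
- exact: measurableC.
- by rewrite setUv.
- by move=> x _; rewrite lee_fin.
- by apply/disj_setPCl.
rewrite setCitvr integral_itv_bndo_bndc; last exact: measurable_funTS.
have E : (\int[mu]_(x in `[0%R, +oo[) (phi `|x|)%:E = \int[mu]_(r in `]0%R, +oo[) (phi r * r ^+ 0)%:E)%E.
  rewrite -integral_itv_obnd_cbnd; last exact: measurable_funTS.
  by apply: eq_integral => x; rewrite inE /= in_itv /= andbT => x0; rewrite gtr0_norm// mulr1.
rewrite -E mule_natl mule2n; congr (_ + _)%E.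
rewrite ge0_integration_by_substitution0//.
by apply: eq_integral => x _; rewrite normrN.
by move=> r; rewrite lee_fin.
Qed.

(** The intervals [i, i + 1) are disjoint and have measure 1, so a finite partial sum is the
    integral of a step function below g. *)
Lemma esum_int_le (u g : _ -> \bar R) :
  measurable_fun [set: R] g -> (forall x, 0 <= g x)%E -> (forall i, 0 <= u i)%E ->
  (forall (i : int) (x : R), i%:~R <= x < i%:~R + 1 -> (u i <= g x)%E) ->
  (\esum_(i in [set: int]) u i <= \int[mu]_x g x)%E.
Proof.
move=> mg g0 u0 ug; apply: ge_ereal_sup => _ [X [finX _] <-].
rewrite fsbig_finite//=.
have := finmap.fset_uniq (fset_set X).
move: (finmap.enum_fset _) => s us.
pose I (i : int) := `[i%:~R, (i%:~R + 1 : R)[%classic : set R.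
have tI : trivIset [set` s] I.
  move=> i j _ _ [x [/=]]; rewrite /I /= !in_itv /= => /andP[a1 a2] /andP[b1 b2].
  have := le_lt_trans a1 b2; have := le_lt_trans b1 a2.
  rewrite -!(intrD _ _ 1) !ltr_int !ltzD1 => ? ?.
  by apply/eqP; rewrite eq_le; apply/andP.
apply: (@le_trans _ _ (\int[mu]_(x in \big[setU/set0]_(i <- s) I i) g x)%E); last first.
  apply: ge0_subset_integral => //.
  by apply: bigsetU_measurable => i _; exact: measurable_itv.
rewrite ge0_integral_bigsetU//=; last 2 first.
- by move=> i; exact: measurable_itv.
- exact: measurable_funTS.
apply: lee_sum => i _.
rewrite [leLHS](_ : _ = (\int[mu]_(x in I i) cst (u i) x)%E); last first.
  rewrite integral_cst; last exact: measurable_itv.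
  by rewrite /I/= lebesgue_measure_itv /= lte_fin ltrDl ltr01 -EFinB addrAC subrr add0r mule1.
apply: ge0_le_integral => //.
- exact: measurable_itv.
- by move=> x _ /=; exact: u0.
- exact: measurable_funTS.
- by move=> x; rewrite /I /= in_itv /= => ?; apply: ug.
Qed.

(* The surface measure of the sphere of R^(d+1), in the form produced by [radint_rec]. *)
Fixpoint radS (d : nat) : \bar R :=
  if d is d'.+1 then (radK d' * radS d')%E else 2%:E.

Lemma radS_ge0 d : (0 <= radS d)%E.
Proof.
elim: d => [|d IH] /=; first by rewrite lee_fin.
rewrite mule_ge0//; apply: integral_ge0 => x _.
by rewrite lee_fin exprn_ge0// invr_ge0 sqrtr_ge0.
Qed.

Definition cons_row (K : Type) d (z : K * 'rV[K]_d) : 'rV[K]_d.+1 :=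
  \row_j (if unlift ord0 j is Some j' then z.2 0 j' else z.1).

Lemma cons_row0 (K : Type) d (z : K * 'rV[K]_d) : cons_row z 0 0 = z.1.
Proof. by rewrite mxE unlift_none. Qed.

Lemma cons_rowS (K : Type) d (z : K * 'rV[K]_d) j : cons_row z 0 (lift ord0 j) = z.2 0 j.
Proof. by rewrite mxE liftK. Qed.

Lemma cons_row_bij (K : Type) d : set_bij [set: K * 'rV[K]_d] setT (@cons_row K d).
Proof.
split => //.
- move=> [a x] [b y] _ _ /= e; congr pair.
    by have := congr1 (fun z : 'rV[K]_d.+1 => z 0 0) e; rewrite !cons_row0.
  apply/rowP => j.
  by have := congr1 (fun z : 'rV[K]_d.+1 => z 0 (lift ord0 j)) e; rewrite !cons_rowS.
- move=> x _; exists (x 0 0, \row_j x 0 (lift ord0 j)) => //.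
  apply/rowP => j; case: (unliftP ord0 j) => [j' ->|->]; last by rewrite cons_row0.
  by rewrite cons_rowS mxE.
Qed.

Lemma rnorm_cons_row d (z : R * 'rV[R]_d) : rnorm (cons_row z) = hypot z.1 (rnorm z.2).
Proof.
rewrite /rnorm /hypot sqr_sqrtr; last by apply: sumr_ge0 => i _; rewrite -expr2 sqr_ge0.
congr Num.sqrt; rewrite /dotv big_ord_recl cons_row0 -expr2; congr (_ + _).
by apply: eq_bigr => i _; rewrite cons_rowS.
Qed.

(** Fixing the first coordinate x in [i, i + 1) turns phi(|.|) into the radial function r |->
    phi([hypot x r]) in one dimension less, and the cubes over that slice into cubes of the smaller
    dimension. Since [d] stands for dimension d + 1, the induction starts on the real line. *)
Lemma lattice_sum_le d (w : 'rV[int]_d.+1 -> R) (phi : R -> R) :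
  measurable_fun setT phi -> (forall r, 0 <= phi r) -> (forall h, 0 <= w h) ->
  (forall (h : 'rV[int]_d.+1) (x : 'rV[R]_d.+1), (forall j, (h 0 j)%:~R <= x 0 j < (h 0 j)%:~R + 1) ->
    w h <= phi (rnorm x)) ->
  (\esum_(h in [set: 'rV[int]_d.+1]) (w h)%:E <= radS d * radint d phi)%E.
Proof.
elim: d w phi => [|d IH] w phi mphi phi0 w0 H.
  rewrite (@reindex_esum R _ _ _ _ _ _ (@cons_row_bij int 0)).
  rewrite (_ : [set: int * 'rV[int]_0] = [set: int] `*`` (fun=> [set: 'rV[int]_0])); last first.
    by apply/seteqP; split.
  rewrite -(@esum_esum R _ _ setT (fun=> setT) (fun i h => (w (cons_row (i, h)))%:E)); last first.
    by move=> *; rewrite lee_fin.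
  rewrite (eq_esum (b := fun i => (w (cons_row (i, 0)))%:E)); last first.
    move=> i _; rewrite (_ : [set: 'rV[int]_0] = [set 0]); last first.
      by apply/seteqP; split => // x _ /=; apply/rowP => -[].
    by rewrite esum_set1// lee_fin.
  rewrite -integral_even//.
  apply: esum_int_le => //.
  - by apply/measurable_EFinP; apply: measurableT_comp => //; exact: normr_measurable.
  - by move=> x; rewrite lee_fin.
  - by move=> i; rewrite lee_fin.
  - move=> i x ix; rewrite lee_fin.
    have := H (cons_row (i, 0)) (cons_row (x, 0)); rewrite rnorm_cons_row /= /hypot.
    rewrite /rnorm /dotv big_ord0 sqrtr0 expr0n addr0 sqrtr_sqr; apply.
    by move=> j; rewrite ord1 !cons_row0.
rewrite (@reindex_esum R _ _ _ _ _ _ (@cons_row_bij int d.+1)).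
rewrite (_ : [set: int * 'rV[int]_d.+1] = [set: int] `*`` (fun=> [set: 'rV[int]_d.+1])); last first.
  by apply/seteqP; split.
rewrite -(@esum_esum R _ _ setT (fun=> setT) (fun i h => (w (cons_row (i, h)))%:E)); last first.
  by move=> *; rewrite lee_fin.
rewrite [radS _]/= (muleC (radK d)) -muleA -radint_rec//.
have mr := measurable_radint mphi phi0 d.
have r0 x : (0 <= radint d (fun r => phi (hypot x r)))%E.
  by apply: integral_ge0 => r _; rewrite lee_fin mulr_ge0// rweight_ge0.
rewrite -ge0_integralZl//; last exact: radS_ge0.
have key i x : i%:~R <= x < i%:~R + 1 ->
    (\esum_(h in [set: 'rV[int]_d.+1]) (w (cons_row (i, h)))%:E <=
     radS d * radint d (fun r => phi (hypot x r)))%E.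
  move=> ix; apply: IH => //.
  - by apply: (measurableT_comp mphi); exact: measurable_hypot.
  - move=> h y hy; have := H (cons_row (i, h)) (cons_row (x, y)); rewrite rnorm_cons_row; apply => j.
    by case: (unliftP ord0 j) => [j' ->|->]; rewrite ?cons_row0// !cons_rowS.
apply: esum_int_le => //.
- exact: measurable_funeM.
- by move=> x; rewrite mule_ge0// radS_ge0.
- by move=> i; apply: esum_ge0 => h _; rewrite lee_fin.
Qed.
End lattice.

(** * The surface constant from the Gaussian integral *)

Section gaussian.
Context {R : realType}.
Local Notation mu := (@lebesgue_measure R).

Lemma gauss_hypot (x r : R) : gauss_fun (hypot x r) = gauss_fun x * gauss_fun r.
Proof.
by rewrite /gauss_fun /hypot sqr_sqrtr ?addr_ge0 ?sqr_ge0// opprD expRD.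
Qed.

(** exp(-|x|^2) is a product over the coordinates, so each step of the recursion contributes one
    factor sqrt pi, whatever the values of [radK] are. *)
Lemma radS_gauss d :
  (radS d * radint d (@gauss_fun R) = (Num.sqrt pi ^+ d.+1)%:E)%E.
Proof.
elim: d => [|d IH].
  rewrite -integral_even//; last 2 first.
  - exact: measurable_gauss_fun.
  - exact: gauss_fun_ge0.
  rewrite expr1 -integralT_gauss; apply: eq_integral => x _.
  by rewrite /gauss_fun real_normK// num_real.
rewrite [radS _]/= (muleC (radK d)) -muleA -radint_rec; last 2 first.
- exact: measurable_gauss_fun.
- exact: gauss_fun_ge0.
have mg : measurable_fun setT (fun x : R => (gauss_fun x * rweight d x)%:E).
  apply/measurable_EFinP; apply: measurable_funM.
    exact: measurable_gauss_fun.
  exact: measurable_rweight.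
have g0 (x : R) : (0 <= (gauss_fun x)%:E)%E by rewrite lee_fin gauss_fun_ge0.
have r0 : (0 <= radint d (@gauss_fun R))%E.
  by apply: integral_ge0 => x _; rewrite lee_fin mulr_ge0// ?gauss_fun_ge0 ?rweight_ge0.
have -> : (\int[mu]_x radint d (fun r => gauss_fun (hypot x r)) = \int[mu]_x ((gauss_fun x)%:E * radint d (@gauss_fun R)))%E.
  apply: eq_integral.
  move=> x _; rewrite -ge0_integralZl//; last first.
    by move=> r _; rewrite lee_fin mulr_ge0// ?gauss_fun_ge0 ?rweight_ge0.
  by apply: eq_integral => r _; rewrite gauss_hypot -EFinM mulrA.
rewrite ge0_integralZr//; last first.
  by apply/measurable_EFinP; exact: measurable_gauss_fun.
by rewrite muleCA IH integralT_gauss -EFinM -exprS.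
Qed.

(** The substitution s = r^2, carried out from [0, n] onto [0, n^2] before n tends to infinity. As d
    >= 1, the exponent of s is nonnegative; together with the truncation at 0 this makes the new
    integrand continuous on the whole line. *)
Lemma radint_gauss d : (0 < d)%N ->
  ((2%:E * radint d (@gauss_fun R) = \int[mu]_(x in `]0%R, +oo[) (x `^ (d.+1%:R / 2 - 1) * expR (- x))%:E))%E.
Proof.
move=> d0.
set a := d.+1%:R / 2 - 1.
have a0 : 0 <= a by rewrite subr_ge0 ler_pdivlMr// mul1r ler_nat.
pose G (s : R) := Num.max s 0 `^ a * expR (- s).
have cG : continuous G.
  move=> x; apply: cvgM; first exact: powR_max_continuous.
  by apply: continuous_comp; [exact: oppr_continuous|exact: continuous_expR].
have G0 x : 0 <= G x by rewrite mulr_ge0 ?powR_ge0 ?expR_ge0.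
have mG : measurable_fun setT G by exact: continuous_measurable_fun.
pose H (r : R) := 2 * (gauss_fun r * (Num.max r 0) ^+ d).
have H0 x : 0 <= H x by rewrite !mulr_ge0 ?gauss_fun_ge0 ?exprn_ge0// le_max lexx orbT.
have mH : measurable_fun setT H.
  apply: measurable_funM => //; apply: measurable_funM.
    exact: measurable_gauss_fun.
  by apply: measurable_funX; apply: measurable_maxr.
transitivity (\int[mu]_(x in `[0%R, +oo[) (H x)%:E)%E.
  rewrite radintE -ge0_integralZl//; last 2 first.
  - apply/measurable_EFinP; apply: measurable_funTS; apply: measurable_funM => //.
    exact: measurable_gauss_fun.
  - move=> x; rewrite /= in_itv /= andbT => x0.
    by rewrite lee_fin mulr_ge0 ?gauss_fun_ge0 ?exprn_ge0// ltW.
  rewrite -[RHS]integral_itv_obnd_cbnd; last by apply/measurable_EFinP; exact: measurable_funTS.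
  apply: eq_integral => x; rewrite inE /= in_itv /= andbT => x0.
  by rewrite /H (max_idPl (ltW x0)) -EFinM.
transitivity (\int[mu]_(x in `[0%R, +oo[) (G x)%:E)%E; last first.
  rewrite -[LHS]integral_itv_obnd_cbnd; last by apply/measurable_EFinP; exact: measurable_funTS.
  apply: eq_integral => x; rewrite inE /= in_itv /= andbT => x0.
  by rewrite /G (max_idPl (ltW x0)).
have cH := ge0_cvgn_integral (mu := mu) H0 mH.
have cGn := ge0_cvgn_integral (mu := mu) G0 mG.
have E (n : nat) : (\int[mu]_(x in `[0%R, n%:R]) (H x)%:E = \int[mu]_(x in `[0%R, (n ^ 2)%:R]) (G x)%:E)%E.
  pose F := fun x : R => x ^+ 2.
  have dF : F^`()%classic = (fun x => 2 * x).
    by apply/funext => x; rewrite derive1E exp_derive /GRing.scale /= mulr1 mulr_natl.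
  have cF : continuous F by exact: exprn_continuous.
  have -> : `[0%R, (n ^ 2)%:R]%classic = `[F 0, F n%:R]%classic.
    by rewrite /F expr0n /= natrX.
  rewrite integration_by_substitution_increasing//.
  - apply: eq_integral => x; rewrite inE /= in_itv /= => /andP[x0 _]; congr EFin.
    rewrite dF [RHS]/GRing.mul /= /G /H /F /gauss_fun (max_idPl x0) (max_idPl (sqr_ge0 x)).
    rewrite -(powR_mulrn 2 x0) -powRrM.
    have -> : 2 * a = d.-1%:R by rewrite /a -(@natr1 _ d) -[X in X%:R + 1](prednK d0) -(@natr1 _ d.-1); field.
    by rewrite !powR_mulrn// -{1}(prednK d0) [x ^+ d.-1.+1]exprS; ring.
  - move=> x y; rewrite !in_itv /= => /andP[x0 _] /andP[y0 _] xy.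
    by rewrite /F ltr_pXn2r.
  - by rewrite dF => x _; apply: cvgM; [exact: cvg_cst|exact: cvg_id].
  - rewrite dF; apply/cvg_ex; exists (2 * 0).
    apply: cvg_at_right_filter; apply: cvgM; [exact: cvg_cst|exact: cvg_id].
  - rewrite dF; apply/cvg_ex; exists (2 * n%:R).
    apply: cvg_at_left_filter; apply: cvgM; [exact: cvg_cst|exact: cvg_id].
  - split.
    + by move=> x _; apply: exprn_derivable.
    + by apply: cvg_at_right_filter; exact: cF.
    + by apply: cvg_at_left_filter; exact: cF.
  - exact: continuous_subspaceT.
move/cvg_lim : cH => <-//.
apply/cvg_lim => //.
rewrite (_ : (fun n => _) = (fun n : nat => \int[mu]_(x in `[0%R, (n ^ 2)%:R]) (G x)%:E)%E); last by apply/funext.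
have n2 : (n ^ 2)%N @[n --> \oo] --> \oo.
  apply/cvgnyPge => A; near=> n.
  apply: (@leq_trans n); first by near: n; exact: nbhs_infty_ge.
  by case: (n) => // k; rewrite -mulnn leq_pmulr.
exact: (cvg_comp _ _ n2 cGn).
Unshelve. all: by end_near. Qed.
End gaussian.

(** * The tail of the sum of |h|^(-nu) *)

Section tail.
Context {R : realType}.
Local Notation mu := (@lebesgue_measure R).

(** The radial Gaussian integral is half a Gamma value; dividing [radS_gauss] by it isolates the
    constant. *)
Lemma radSE d : (0 < d)%N ->
  radS d = (2 * pi `^ (d.+1%:R / 2) / Gamma (d.+1%:R / 2))%:E :> \bar R.
Proof.
move=> d0.
have H1 := @radS_gauss R d; have H2 := @radint_gauss R d d0.
have S0 := @radS_ge0 R d.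
have c0 : (0 <= radint d (@gauss_fun R))%E.
  by apply: integral_ge0 => x _; rewrite lee_fin mulr_ge0// ?gauss_fun_ge0 ?rweight_ge0.
have pi0 : 0 < Num.sqrt pi ^+ d.+1 :> R by rewrite exprn_gt0// sqrtr_gt0 pi_gt0.
have E : Gamma (d.+1%:R / 2) = fine (2%:E * radint d (@gauss_fun R))%E :> R.
  by rewrite H2.
rewrite {H2}E.
have -> : pi `^ (d.+1%:R / 2) = Num.sqrt pi ^+ d.+1 :> R.
  by rewrite -powR12_sqrt ?pi_ge0// -powR_mulrn ?powR_ge0// -powRrM mulrC.
(* The product of the two factors is finite and positive, which rules out an infinite factor. *)
move: H1 S0 c0 pi0; case: (radS d) => [s||]//; case: (radint _ _) => [c||]//=.
- move=> [<-]; rewrite !lee_fin => s0 c0 sc0; congr EFin.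
  have c0' : 0 < c by rewrite lt0r c0 andbT; apply: contraTneq sc0 => ->; rewrite mulr0 ltxx.
  by field; rewrite gt_eqF.
- move=> H s0 _ pi0; move: H; rewrite lee_fin le_eqVlt in s0.
  case/orP: s0 => [/eqP<-|s0]; first by rewrite mul0e => -[] H; rewrite -H ltxx in pi0.
  by rewrite gt0_muley.
- move=> H _ c0 pi0; move: H; rewrite lee_fin le_eqVlt in c0.
  case/orP: c0 => [/eqP<-|c0]; first by rewrite mule0 => -[] H; rewrite -H ltxx in pi0.
  by rewrite gt0_mulye.
Qed.

(** Expanding r^d = (e + (r - e))^d makes the integrand a sum of powers of r - e. Since nu > d + 1,
    the powers in the antiderivative have negative exponents and vanish at infinity. *)
Lemma radint_tail d (e b nu : R) : 0 < e -> e < b -> d.+1%:R < nu ->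
  radint d (fun r => if b <= r then (r - e) `^ (- nu) else 0) =
  (\sum_(i < d.+1) ('C(d, i))%:R * (e ^+ (d - i) / ((nu - 1 - i%:R) * (b - e) `^ (nu - 1 - i%:R))))%:E.
Proof.
move=> e0 eb dnu.
have nui (i : 'I_d.+1) : 0 < nu - 1 - i%:R.
  have : i%:R <= d%:R :> R by rewrite ler_nat -ltnS.
  by move: dnu; rewrite -natr1; lra.
pose f (r : R) := (r - e) `^ (- nu) * r ^+ d.
pose F (r : R) := - \sum_(i < d.+1) ('C(d, i))%:R * (e ^+ (d - i) / ((nu - 1 - i%:R)) * (r - e) `^ (- (nu - 1 - i%:R))).
transitivity (\int[mu]_(r in `[b, +oo[) (f r)%:E)%E.
  rewrite [RHS]integral_mkcond; apply: eq_integral => r _.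
  rewrite /patch /rweight mem_setE in_itv /= andbT.
  case: ifPn => [br|_]; last by rewrite mul0r.
  by rewrite (lt_le_trans _ br)// (lt_trans e0).
have dF x : b <= x -> is_derive x 1 F (f x).
  move=> bx; have xe : 0 < x - e by rewrite subr_gt0 (lt_le_trans eb).
  have D (a : R) : is_derive x 1 (fun r => (r - e) `^ a) (a * (x - e) `^ (a - 1)).
    exact: is_derive_powR_shift.
  pose g (i : 'I_d.+1) := ('C(d, i))%:R * (e ^+ (d - i) / ((nu - 1 - i%:R))) \*: (fun r => (r - e) `^ (- (nu - 1 - i%:R))).
  have Dg i : is_derive x 1 (g i) (- ('C(d, i)%:R * e ^+ (d - i) * (x - e) `^ (i%:R - nu))).
    apply: (is_derive_eq (is_deriveZ _ (D (- (nu - 1 - i%:R))))).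
    rewrite /GRing.scale /= (_ : - (nu - 1 - i%:R) - 1 = i%:R - nu); last by ring.
    by field; rewrite gt_eqF.
  have -> : F = - \sum_(i < d.+1) g i.
    apply/funext => r; rewrite /F fctE; congr (- _).
    rewrite fct_sumE; apply: eq_bigr => i _.
    by rewrite /g /= /GRing.scale /= mulrA.
  apply: is_derive_eq.
  rewrite -sumrN /f -[X in _ * X ^+ d](subrKC e x) exprDn mulr_sumr.
  apply: eq_bigr => i _; rewrite opprK.
  rewrite (addrC _ (- nu)) powRD; last by rewrite (gt_eqF xe) implybT.
  by rewrite powR_mulrn ?(ltW xe)// -mulr_natr; ring.
rewrite (@ge0_continuous_FTC2y R f F b 0).
- rewrite sub0e -EFinN /F opprK; congr EFin; apply: eq_bigr => i _.
  by rewrite powRN -!mulrA -invfM.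
- move=> x bx; rewrite /f mulr_ge0 ?powR_ge0// exprn_ge0//.
  by apply: le_trans bx; rewrite ltW// (lt_trans e0).
- apply: continuous_in_subspaceT => x; rewrite inE /= in_itv /= andbT => bx.
  apply: cvgM; last exact: exprn_continuous.
  apply: cvg_powR; first by rewrite subr_gt0 (lt_le_trans eb).
  by apply: cvgB; [exact: cvg_id|exact: cvg_cst].
- have -> : 0 = - \sum_(i < d.+1) ('C(d, i)%:R * (e ^+ (d - i) / (nu - 1 - i%:R)) * 0) :> R.
    by rewrite big1 ?oppr0// => i _; rewrite mulr0.
  apply: cvgN; apply: cvg_sumr => i _.
  under eq_fun do rewrite mulrA.
  apply: cvgM; first exact: cvg_cst.
  apply: cvg_powRN_pinfty => //; apply/cvgryPge => A.
  by near=> r; rewrite lerBrDr; near: r; apply: nbhs_pinfty_ge; exact: num_real.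
- by move=> x bx; have [] := dF x (ltW bx).
- have [db _] := dF b (lexx b).
  apply: cvg_at_right_filter; apply: differentiable_continuous.
  exact/derivable1_diffP.
- move=> x; rewrite in_itv /= andbT => /ltW bx; rewrite derive1E.
  by have [_ ->] := dF x bx.
Unshelve. all: by end_near. Qed.

Lemma lattice_tail d (nu rho : R) : (0 < d)%N -> d.+1%:R < nu -> 2 * Num.sqrt d.+1%:R < rho ->
  (\esum_(h in [set h : 'rV[int]_d.+1 | (rho <= znorm R h)%R]) (znorm R h `^ (- nu))%:E <=
   (2 * pi `^ (d.+1%:R / 2) / Gamma (d.+1%:R / 2)
  * \sum_(i < d.+1) ('C(d, i))%:R
      * (d.+1%:R `^ (d.+1%:R / 2 - 1 / 2 - i%:R / 2)
         / ((nu - 1 - i%:R)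
            * (rho - 2 * Num.sqrt d.+1%:R) `^ (nu - 1 - i%:R))))%:E)%E.
Proof.
move=> d0 dnu hrho.
set e := Num.sqrt d.+1%:R in hrho *.
have e0 : 0 < e by rewrite sqrtr_gt0 ltr0n.
have nu0 : 0 < nu by apply: le_lt_trans dnu; rewrite ler0n.
rewrite esum_mkcond.
pose w (h : 'rV[int]_d.+1) := if rho <= znorm R h then znorm R h `^ (- nu) else 0.
rewrite (eq_esum (b := fun h => (w h)%:E)); last first.
  move=> h _; rewrite /w; case: (boolP (h \in _)) => [/set_mem /= ->//|].
  by move=> /negP hr; rewrite ifF//; apply/negP => rh; apply: hr; exact/mem_set.
(* [e] is the diameter of a unit cube, so |h| and |x| differ by at most [e] for x in the cube of h:
   |h| >= rho gives |x| >= rho - e, and |h| >= |x| - e bounds the term. Integrating powers of r - e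
   from rho - e on leaves powers of rho - 2e. *)
pose phi (r : R) := if rho - e <= r then (r - e) `^ (- nu) else 0.
apply: (le_trans (@lattice_sum_le R d w phi _ _ _ _)).
- apply: measurable_fun_ifT => //; first exact: measurable_fun_ler.
  apply: (measurableT_comp (measurable_powR _)); exact: measurable_funB.
- by move=> r; rewrite /phi; case: ifP; rewrite ?powR_ge0.
- by move=> r; rewrite /w; case: ifP; rewrite ?powR_ge0.
- move=> h x hx.
  have xh : rnorm (x - rvec R h) <= e.
    rewrite -[leRHS]mul1r; apply: rnorm_le_sqrt => // j; rewrite !mxE.
    by have := hx j; rewrite ler_norml; lra.
  rewrite /w /phi; case: ifPn => [rh|_]; last by case: ifP; rewrite ?powR_ge0.
  have h1 : znorm R h - e <= rnorm x.
    have := rnormB (rvec R h) x; rewrite -(rnormN (_ - x)) opprB -/(znorm R h).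
    by move: xh; lra.
  have h2 : rnorm x - e <= znorm R h by have := rnormB x (rvec R h); rewrite -/(znorm R h); lra.
  rewrite ifT; last lra.
  rewrite !powRN lef_pV2 ?posrE ?powR_gt0//; [|lra|lra].
  by rewrite ge0_ler_powR ?nnegrE// ?ltW//; lra.
rewrite radSE// radint_tail//; last lra.
rewrite -EFinM lee_fin; rewrite le_eqVlt; apply/predU1P; left; congr (_ * _).
apply: eq_bigr => i _; congr (_ * (_ / _)).
  have id : (i <= d)%N by rewrite -ltnS.
  rewrite /e -powR12_sqrt// -powR_mulrn ?powR_ge0// -powRrM natrB//; congr powR.
  by rewrite -natr1; field.
by congr (_ * _ `^ _); ring.
Qed.
End tail.

(** * The function c_pn and the terms of the series *)

Section maximum.
Variable (R : realType).

Lemma maximumP (A : set R) : (exists x, (A `&` ubound A) x) ->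
  (A `&` ubound A) (maximum A).
Proof. by move=> [x Ax]; rewrite /maximum; case: xgetP => [y -> //|/(_ x)]. Qed.

Lemma maximum_image (T : topologicalType) (K : set T) (f : T -> R) :
  K !=set0 -> compact K -> {within K, continuous f} ->
  exists2 c, K c & maximum (f @` K) = f c /\ forall t, K t -> f t <= maximum (f @` K).
Proof.
move=> K0 cK cf; have [c cK' Hc] := compact_EVT_max K0 cK cf.
have Kc : K c by rewrite inE in cK'.
have H : ((f @` K) `&` ubound (f @` K)) (f c).
  split; first by exists c.
  by move=> _ [t Kt <-]; apply: Hc; rewrite inE.
have [M1 M2] : (f @` K `&` ubound (f @` K)) (maximum (f @` K)) by apply: maximumP; exists (f c).
exists c => //; split; last by move=> t Kt; apply: M2; exists t.
by apply: le_anti; apply/andP; split; [exact: H.2|apply: M2; exists c].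
Qed.

End maximum.

Section cpn.
Variable (R : realType).

(* The truncation at 0 only matters for w > 1; it makes [powquo a] continuous on the whole line. *)
Definition powquo (a w : R) : R := if w == 0 then a else (1 - Num.max (1 - w) 0 `^ a) / w.

(** The value at 0 is the limit of the quotient, because (1 - w)^a has derivative -a there. *)
Lemma powquo_continuous a : 0 <= a -> continuous (powquo a).
Proof.
move=> a0 w.
have cF : continuous (fun w : R => Num.max (1 - w) 0 `^ a).
  move=> x; apply: (@continuous_comp _ _ _ (fun x : R => 1 - x) (fun x => Num.max x 0 `^ a)).
    by apply: cvgB; [exact: cvg_cst|exact: cvg_id].
  exact: powR_max_continuous.
have [->|w0] := eqVneq w 0; last first.
  have : (fun w : R => (1 - Num.max (1 - w) 0 `^ a) / w) x @[x --> w] --> powquo a w.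
    rewrite /powquo (negbTE w0); apply: cvgM; last exact: cvgV.
    by apply: cvgB; [exact: cvg_cst|exact: cF].
  apply: cvg_trans; apply: near_eq_cvg; near=> x.
  rewrite /powquo ifF//; apply/negbTE; near: x.
  by apply: (cvgr_neq0 w) => //; exact: cvg_id.
apply/continuous_withinNx.
have d0 : is_derive (0 : R) 1 (fun w : R => (1 - w) `^ a) (- a).
  have d1 : is_derive (0 : R) 1 (fun w : R => 1 - w) (- 1).
    by apply: is_derive_eq; rewrite add0r mul1r.
  have d2 := @is_derive1_powR R a (1 - 0).
  have := is_derive_comp1 d1 (d2 _); rewrite subr0 powR1 mulr1 mulrN mulr1; apply.
  by rewrite ltr01.
have [d1 d2] := d0.
have := d1; rewrite /derivable => /cvg_ex[l lE].
have := d2; rewrite /derive => lD.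
have El : l = - a by rewrite -lD; apply/esym/cvg_lim.
have {}lE : (fun h : R => - (h^-1 *: ((1 - (h *: 1 + 0)) `^ a - (1 - 0) `^ a))) h @[h --> 0^'] --> a.
  by rewrite -[a in X in _ --> X]opprK -El; exact: cvgN.
rewrite {2}/powquo eqxx; apply: cvg_trans lE; apply: near_eq_cvg.
near=> h.
have h0 : h != 0 by near: h; exact: nbhs_dnbhs_neq.
rewrite /powquo (negbTE h0) (max_idPl _).
  by rewrite /GRing.scale /= mulr1 addr0 subr0 powR1 -mulrN opprB mulrC.
rewrite subr_ge0; apply: ltW; near: h.
apply: nbhs_dnbhs; have : (fun x : R => x) x @[x --> (0 : R)] --> (0 : R) by exact: cvg_id.
by move=> /(cvgr_lt (0 : R)); apply.
Unshelve. all: by end_near. Qed.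

Lemma mul_powquo a w : w * powquo a w = 1 - Num.max (1 - w) 0 `^ a.
Proof.
rewrite /powquo; case: eqVneq => [->|w0]; last by rewrite mulrC divfK.
by rewrite mul0r subr0 (max_idPl _)// powR1 subrr.
Qed.

(** The bracket (1 - zu + zu^2)^(p/2) - (1 - u)^p of [cpn] divided by u, made regular at u = 0 by
    [powquo]. *)
Definition cpn_num (p z u : R) : R := - z * (1 - u) * powquo (p / 2) (z * u * (1 - u)) + powquo p u.
Definition sumpow (a u : R) : R := Num.max (1 - u) 0 `^ a + Num.max u 0 `^ a.

Lemma sumpow_gt0 a u : 0 < sumpow a u.
Proof.
have [u0|u0] := ltP 0 u.
  by rewrite ltr_wpDl ?powR_ge0// powR_gt0// lt_max u0.
by rewrite ltr_wpDr ?powR_ge0// powR_gt0// lt_max; apply/orP; left; lra.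
Qed.

(* cpn, with a common factor (u (1 - u))^(2n+2) cancelled. *)
Lemma cpn_simpl p n z u : 0 <= z <= 4 -> 0 <= u <= 1 -> 1 < n -> n <= p ->
  cpn p n z u = 2 * z * (4 - z) * cpn_num p z u ^+ 2
    / (sumpow (2 * n - 2) u * sumpow (p - n) u ^+ 2).
Proof.
move=> /andP[z0 z4] /andP[u0 u1] n1 np.
have n22 : 2 * n - 2 != 0 by rewrite gt_eqF//; lra.
(* 1 + 3 delta is the square of the value of [sumpow (p - n)] at the endpoints, namely 1 + 0^(p-n),
   which is 2 for p = n because 0^0 = 1. *)
have d1 : (1 + 3 * delta p n : R) = (1 + (p - n == 0)%:R) ^+ 2.
  by rewrite /delta subr_eq0; case: eqP => _ /=; ring.
have d0 : 0 < 1 + (p - n == 0)%:R :> R by rewrite ltr_pwDl.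
rewrite /cpn; case: eqVneq => [->|un0].
  rewrite /cpn_num /sumpow /powquo !mulr0 mul0r !eqxx subr0 maxxx (max_idPl ler01) !powR1.
  rewrite powR0// d1 {1}/powR eqxx addr0.
  by field; rewrite gt_eqF.
case: eqVneq => [->|un1].
  rewrite /cpn_num /sumpow subrr !mulr0 mul0r add0r maxxx (max_idPl ler01) !powR1 powR0//.
  rewrite d1 {1}/powR eqxx add0r mul1r addrC /powquo oner_eq0 subrr maxxx powR0; last by rewrite gt_eqF//; lra.
  by field; rewrite gt_eqF.
have {u0 un0} u0 : 0 < u by rewrite lt0r un0.
have {u1 un1} u1 : 0 < 1 - u by rewrite subr_gt0 lt_neqAle un1.
have w1 : 0 <= 1 - z * u + z * u ^+ 2 by have := mulr_ge0 z0 (sqr_ge0 (1 - 2 * u)); lra.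
have E : (1 - z * u + z * u ^+ 2) `^ (p / 2) - (1 - u) `^ p = u * cpn_num p z u.
  have H1 := mul_powquo (p / 2) (z * u * (1 - u)); have H2 := mul_powquo p u.
  rewrite (max_idPl _) in H1; last by lra.
  rewrite (max_idPl (ltW u1)) in H2.
  rewrite (_ : 1 - z * u + _ = 1 - z * u * (1 - u)); last by ring.
  rewrite (_ : u * cpn_num p z u = - (z * u * (1 - u) * powquo (p / 2) (z * u * (1 - u))) + u * powquo p u).
    by rewrite H1 H2; ring.
  by rewrite /cpn_num; ring.
rewrite E /sumpow (max_idPl (ltW u0)) (max_idPl (ltW u1)).
move: (cpn_num p z u) => A.
have P2 (x : R) : 0 < x -> x `^ (2 * n) = (x `^ n) ^+ 2.
  by move=> x0; rewrite mulrC powRrM powR_mulrn ?powR_ge0.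
have P3 (x : R) : 0 < x -> x `^ (2 * n - 2) = (x `^ n) ^+ 2 / x ^+ 2.
  by move=> x0; rewrite powRB ?(gt_eqF x0) ?implybT// P2// powR_mulrn// ltW.
have P4 (x : R) : 0 < x -> x `^ (2 * n + 2) = (x `^ n) ^+ 2 * x ^+ 2.
  by move=> x0; rewrite powRD ?(gt_eqF x0) ?implybT// P2// powR_mulrn// ltW.
have P5 (x : R) : 0 < x -> x `^ (p - n) = x `^ p / x `^ n.
  by move=> x0; rewrite powRB ?(gt_eqF x0) ?implybT.
rewrite !P4// !P3// !P2// !P5//.
have := powR_gt0 n u0; have := powR_gt0 n u1; have := powR_gt0 p u0; have := powR_gt0 p u1.
move: (u `^ n) ((1 - u) `^ n) (u `^ p) ((1 - u) `^ p) => a b a' b' b'0 a'0 b0 a0.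
move: u0 u1; set x := 1 - u => u0 x0.
field.
by rewrite !gt_eqF// ?addr_gt0 ?mulr_gt0 ?exprn_gt0.
Qed.

(** The cancelled form in [cpn_simpl] is continuous on the whole plane, so its maximum over the
    rectangle is attained; the value 0 at the corner (0, 0) gives the sign. *)
Lemma cpn_max (p n : R) : 1 < n -> n <= p ->
  0 <= Cpn p n /\ forall z u, 0 <= z <= 4 -> 0 <= u <= 1 -> cpn p n z u <= Cpn p n.
Proof.
move=> n1 np.
pose f (x : R * R) := 2 * x.1 * (4 - x.1) * cpn_num p x.1 x.2 ^+ 2
    / (sumpow (2 * n - 2) x.2 * sumpow (p - n) x.2 ^+ 2).
have cs (a : R) : 0 <= a -> continuous (sumpow a).
  move=> a0 u; apply: cvgD; last exact: powR_max_continuous.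
  apply: (@continuous_comp _ _ _ (fun x : R => 1 - x) (fun x => Num.max x 0 `^ a)).
    by apply: cvgB; [exact: cvg_cst|exact: cvg_id].
  exact: powR_max_continuous.
have cf : continuous f.
  move=> [z u].
  have cz : fst x @[x --> (z, u)] --> z by exact: cvg_fst.
  have cu : snd x @[x --> (z, u)] --> u by exact: cvg_snd.
  have c1u : (1 - snd x) @[x --> (z, u)] --> 1 - u by apply: cvgB => //; exact: cvg_cst.
  apply: cvgM.
    apply: cvgM.
      apply: cvgM; first by apply: cvgM => //; exact: cvg_cst.
      by apply: cvgB => //; exact: cvg_cst.
    have cA : cpn_num p x.1 x.2 @[x --> (z, u)] --> cpn_num p z u.
      apply: cvgD; last by apply: (cvg_comp _ _ cu); apply: powquo_continuous; lra.
      apply: cvgM; first by apply: cvgM => //; exact: cvgN.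
      have cw : x.1 * x.2 * (1 - x.2) @[x --> (z, u)] --> z * u * (1 - u).
        by apply: cvgM => //; exact: cvgM.
      by apply: (cvg_comp _ _ cw); apply: powquo_continuous; lra.
    exact: cvgM.
  apply: cvgV; first by rewrite mulf_neq0 ?expf_neq0// gt_eqF// sumpow_gt0.
  apply: cvgM; first by apply: (cvg_comp _ _ cu); apply: cs; lra.
  have c2 : sumpow (p - n) x.2 @[x --> (z, u)] --> sumpow (p - n) u.
    by apply: (cvg_comp _ _ cu); apply: cs; lra.
  exact: cvgM.
have cK : compact (`[0, 4]%classic `*` `[0, 1]%classic : set (R * R)).
  by apply: compact_setX; exact: segment_compact.
have K0 : (`[0, 4]%classic `*` `[0, 1]%classic : set (R * R)) !=set0.
  by exists (0, 0); split; rewrite /= in_itv /= lexx /=.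
have := maximum_image K0 cK (continuous_subspaceT cf).
have -> : f @` (`[0, 4]%classic `*` `[0, 1]%classic : set (R * R)) =
    [set cpn p n z u | z in `[0, 4] & u in `[0, 1]].
  apply/seteqP; split.
    move=> _ [[z u] [/= hz hu] <-]; exists z => //; exists u => //.
    by rewrite cpn_simpl//; move: hz hu; rewrite !in_itv.
  move=> _ [z hz [u hu <-]]; exists (z, u) => //.
  by rewrite cpn_simpl//; move: hz hu; rewrite /= !in_itv.
rewrite -[maximum _]/(Cpn p n) => -[c cK' [M1 M2]].
have H z u : 0 <= z <= 4 -> 0 <= u <= 1 -> cpn p n z u <= Cpn p n.
  move=> hz hu; rewrite cpn_simpl//; apply: (M2 (z, u)).
  by split; rewrite /= in_itv.
split => //; apply: le_trans (H 0 0 _ _); rewrite ?lexx ?ler01//.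
  by rewrite /cpn eqxx mulr0 !mul0r.
exact: ler0n.
Qed.
End cpn.

(** * Bounds for single terms of the series *)

Section gterm.
Variable (R : realType).

Lemma powR_sub1 (x a : R) : 0 < x -> x `^ (a - 1) = x `^ a / x.
Proof. by move=> x0; rewrite powRB ?(gt_eqF x0) ?implybT// powRr1// ltW. Qed.

Lemma powR_2sub2 (x a : R) : 0 < x -> x `^ (2 - 2 * a) = x ^+ 2 / (x `^ a) ^+ 2.
Proof.
move=> x0; rewrite powRB ?(gt_eqF x0) ?implybT// powR_mulrn ?(ltW x0)//.
by rewrite mulrC (mulrC 2) powRrM powR_mulrn ?powR_ge0// mulrC.
Qed.

Lemma powR_half (x a : R) : 0 <= x -> (x ^+ 2) `^ (a / 2) = x `^ a.
Proof.
move=> x0; rewrite -powR_mulrn// -powRrM; congr powR; by field.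
Qed.

(** Both sides are homogeneous of degree 2 - 2n in (H, L, K), so only u = H / (H + L) and the cosine
    matter. With z = 2 (1 - c) one has K^2 = (H + L)^2 (1 - zu + zu^2) and z (4 - z) = 4 (1 - c^2).
    The left side is then the right side with c_pn(z, u) in place of its maximum. *)
Lemma gterm_real (p n H L K c : R) : 1 < n -> n <= p -> 0 < H -> 0 < L -> 0 <= K ->
  -1 <= c <= 1 -> K ^+ 2 = H ^+ 2 + L ^+ 2 + 2 * H * L * c ->
  (K `^ p - L `^ p) ^+ 2 * (1 - c ^+ 2) / (H `^ p * L `^ (n - 1) + H `^ n * L `^ (p - 1)) ^+ 2
  <= Cpn p n / 8 * (H `^ (2 - 2 * n) + L `^ (2 - 2 * n)).
Proof.
move=> n1 np H0 L0 K0 /andP[c1 c2] KE.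
have s0 : 0 < H + L by rewrite addr_gt0.
set s := H + L in s0.
pose u := H / s; pose x := L / s.
have u0 : 0 < u by rewrite divr_gt0.
have x0 : 0 < x by rewrite divr_gt0.
have xu : x = 1 - u by rewrite /x /u /s; field; rewrite gt_eqF.
have HE : H = s * u by rewrite /u mulrC divfK// gt_eqF.
have LE : L = s * x by rewrite /x mulrC divfK// gt_eqF.
pose z := 2 * (1 - c).
have z04 : 0 <= z <= 4 by rewrite /z; apply/andP; split; lra.
have u01 : 0 <= u <= 1 by apply/andP; split; lra.
have w0 : 0 <= 1 - z * u + z * u ^+ 2.
  rewrite (_ : _ + _ = K ^+ 2 / s ^+ 2); first by rewrite divr_ge0 ?sqr_ge0.
  by rewrite KE /z /u /s; field; rewrite gt_eqF.
have KpE : K `^ p = s `^ p * (1 - z * u + z * u ^+ 2) `^ (p / 2).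
  rewrite -(powR_half _ K0) -(powR_half _ (ltW s0)) -powRM ?sqr_ge0//; congr powR.
  by rewrite KE /z /u /s; field; rewrite gt_eqF.
have [_ /(_ z u z04 u01)] := cpn_max n1 np.
set C := Cpn p n => HC.
suff -> : (K `^ p - L `^ p) ^+ 2 * (1 - c ^+ 2) / (H `^ p * L `^ (n - 1) + H `^ n * L `^ (p - 1)) ^+ 2
  = cpn p n z u / 8 * (H `^ (2 - 2 * n) + L `^ (2 - 2 * n)).
  by rewrite ler_wpM2r ?addr_ge0 ?powR_ge0// ler_pM2r ?invr_gt0.
have zE : z = 2 * (1 - c) by [].
clearbody u x z.
rewrite {HC C} !powR_2sub2// !powR_sub1// KpE HE LE !powRM ?(ltW s0) ?(ltW u0) ?(ltW x0)//.
rewrite /cpn gt_eqF// lt_eqF; last by move: x0; rewrite xu; lra.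
rewrite -xu.
have P2 (y : R) : 0 < y -> y `^ (2 * n) = (y `^ n) ^+ 2.
  by move=> y0; rewrite mulrC powRrM powR_mulrn ?powR_ge0.
have P4 (y : R) : 0 < y -> y `^ (2 * n + 2) = (y `^ n) ^+ 2 * y ^+ 2.
  by move=> y0; rewrite powRD ?(gt_eqF y0) ?implybT// P2// powR_mulrn// ltW.
rewrite P4// !P2//.
have := powR_gt0 n u0; have := powR_gt0 n x0; have := powR_gt0 n s0.
have := powR_gt0 p u0; have := powR_gt0 p x0; have := powR_gt0 p s0.
move: (_ `^ (p / 2)) => Y; rewrite zE.
move: (u `^ n) (x `^ n) (u `^ p) (x `^ p) (s `^ n) (s `^ p) => a b a' b' N S S0 b'0 a'0 N0 b0 a0.
clear -s0 u0 x0 S0 b'0 a'0 N0 b0 a0.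
move: s u x s0 u0 x0 => s u x s0 u0 x0.
field.
by rewrite !gt_eqF// ?addr_gt0 ?mulr_gt0 ?exprn_gt0.
Qed.

(** With xi = H / K, the quantity 1 - 2 c xi + xi^2 is (L / K)^2. Here c is the cosine for h and k,
    and by the law of sines (1 - c^2) K^2 / L^2 is the squared sine for h and k - h. The two
    summands in the braces of F_pn come from the indices k - h and h, in this order. *)
Lemma Fpn_real (p n H L K c : R) : 0 < H -> 0 < L -> 0 < K ->
  L ^+ 2 = K ^+ 2 * (1 - 2 * c * (H / K) + (H / K) ^+ 2) ->
  1 / H `^ (2 * n - 2) * Fpn p n c (H / K) =
  (K `^ p - L `^ p) ^+ 2 * ((1 - c ^+ 2) * K ^+ 2 / L ^+ 2)
    / (H `^ p * L `^ (n - 1) + H `^ n * L `^ (p - 1)) ^+ 2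
  + (K `^ p - H `^ p) ^+ 2 * ((1 - c ^+ 2) * K ^+ 2 / L ^+ 2)
    / (L `^ p * H `^ (n - 1) + L `^ n * H `^ (p - 1)) ^+ 2.
Proof.
move=> H0 L0 K0 LE.
have qE : 1 - 2 * c * (H / K) + (H / K) ^+ 2 = (L / K) ^+ 2.
  rewrite [RHS]exprMn exprVn LE; move: (1 - _ + _) => q; field; by rewrite gt_eqF.
have HK0 : 0 < H / K by rewrite divr_gt0.
have LK0 : 0 < L / K by rewrite divr_gt0.
rewrite /Fpn (gt_eqF HK0) qE !(powR_half _ (ltW LK0)).
have pB (x : R) : 0 < x -> x `^ (p - n) = x `^ p / x `^ n.
  by move=> x0; rewrite powRB ?(gt_eqF x0) ?implybT.
have pD (x y a : R) : 0 < x -> 0 < y -> (x / y) `^ a = x `^ a / y `^ a.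
  by move=> x0 y0; rewrite powRM ?invr_ge0 ?(ltW x0) ?(ltW y0)// -powR_inv1 ?(ltW y0)// -powRrM mulN1r powRN.
rewrite (_ : 2 * n - 2 = - (2 - 2 * n)); last by ring.
rewrite powRN powR_2sub2// pB// !pD// !powR_sub1//.
have := powR_gt0 n H0; have := powR_gt0 n L0; have := powR_gt0 n K0.
have := powR_gt0 p H0; have := powR_gt0 p L0; have := powR_gt0 p K0.
move: (H `^ n) (L `^ n) (K `^ n) (H `^ p) (L `^ p) (K `^ p) => hn ln kn hp lp kp kp0 lp0 hp0 kn0 ln0 hn0.
clear -H0 L0 K0 kp0 lp0 hp0 kn0 ln0 hn0.
field.
by rewrite !gt_eqF// ?addr_gt0 ?mulr_gt0 ?exprn_gt0.
Qed.

Local Notation v := (rvec R).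

Lemma gterm_ge0 p n d (k h l : 'rV[int]_d) : 0 <= gterm p n k h l :> R.
Proof. by rewrite /gterm divr_ge0 ?sqr_ge0// mulr_ge0 ?sqr_ge0. Qed.

Lemma gterm_sin p n d (k h l : 'rV[int]_d) : l != 0 ->
  gterm p n k h l <= (znorm R k `^ p - znorm R l `^ p) ^+ 2 * sin2 R h l
  / (znorm R h `^ p * znorm R l `^ (n - 1)
     + znorm R h `^ n * znorm R l `^ (p - 1)) ^+ 2.
Proof.
move=> l0; rewrite /gterm ler_wpM2r ?invr_ge0 ?sqr_ge0// ler_wpM2l ?sqr_ge0//.
exact: Pnorm_sin.
Qed.

Lemma cos_bound d (x y : 'rV[R]_d) : -1 <= dotv x y / (rnorm x * rnorm y) <= 1.
Proof.
rewrite -ler_norml normrM normfV (ger0_norm (mulr_ge0 (rnorm_ge0 x) (rnorm_ge0 y))).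
have [h0|h0] := eqVneq (rnorm x * rnorm y) 0; first by rewrite h0 invr0 mulr0.
by rewrite ler_pdivrMr ?mul1r ?dotv_le// lt0r h0 mulr_ge0 ?rnorm_ge0.
Qed.

Lemma gterm_le p n d (k h : 'rV[int]_d) : 1 < n -> n <= p -> h != 0 -> h != k ->
  gterm p n k h (k - h) <= Cpn p n / 8 * (znorm R h `^ (2 - 2 * n) + znorm R (k - h) `^ (2 - 2 * n)).
Proof.
move=> n1 np h0 hk.
have l0 : k - h != 0 by rewrite subr_eq0 eq_sym.
apply: le_trans (gterm_sin p n k h l0) _.
have H0 : 0 < znorm R h by rewrite znorm_gt0.
have L0 : 0 < znorm R (k - h) by rewrite znorm_gt0.
rewrite (_ : sin2 R h (k - h) = 1 - (dotv (v h) (v (k - h)) / (znorm R h * znorm R (k - h))) ^+ 2); last first.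
  by rewrite /sin2 exprMn exprVn exprMn.
apply: gterm_real => //; [exact: znorm_ge0|exact: cos_bound|].
have -> : znorm R k ^+ 2 = znorm R h ^+ 2 + znorm R (k - h) ^+ 2 + 2 * dotv (v h) (v (k - h)).
  have {1}-> : k = h + (k - h) by rewrite subrKC.
  move: (k - h) => l.
  rewrite /znorm rvecD !rnorm_sqr !(dotvDl, dotvDr) (dotvC (v l)).
  by ring.
by field; rewrite !gt_eqF.
Qed.

Lemma gterm_Fpn p n d (k h : 'rV[int]_d) : k != 0 -> h != 0 -> h != k ->
  gterm p n k h (k - h) + gterm p n k (k - h) h <=
  1 / znorm R h `^ (2 * n - 2)
    * Fpn p n (cos (angle (v h) (v k))) (znorm R h / znorm R k).
Proof.
move=> k0 h0 hk.
have l0 : k - h != 0 by rewrite subr_eq0 eq_sym.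
have H0 : 0 < znorm R h by rewrite znorm_gt0.
have L0 : 0 < znorm R (k - h) by rewrite znorm_gt0.
have K0 : 0 < znorm R k by rewrite znorm_gt0.
rewrite /angle acosK; last by rewrite in_itv /= cos_bound.
rewrite -!/(znorm R _).
set c := _ / (znorm R h * znorm R k).
have cE : dotv (v h) (v k) = c * (znorm R h * znorm R k).
  by rewrite divfK// gt_eqF// mulr_gt0.
have LE : znorm R (k - h) ^+ 2 = znorm R k ^+ 2 * (1 - 2 * c * (znorm R h / znorm R k) + (znorm R h / znorm R k) ^+ 2).
  rewrite {1}/znorm rvecB rnorm_sqr !(dotvBl, dotvBr) (dotvC (v k) (v h)) cE -!rnorm_sqr -!/(znorm R _).
  by field; rewrite gt_eqF.
rewrite (Fpn_real p n H0 L0 K0 LE).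
have sE : sin2 R h (k - h) = (1 - c ^+ 2) * znorm R k ^+ 2 / znorm R (k - h) ^+ 2.
  rewrite /sin2 rvecB dotvBr cE -rnorm_sqr -/(znorm R h).
  have L20 : znorm R (k - h) ^+ 2 != 0 by rewrite expf_neq0// gt_eqF.
  rewrite (_ : (_ - _) ^+ 2 = znorm R h ^+ 2 * (znorm R (k - h) ^+ 2 - (1 - c ^+ 2) * znorm R k ^+ 2)).
    by move: (znorm R (k - h) ^+ 2) L20 => L2 L20; field; rewrite L20 gt_eqF.
  by rewrite LE; field; rewrite gt_eqF.
have sE' : sin2 R (k - h) h = sin2 R h (k - h).
  by rewrite /sin2 dotvC (mulrC (znorm R h ^+ 2)).
by rewrite lerD// -sE; [|rewrite -sE']; exact: gterm_sin.
Qed.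

End gterm.

(** * Asymptotic expansion of F_pn *)

Section enumeration.
Variable (R : realType).

Lemma finite_set_min (A : set R) : finite_set A -> A !=set0 ->
  exists2 x, A x & forall y, A y -> x <= y.
Proof.
move=> /finite_seqP[s ->] [x0 /= x0s].
elim: s x0 x0s => [//|a s IH] x0 _.
case: s IH => [_|b s IH].
  by exists a; rewrite /= ?inE// => y; rewrite inE => /eqP->.
have [x xs Hx] := IH b (mem_head b s).
have [ax|xa] := leP a x.
  exists a; first exact: mem_head.
  by move=> y /=; rewrite inE => /predU1P[->//|/Hx]; exact: le_trans.
exists x; first by rewrite /= inE xs orbT.
by move=> y /=; rewrite inE => /predU1P[->|/Hx//]; exact: ltW.
Qed.

(** Each element has a successor, by finiteness below any bound. An element that the iterated
    successors of 0 never reach would have all of them below it, an infinite set. *)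
Lemma increasing_enumeration_exists (S : set R) : S 0 -> (forall x, S x -> 0 <= x) ->
  (forall M, finite_set (S `&` [set x | x <= M])) -> (forall M, exists2 x, S x & M < x) ->
  exists l, increasing_enumeration S l.
Proof.
move=> S0 Sge Sfin Sunb.
have next x : {y : R | S y /\ x < y & forall z, S z -> x < z -> y <= z}.
  apply: cid2; have [y Sy xy] := Sunb x.
  have [z [[Sz zy] xz] Hz] := @finite_set_min (S `&` [set t | t <= y] `&` [set t | x < t])
     (finite_setIl _ (Sfin y)) (ex_intro _ y (conj (conj Sy (lexx y)) xy)).
  exists z => // t St xt; have [ty|/ltW yt] := leP t y; first exact: Hz.
  exact: le_trans yt.
pose nx x := sval (next x); pose l i := iter i nx 0.
have nxP x : S (nx x) /\ x < nx x by rewrite /nx; case: (next x).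
have nxmin x z : S z -> x < z -> nx x <= z by rewrite /nx; case: (next x) => ? ? /= H; exact: H.
have lS i : S (l i) by case: i => [//|i]; exact: (nxP _).1.
have linc i j : (i < j)%N -> l i < l j.
  elim: j => // j IH; rewrite ltnS leq_eqVlt => /predU1P[->|/IH]; first exact: (nxP _).2.
  by move=> /lt_trans; apply; exact: (nxP _).2.
exists l; split => //; split => //.
apply/seteqP; split => [_ [i _ <-]//|y Sy].
apply: contrapT => ny.
have ly i : l i < y.
  elim: i => [|i IH].
    rewrite lt_neqAle Sge// andbT; apply/eqP => y0; apply: ny; exists 0%N => //.
  rewrite lt_neqAle nxmin// andbT; apply/eqP => yE; apply: ny; exists i.+1 => //.
have linj : injective l.
  move=> i j e; apply/eqP; rewrite eqn_leq; apply/andP; split; rewrite leqNgt; apply/negP => /linc;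
    by rewrite e ltxx.
have : finite_set (range l).
  by apply: sub_finite_set (Sfin y) => _ [i _ <-]; split => //; exact: ltW.
have li : {in [set: nat] &, injective l} by move=> i j _ _; exact: linj.
by rewrite (eq_finite_set (inj_card_eq li)) => /infinite_nat.
Qed.

Variables (p n : R).
Hypotheses (p0 : 0 < p) (np : n <= p).

Lemma exponents_ge0 x : exponents p n x -> 0 <= x.
Proof.
by move=> [r [s [t [_ ->]]]]; rewrite !addr_ge0 ?mulr_ge0 ?subr_ge0 ?(ltW p0).
Qed.

Lemma exponents_finite M : finite_set (exponents p n `&` [set x | x <= M]).
Proof.
pose N := (Num.truncn `|M|).+1.
pose N' := (Num.truncn (`|M| / (p - n))).+1.
pose f (x : nat * nat * nat) : R := x.1.1%:R + (p - n) * x.1.2%:R + p * x.2%:R.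
apply: (@sub_finite_set _ _ (f @` (`I_N `*` `I_N' `*` `I_3))); last first.
  by apply: finite_image; apply: finite_setX; [apply: finite_setX|]; exact: finite_II.
move=> x [[r [s [t [t2 xE]]]] /= xM].
have e0 : 0 <= p - n by rewrite subr_ge0.
have h1 : 0 <= (p - n) * s%:R by rewrite mulr_ge0.
have h2 : 0 <= p * t%:R by rewrite mulr_ge0// ltW.
have Mx : x <= `|M| by apply: le_trans xM _; exact: ler_norm.
have rN : (r < N)%N.
  by rewrite ltnS truncn_ge_nat//; move: Mx; rewrite xE; lra.
(* For p = n the index s does not influence the exponent and is normalized to 0; otherwise (p - n) s
   <= M bounds it. *)
exists (r, (if p == n then 0%N else s), t).
  split; [split => //|] => //=.
  case: eqP => [_|/eqP pn]; first by rewrite /N'.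
  rewrite ltnS truncn_ge_nat; last by rewrite divr_ge0.
  rewrite ler_pdivlMr; last by rewrite lt0r e0 subr_eq0 pn.
  by rewrite mulrC; have := ler0n R r; move: Mx; rewrite xE; lra.
by rewrite /f /= xE; case: eqP => [->|//]; rewrite subrr !mul0r.
Qed.

Lemma lambdaP : increasing_enumeration (exponents p n) (lambda p n).
Proof.
rewrite /lambda; case: xgetP => // H; exfalso.
have [||||l /H//] := @increasing_enumeration_exists (exponents p n).
- by exists 0%N, 0%N, 0%N; rewrite !mulr0 !addr0.
- exact: exponents_ge0.
- exact: exponents_finite.
- move=> M; exists (Num.truncn `|M|).+1%:R.
    by exists (Num.truncn `|M|).+1, 0%N, 0%N; rewrite !mulr0 !addr0.
  by apply: le_lt_trans (ler_norm M) _; exact: truncnS_gt.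
Qed.
End enumeration.

(** * Uniform O-estimates and functions with asymptotic expansions *)

Section uniformO.
Variable R : realType.
Implicit Types (f g : R -> R -> R) (M : R).

(** The constant and the range of xi are chosen before c, so the estimate is uniform in c. No sign
    is imposed on C, hence the absolute values of constants in later estimates. *)
Definition uO f M := exists C, \forall xi \near (0:R)^'+,
  forall c, -1 <= c <= 1 -> `|f c xi| <= C * xi `^ M.

Lemma near0_gt0 : \forall x \near (0:R)^'+, 0 < x.
Proof. exact: nbhs_right_gt. Qed.

Lemma near0_lt (e : R) : 0 < e -> \forall x \near (0:R)^'+, x < e.
Proof. by move=> e0; exact: nbhs_right_lt. Qed.

Lemma uO_ext f g M : (\forall xi \near (0:R)^'+, forall c, -1 <= c <= 1 -> f c xi = g c xi) ->
  uO f M -> uO g M.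
Proof.
move=> fg [C HC]; exists C; near=> xi => c c1.
have <- : f c xi = g c xi by move: c c1; near: xi.
by move: c c1; near: xi.
Unshelve. all: by end_near. Qed.

Lemma uO_eq f g M : (forall c xi, f c xi = g c xi) -> uO f M -> uO g M.
Proof. by move=> fg; apply: uO_ext; near=> xi => c _. Unshelve. all: by end_near. Qed.

Lemma uO0 M : uO (fun _ _ => 0) M.
Proof. by exists 0; near=> xi => c _; rewrite normr0 mul0r. Unshelve. all: by end_near. Qed.

Lemma uOD f g M : uO f M -> uO g M -> uO (fun c xi => f c xi + g c xi) M.
Proof.
move=> [C HC] [D HD]; exists (C + D); near=> xi => c c1.
rewrite mulrDl; apply: le_trans (ler_normD _ _) _; apply: lerD.
  by move: c c1; near: xi.
by move: c c1; near: xi.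
Unshelve. all: by end_near. Qed.

Lemma uOM f g M N : uO f M -> uO g N -> uO (fun c xi => f c xi * g c xi) (M + N).
Proof.
move=> [C HC] [D HD]; exists (`|C| * `|D|); near=> xi => c c1.
have xi0 : 0 < xi by near: xi; exact: near0_gt0.
rewrite normrM powRD ?(gt_eqF xi0) ?implybT// mulrACA.
have Hf : `|f c xi| <= C * xi `^ M by move: c c1; near: xi.
have Hg : `|g c xi| <= D * xi `^ N by clear Hf; move: c c1; near: xi.
by apply: ler_pM => //; [apply: le_trans Hf _|apply: le_trans Hg _];
   rewrite ler_wpM2r ?powR_ge0// ler_norm.
Unshelve. all: by end_near. Qed.

Lemma uO_le f M N : N <= M -> uO f M -> uO f N.
Proof.
move=> NM [C HC]; exists `|C|; near=> xi => c c1.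
have xi0 : 0 < xi by near: xi; exact: near0_gt0.
have xi1 : xi < 1 by near: xi; exact: near0_lt.
have Hf : `|f c xi| <= C * xi `^ M by move: c c1; near: xi.
apply: le_trans Hf _; apply: le_trans (_ : `|C| * xi `^ M <= _).
  by rewrite ler_wpM2r ?powR_ge0// ler_norm.
by rewrite ler_wpM2l// ger_powR// xi0 ltW.
Unshelve. all: by end_near. Qed.

Lemma uO_sum (I : Type) (r : seq I) (P : pred I) (F : I -> R -> R -> R) M :
  (forall i, P i -> uO (F i) M) -> uO (fun c xi => \sum_(i <- r | P i) F i c xi) M.
Proof.
move=> HF; elim: r => [|i r IH].
  by apply: uO_eq (uO0 M) => c xi; rewrite big_nil.
case Pi : (P i); last by apply: uO_eq IH => c xi; rewrite big_cons Pi.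
by apply: uO_eq (uOD (HF i Pi) IH) => c xi; rewrite big_cons Pi.
Qed.

Lemma poly_bound (Q : {poly R}) : exists C, forall c, -1 <= c <= 1 -> `|Q.[c]| <= C.
Proof.
exists (\sum_(i < size Q) `|Q`_i|) => c c1.
rewrite horner_coef; apply: le_trans (ler_norm_sum _ _ _) _; apply: ler_sum => i _.
by rewrite normrM normrX ler_piMr// exprn_ile1// ler_norml.
Qed.

Definition monomial (Q : {poly R}) (a : R) : R -> R -> R := fun c xi => Q.[c] * xi `^ a.

Lemma uO_monomial Q a : uO (monomial Q a) a.
Proof.
have [C HC] := poly_bound Q; exists C; near=> xi => c c1.
by rewrite normrM (ger0_norm (powR_ge0 _ _)) ler_wpM2r ?powR_ge0// HC.
Unshelve. all: by end_near. Qed.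

Lemma uO_powR a : uO (fun _ xi => xi `^ a) a.
Proof. by apply: uO_eq (uO_monomial 1 a) => c xi; rewrite /monomial hornerC mul1r. Qed.

Lemma uO_cvg f M : uO f M -> 0 < M -> forall c, -1 <= c <= 1 -> f c xi @[xi --> (0:R)^'+] --> 0.
Proof.
move=> [C HC] M0 c c1.
have H : C * xi `^ M @[xi --> (0:R)^'+] --> 0.
  rewrite -[X in _ --> X](mulr0 C); apply: cvgM; first exact: cvg_cst.
  exact: powR_cvg0.
apply/cvgrPdist_le => e e0.
move/cvgrPdist_le: H => /(_ e e0) H.
near=> xi.
rewrite sub0r normrN; have H1 : `|f c xi| <= C * xi `^ M by move: c c1; near: xi.
apply: le_trans H1 _; apply: le_trans (ler_norm _) _.
have : `|0 - C * xi `^ M| <= e by near: xi.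
by rewrite sub0r normrN.
Unshelve. all: by end_near. Qed.

Section expandable.
Variable e : R.
Hypothesis e0 : 0 <= e.

Definition gen_poly (L : seq (nat * nat * {poly R})) (c xi : R) : R :=
  \sum_(t <- L) monomial t.2 (t.1.1%:R + e * t.1.2%:R) c xi.

(** One approximant for each order, with no compatibility between orders: in this form the property
    passes easily through products and compositions, and the coefficients are matched later by
    [powR_indep]. The power xi^p is kept out of this class, since p need not be of the form r + e
    s. *)
Definition expandable f := forall M : nat, exists L, uO (fun c xi => f c xi - gen_poly L c xi) M%:R.

Lemma expandable_ext f g : (\forall xi \near (0:R)^'+, forall c, -1 <= c <= 1 -> f c xi = g c xi) ->
  expandable f -> expandable g.
Proof.
move=> fg Ef M; have [L HL] := Ef M; exists L; apply: uO_ext HL.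
by apply: filterS fg => xi H c c1; rewrite H.
Qed.

Lemma expandable_monomial Q r s : expandable (monomial Q (r%:R + e * s%:R)).
Proof.
move=> M; exists [:: (r, s, Q)]; apply: uO_eq (uO0 _) => c xi.
by rewrite /gen_poly big_seq1 /= subrr.
Qed.

Lemma expandable_poly (Q : {poly R}) : expandable (fun c _ => Q.[c]).
Proof.
apply: expandable_ext (@expandable_monomial Q 0 0); near=> xi => c _.
by rewrite /monomial mulr0 addr0 powRr0 mulr1.
Unshelve. all: by end_near. Qed.

Lemma expandable_cst a : expandable (fun _ _ => a).
Proof.
apply: expandable_ext (@expandable_poly a%:P); near=> xi => c _; exact: hornerC.
Unshelve. all: by end_near. Qed.

Lemma expandable_xi : expandable (fun _ xi => xi).
Proof.
apply: expandable_ext (@expandable_monomial 1 1 0); near=> xi => c _.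
have xi0 : 0 < xi by near: xi; exact: near0_gt0.
by rewrite /monomial mulr0 addr0 powRr1 ?(ltW xi0)// hornerC mul1r.
Unshelve. all: by end_near. Qed.

Lemma expandable_powR : expandable (fun _ xi => xi `^ e).
Proof.
apply: expandable_ext (@expandable_monomial 1 0 1); near=> xi => c _.
by rewrite /monomial mulr1 add0r hornerC mul1r.
Unshelve. all: by end_near. Qed.

Lemma expandableD f g : expandable f -> expandable g -> expandable (fun c xi => f c xi + g c xi).
Proof.
move=> Ef Eg M; have [L HL] := Ef M; have [L' HL'] := Eg M.
exists (L ++ L'); apply: uO_eq (uOD HL HL') => c xi.
by rewrite /gen_poly big_cat /=; ring.
Qed.

Lemma uO_gen_poly L : uO (gen_poly L) 0.
Proof.
apply: uO_sum => t _; apply: uO_le (uO_monomial _ _).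
by rewrite addr_ge0// mulr_ge0.
Qed.

Lemma expandable_bounded f : expandable f -> uO f 0.
Proof.
move=> Ef; have [L HL] := Ef 0%N; apply: uO_eq (uOD HL (uO_gen_poly L)) => c xi.
by rewrite subrK.
Qed.

(** Approximants l and l' multiply because f g - l l' = f (g - l') + (f - l) l', where f and l' are
    bounded near 0 as e >= 0. *)
Lemma expandableM f g : expandable f -> expandable g -> expandable (fun c xi => f c xi * g c xi).
Proof.
move=> Ef Eg M; have [L HL] := Ef M; have [L' HL'] := Eg M.
exists [seq ((t.1.1 + t'.1.1)%N, (t.1.2 + t'.1.2)%N, t.2 * t'.2) | t <- L, t' <- L'].
apply: (@uO_ext (fun c xi => f c xi * (g c xi - gen_poly L' c xi) + (f c xi - gen_poly L c xi) * gen_poly L' c xi)).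
  near=> xi => c _.
  have xi0 : 0 < xi by near: xi; exact: near0_gt0.
  rewrite [X in _ = _ - X]/gen_poly big_allpairs_dep /=.
  rewrite (_ : \sum_(i1 <- L) _ = gen_poly L c xi * gen_poly L' c xi); first ring.
  rewrite /gen_poly mulr_suml; apply: eq_bigr => t _; rewrite mulr_sumr; apply: eq_bigr => t' _.
  rewrite /monomial hornerM !natrD mulrACA -powRD ?(gt_eqF xi0) ?implybT//.
  by congr (_ * _ `^ _); ring.
apply: uOD.
  by have := uOM (expandable_bounded Ef) HL'; rewrite add0r.
by have := uOM HL (uO_gen_poly L'); rewrite addr0.
Unshelve. all: by end_near. Qed.

Lemma expandableZ a f : expandable f -> expandable (fun c xi => a * f c xi).
Proof. by apply: expandableM; exact: expandable_cst. Qed.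

Lemma expandable_horner (Q : {poly R}) f : expandable f -> expandable (fun c xi => Q.[f c xi]).
Proof.
move=> Ef; elim/poly_ind: Q => [|Q a IH].
  by apply: expandable_ext (expandable_cst 0); near=> xi => c _; rewrite horner0.
apply: expandable_ext (expandableD (expandableM IH Ef) (expandable_cst a)).
by near=> xi => c _; rewrite hornerMXaddC.
Unshelve. all: by end_near. Qed.

Definition taylor (g : R -> R) := forall N, exists (Q : {poly R}) C,
  \forall w \near (0 : R), `|g w - Q.[w]| <= C * `|w| ^+ N.

Lemma uO_near0 f h (A : set R) : uO f h -> 0 < h -> nbhs (0:R) A ->
  \forall xi \near (0:R)^'+, forall c, -1 <= c <= 1 -> A (f c xi).
Proof.
move=> [C HC] h0 /nbhs_ballP[d /= d0 dA].
have H : C * xi `^ h @[xi --> (0:R)^'+] --> 0.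
  by rewrite -[X in _ --> X](mulr0 C); apply: cvgM; [exact: cvg_cst|exact: powR_cvg0].
move/cvgrPdist_lt: H => /(_ d d0) H.
near=> xi => c c1; apply: dA; rewrite /ball /= sub0r normrN.
have H1 : `|f c xi| <= C * xi `^ h by move: c c1; near: xi.
apply: le_lt_trans H1 _; apply: le_lt_trans (ler_norm _) _.
have : `|0 - C * xi `^ h| < d by near: xi.
by rewrite sub0r normrN.
Unshelve. all: by end_near. Qed.

(** Replacing g by its Taylor polynomial costs O(xi^(h N)), with N chosen so that h N >= M; a
    polynomial in f is expandable. *)
Lemma expandable_taylor (g : R -> R) f h : taylor g -> expandable f -> 0 < h -> uO f h ->
  expandable (fun c xi => g (f c xi)).
Proof.
move=> Tg Ef h0 fO M.
pose N := (Num.truncn (M%:R / h)).+1.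
have MN : M%:R <= h * N%:R.
  by rewrite -ler_pdivrMl// mulrC ltW// truncnS_gt.
have [Q [C HQ]] := Tg N.
have [L HL] := expandable_horner Q Ef M.
exists L.
have gQ : uO (fun c xi => g (f c xi) - Q.[f c xi]) M%:R.
  apply: uO_le MN _.
  have Cf := uO_near0 fO h0 HQ.
  have [D HD] := fO.
  exists (`|C| * `|D| ^+ N); near=> xi => c c1.
  have xi0 : 0 < xi by near: xi; exact: near0_gt0.
  have H1 : `|g (f c xi) - Q.[f c xi]| <= C * `|f c xi| ^+ N by move: c c1; near: xi.
  have H2 : `|f c xi| <= D * xi `^ h by clear H1; move: c c1; near: xi.
  apply: le_trans H1 _; apply: (@le_trans _ _ (`|C| * `|f c xi| ^+ N)).
    by rewrite ler_wpM2r ?exprn_ge0// ler_norm.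
  rewrite -mulrA ler_wpM2l// powRrM powR_mulrn ?powR_ge0// -exprMn.
  rewrite ler_pXn2r ?nnegrE ?mulr_ge0 ?powR_ge0//; apply: le_trans H2 _.
  by rewrite ler_wpM2r ?powR_ge0// ler_norm.
by apply: uO_eq (uOD gQ HL) => c xi; ring.
Unshelve. all: by end_near. Qed.

End expandable.
End uniformO.

(** * Taylor polynomials of (1 - w)^a and of its difference quotient *)

Section taylor_powR.
Variable R : realType.

Lemma poly_antideriv (Q : {poly R}) k : exists Q', Q'^`()%R = Q /\ Q'.[0] = k.
Proof.
exists (k%:P + 'X * \poly_(i < size Q) (Q`_i / i.+1%:R)); split.
  apply/polyP => i; rewrite coef_deriv coefD coefC /= add0r coefXM /= coef_poly.
  case: ltnP => iQ; last by rewrite mul0rn nth_default.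
  by rewrite -[LHS]mulr_natr divfK// pnatr_eq0.
by rewrite hornerD hornerC hornerM hornerX mul0r addr0.
Qed.

(** Differentiation lowers a by 1, so the induction on N runs over all a at once: an antiderivative
    of the approximant for a - 1, scaled by -a, approximates (1 - w)^a, and the mean value theorem
    on the segment from 0 to w gains one power of w. *)
Lemma powR_taylor N : forall a : R, exists (Q : {poly R}) C, 0 <= C /\
  forall w, `|w| < 2^-1 -> `|(1 - w) `^ a - Q.[w]| <= C * `|w| ^+ N.
Proof.
elim: N => [|N IH] a.
  (* On [1/2, 3/2] the first summand bounds the power for a >= 0, the second for a < 0. *)
  exists 0, ((3 / 2) `^ a + 2^-1 `^ a); split; first by rewrite addr_ge0 ?powR_ge0.
  move=> w; rewrite ltr_norml => /andP[w1 w2].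
  rewrite horner0 subr0 expr0 mulr1 ger0_norm ?powR_ge0//.
  have [a0|a0] := leP 0 a.
    apply: ler_wpDr; first exact: powR_ge0.
    by rewrite ge0_ler_powR ?nnegrE//; lra.
  apply: ler_wpDl; first exact: powR_ge0.
  rewrite -[a]opprK (powRN _ (- a)) (powRN _ (- a)) lef_pV2 ?posrE ?powR_gt0//; last lra.
  by rewrite ge0_ler_powR ?nnegrE//; lra.
have [Q [C [C0 HQ]]] := IH (a - 1).
have [Q' [dQ' Q'0]] := poly_antideriv (- a *: Q) 1.
exists Q', (`|a| * C); split; first by rewrite mulr_ge0.
pose r (w : R) := (1 - w) `^ a - Q'.[w].
have r0 : r 0 = 0 by rewrite /r subr0 powR1 Q'0 subrr.
have dr (w : R) : `|w| < 2^-1 -> is_derive w (1 : R) r (- a * ((1 - w) `^ (a - 1) - Q.[w])).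
  rewrite ltr_norml => /andP[w1 w2].
  have d1 : is_derive w 1 (fun w : R => 1 - w) (- 1).
    by apply: is_derive_eq; rewrite add0r mul1r.
  have w0 : 0 < 1 - w by lra.
  have d2 := is_derive_comp1 d1 (@is_derive1_powR R a (1 - w) w0).
  have d3 := @is_derive_poly R Q' w.
  apply: is_derive_eq; rewrite dQ' hornerZ; by ring.
move=> w w2.
have cr (x y : R) : `|x| < 2^-1 -> `|y| < 2^-1 -> {within `[x, y], continuous r}.
  move=> hx hy; apply: continuous_in_subspaceT => z; rewrite inE /= in_itv /= => /andP[z1 z2].
  have [|dz _] := dr z; first by move: hx hy; rewrite !ltr_norml; lra.
  by apply: differentiable_continuous; exact/derivable1_diffP.
have [c cw ->] : exists2 c, `|c| <= `|w| & `|(1 - w) `^ a - Q'.[w]| = `|- a * ((1 - c) `^ (a - 1) - Q.[c])| * `|w|.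
  have h0 : `|0 : R| < 2^-1 by rewrite normr0 invr_gt0.
  have [w0|w0] := leP 0 w.
    have [||c] := @MVT_segment R r (fun c => - a * ((1 - c) `^ (a - 1) - Q.[c])) 0 w w0.
    - move=> x; rewrite in_itv /= => /andP[x1 x2]; apply: dr.
      by move: w2; rewrite !ltr_norml; lra.
    - exact: cr.
    rewrite in_itv /= => /andP[c1 c2]; rewrite r0 !subr0 => H; exists c.
      by rewrite !ger0_norm.
    by rewrite -/(r w) H normrM.
  have [||c] := @MVT_segment R r (fun c => - a * ((1 - c) `^ (a - 1) - Q.[c])) w 0 (ltW w0).
  - move=> x; rewrite in_itv /= => /andP[x1 x2]; apply: dr.
    by move: w2; rewrite !ltr_norml; lra.
  - exact: cr.
  rewrite in_itv /= => /andP[c1 c2]; rewrite r0 !sub0r => H; exists c.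
    by rewrite !ler0_norm// ?lerN2//; exact: ltW.
  by rewrite -/(r w) -[LHS]normrN H normrM normrN.
rewrite normrM normrN -!mulrA ler_wpM2l// exprSr mulrA ler_wpM2r//.
apply: le_trans (HQ c _) _; first exact: le_lt_trans w2.
by rewrite ler_wpM2l// lerXn2r ?nnegrE.
Qed.

Lemma near0_norm_lt (d : R) : 0 < d -> \forall w \near (0 : R), `|w| < d.
Proof.
move=> d0; apply/nbhs_ballP; exists d => // w; by rewrite /ball /= sub0r normrN.
Qed.

Lemma taylor_powR (a : R) : taylor (fun w => (1 - w) `^ a).
Proof.
move=> N; have [Q [C [_ HQ]]] := powR_taylor N a.
exists Q, C; near=> w; apply: HQ; near: w; apply: near0_norm_lt.
by rewrite invr_gt0.
Unshelve. all: by end_near. Qed.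

(** The estimate at w = 0 forces Q(0) = 1, so 1 - Q is divisible by X and the quotient approximates
    [powquo a] one order lower. At w = 0 itself the bound is a limit from the right. *)
Lemma taylor_powquo (a : R) : 0 <= a -> taylor (powquo a).
Proof.
move=> a0 N; have [Q [C [C0 HQ]]] := powR_taylor N.+1 a.
have Q0 : Q.[0] = 1.
  have := HQ 0; rewrite normr0 subr0 powR1 expr0n mulr0 invr_gt0 ltr0n => /(_ isT).
  by rewrite normr_le0 subr_eq0 => /eqP.
have /factor_theorem[Q2 Q2E] : root (1 - Q) 0.
  by rewrite /root hornerD hornerN hornerC Q0 subrr.
rewrite subr0 in Q2E.
have H w : `|w| < 2^-1 -> w != 0 -> `|powquo a w - Q2.[w]| <= C * `|w| ^+ N.
  move=> w2 w0.
  have w1 : 0 <= 1 - w by move: w2; rewrite ltr_norml; lra.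
  rewrite -(ler_pM2l (x := `|w|)) ?normr_gt0// -normrM mulrBr mul_powquo (max_idPl w1).
  rewrite mulrCA -exprS; apply: le_trans (HQ w w2).
  have := congr1 (fun p : {poly R} => p.[w]) Q2E.
  rewrite hornerD hornerN hornerC hornerM hornerX => E.
  rewrite (_ : _ - w * _ = - ((1 - w) `^ a - Q.[w])) ?normrN//; rewrite (mulrC w) -E; ring.
exists Q2, C.
have H0 : `|powquo a 0 - Q2.[0]| <= C * `|0 : R| ^+ N.
  rewrite -subr_ge0.
  have cu : (fun w : R => C * `|w| ^+ N - `|powquo a w - Q2.[w]|) w @[w --> (0 : R)^'+] -->
     C * `|0 : R| ^+ N - `|powquo a 0 - Q2.[0]|.
    apply: cvg_at_right_filter; apply: cvgB.
      apply: cvgM; first exact: cvg_cst.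
      apply: (cvg_comp (fun w : R => `|w|) (fun w => w ^+ N)); last exact: exprn_continuous.
      exact: norm_continuous.
    apply: cvg_norm; apply: cvgB; first exact: powquo_continuous.
    exact: continuous_horner.
  apply: (cvgr_to_ge cu); near=> w; rewrite subr_ge0; apply: H.
    have w0 : 0 < w by near: w; exact: near0_gt0.
    by rewrite gtr0_norm//; near: w; apply: near0_lt; rewrite invr_gt0.
  by rewrite gt_eqF//; near: w; exact: near0_gt0.
near=> w.
have [->//|w0] := eqVneq w 0.
apply: H => //; near: w; apply: near0_norm_lt.
Unshelve. all: by end_near. Qed.

End taylor_powR.

(** * The function F_pn near xi = 0 *)

Section Fpn_expansion.
Variable (R : realType) (p n : R).
Hypotheses (n0 : 0 < n) (np : n <= p).
Let e := p - n.
Let e0 : 0 <= e. Proof. by rewrite subr_ge0. Qed.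
Let p0 : 0 < p. Proof. exact: lt_le_trans np. Qed.
Local Notation expandable := (expandable e).

(* With q = 1 - [wq c xi] = 1 - 2 c xi + xi^2, the squared bracket dividing 1 - c^2 in [Fpn] is
   q^p / [Ypn c xi]; [Gpn] and [Hpn] come from the two terms in braces. *)
Definition wq (c xi : R) : R := 2 * c * xi - xi ^+ 2.

(** For p = n the summand xi^e q^(-e/2) is constantly 1, not small, so Taylor expansion at 0 does
    not apply to it; the factor is then the constant 1/4. The two minus signs produce the shape 1 -
    w of [taylor_powR]. *)
Definition Ypn (c xi : R) : R :=
  if e == 0 then 1 / 4 else (1 - (- (xi `^ e * (1 - wq c xi) `^ (- e / 2)))) `^ (- 2).

Definition Gpn (c xi : R) : R :=
  (1 - c ^+ 2) * (1 - wq c xi) `^ (- p) * Ypn c xi * (1 - wq c xi) `^ (- 1).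
Definition Hpn (c xi : R) : R :=
  (1 - c ^+ 2) * (1 - wq c xi) `^ (- p) * Ypn c xi
  * ((2 * c - xi) * powquo (p / 2) (wq c xi)) ^+ 2.

Lemma expandable_lin : expandable (fun c xi : R => 2 * c - xi).
Proof.
apply: (expandable_ext (f := fun c xi => (2 *: 'X).[c] + (- 1) * xi)).
  by near=> xi => c _; rewrite hornerZ hornerX; ring.
by apply: expandableD; [exact: expandable_poly|apply: expandableZ => //; exact: expandable_xi].
Unshelve. all: by end_near. Qed.

Lemma uO_wq : uO wq 1.
Proof.
have h1 : uO (fun _ xi => xi : R) 1.
  apply: (@uO_ext _ (fun _ xi => xi `^ 1) _ 1 _ (@uO_powR R 1)); near=> xi => c _.
  by rewrite powRr1// ltW//; near: xi; exact: near0_gt0.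
have h2 := expandable_bounded e0 expandable_lin.
by have := uOM h2 h1; rewrite add0r; apply: uO_eq => c xi; rewrite /wq; ring.
Unshelve. all: by end_near. Qed.

Lemma expandable_wq : expandable wq.
Proof.
apply: (expandable_ext (f := fun c xi => (2 * c - xi) * xi)).
  by near=> xi => c _; rewrite /wq; ring.
by apply: expandableM => //; [exact: expandable_lin|exact: expandable_xi].
Unshelve. all: by end_near. Qed.

Lemma expandable_qpow a : expandable (fun c xi => (1 - wq c xi) `^ a).
Proof.
exact: (expandable_taylor e0 (@taylor_powR R a) expandable_wq ltr01 uO_wq).
Qed.

Lemma expandable_Y : expandable Ypn.
Proof.
rewrite /Ypn; case: eqP => [_|/eqP en]; first exact: expandable_cst.
have e1 : 0 < e by rewrite lt0r en.
pose y (c xi : R) := - 1 * (xi `^ e * (1 - wq c xi) `^ (- e / 2)).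
have Ey : expandable y.
  apply: expandableZ => //; apply: expandableM => //; first exact: expandable_powR.
  exact: expandable_qpow.
have yO : uO y e.
  have := uOM (@uO_powR R e) (expandable_bounded e0 (expandable_qpow (- e / 2))).
  rewrite addr0 => H; have := uOM (expandable_bounded e0 (expandable_cst e (- 1))) H.
  by rewrite add0r.
have := expandable_taylor e0 (@taylor_powR R (- 2)) Ey e1 yO.
by apply: expandable_ext; near=> xi => c _; rewrite /y mulN1r.
Unshelve. all: by end_near. Qed.

Lemma expandable_base : expandable (fun c xi => (1 - c ^+ 2) * (1 - wq c xi) `^ (- p) * Ypn c xi).
Proof.
apply: expandableM => //; last exact: expandable_Y.
apply: expandableM => //; last exact: expandable_qpow.
apply: expandable_ext (expandable_poly e (1 - 'X ^+ 2)); near=> xi => c _.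
by rewrite hornerD hornerN hornerXn hornerC.
Unshelve. all: by end_near. Qed.

Lemma expandable_G : expandable Gpn.
Proof. by apply: expandableM => //; [exact: expandable_base|exact: expandable_qpow]. Qed.

Lemma expandable_H : expandable Hpn.
Proof.
apply: expandableM => //; first exact: expandable_base.
have El : expandable (fun c xi => (2 * c - xi) * powquo (p / 2) (wq c xi)).
  apply: expandableM => //; first exact: expandable_lin.
  apply: (expandable_taylor e0 _ expandable_wq ltr01 uO_wq).
  by apply: taylor_powquo; rewrite divr_ge0// ltW.
exact: expandableM.
Qed.

(** Expanding (1 - xi^p)^2 isolates xi^p from the factors that expand in xi and xi^(p-n); its powers
    0, 1, 2 are the values of t in [exponents]. *)
Lemma Fpn_GH : \forall xi \near (0:R)^'+, forall c, -1 <= c <= 1 ->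
  Fpn p n c xi = Gpn c xi + - 2 * (Gpn c xi * xi `^ p) + Gpn c xi * xi `^ (2 * p) + Hpn c xi.
Proof.
near=> xi => c c1.
have xi0 : 0 < xi by near: xi; exact: near0_gt0.
have wl : `|wq c xi| < 2^-1.
  move: c c1; near: xi.
  apply: (uO_near0 uO_wq ltr01 (A := [set w | `|w| < 2^-1])).
  by apply: near0_norm_lt; rewrite invr_gt0.
have q0 : 0 < 1 - wq c xi by move: wl; rewrite ltr_norml; lra.
rewrite /Fpn (gt_eqF xi0) (_ : 1 - 2 * c * xi + xi ^+ 2 = 1 - wq c xi); last by rewrite /wq; ring.
have quoE : (1 - (1 - wq c xi) `^ (p / 2)) / xi = (2 * c - xi) * powquo (p / 2) (wq c xi).
  have := mul_powquo (p / 2) (wq c xi); rewrite (max_idPl (ltW q0)) => <-.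
  by rewrite /wq; field; rewrite gt_eqF.
rewrite quoE /Gpn /Hpn; move: ((2 * c - xi) * _) => E.
set q := 1 - wq c xi in q0 *.
have den : (q `^ (p / 2) + xi `^ (p - n) * q `^ (n / 2)) ^+ 2 = q `^ p / Ypn c xi /\ 0 < Ypn c xi.
  have qE : q `^ (p / 2) ^+ 2 = q `^ p.
    by rewrite -powR_mulrn ?powR_ge0// -powRrM; congr powR; field.
  have -> : q `^ (n / 2) = q `^ (p / 2) * q `^ (- e / 2).
    by rewrite -powRD ?(gt_eqF q0) ?implybT//; congr powR; rewrite /e; field.
  rewrite -/e mulrCA -[X in (X + _) ^+ 2]mulr1 -mulrDr exprMn qE /Ypn.
  case: eqP => [->|_].
    by rewrite oppr0 mul0r !powRr0; split => //; field.
  have B0 : 0 < 1 + xi `^ e * q `^ (- e / 2) by rewrite ltr_pwDl// mulr_ge0 ?powR_ge0.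
  by rewrite opprK powRN invrK invr_gt0 powR_gt0// powR_mulrn ?(ltW B0).
have [-> Y0] := den.
rewrite !powRN powRr1 ?(ltW q0)//.
rewrite (_ : 2 * p = p * 2) ?(powRrM xi) ?powR_mulrn ?powR_ge0//; last by ring.
have Q0 := powR_gt0 p q0.
move: (q `^ p) Q0 (Ypn c xi) Y0 (xi `^ p) => Q Q0 Y Y0 X.
by field; rewrite !gt_eqF.
Unshelve. all: by end_near. Qed.

End Fpn_expansion.

(** * Coefficients of the expansion *)

Section expansion_coefficients.
Variable (R : realType) (p n : R).
Hypotheses (n0 : 0 < n) (np : n <= p).
Let e0 : 0 <= p - n. Proof. by rewrite subr_ge0. Qed.
Let p0 : 0 < p. Proof. exact: lt_le_trans np. Qed.
Let lam := lambda p n.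

Lemma lambda_0 : lam 0 = 0. Proof. by have [] := lambdaP p0 np. Qed.
Lemma lambda_lt i j : (i < j)%N -> lam i < lam j.
Proof. by have [_ [H _]] := lambdaP p0 np; exact: H. Qed.
Lemma lambda_le i j : (i <= j)%N -> lam i <= lam j.
Proof. by rewrite leq_eqVlt => /predU1P[->//|/lambda_lt/ltW]. Qed.
Lemma lambda_inj : injective lam.
Proof. by move=> i j; case: (ltngtP i j) => // /lambda_lt H E; rewrite E ltxx in H. Qed.
Lemma lambda_ltn i j : (lam i < lam j) = (i < j)%N.
Proof.
apply/idP/idP => [|/lambda_lt//]; rewrite ltnNge; apply: contraTN => /lambda_le.
by rewrite leNgt.
Qed.
Lemma lambda_ge0 i : 0 <= lam i. Proof. by rewrite -lambda_0 lambda_le. Qed.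
Lemma lambda_surj x : exponents p n x -> exists i, x = lam i.
Proof. by have [_ [_ <-]] := lambdaP p0 np; move=> [i _ <-]; exists i. Qed.

Lemma Fpn_approx (M : nat) : exists L : seq (R * {poly R}),
  (forall t, t \in L -> exponents p n t.1) /\
  uO (fun c xi => Fpn p n c xi - \sum_(t <- L) monomial t.2 t.1 c xi) M%:R.
Proof.
have [LG HG] := expandable_G np M; have [LH HH] := expandable_H n0 np M.
pose ex (t : nat * nat * {poly R}) := t.1.1%:R + (p - n) * t.1.2%:R.
exists ([seq (ex t, t.2) | t <- LG] ++ [seq (ex t + p, - 2 *: t.2) | t <- LG]
   ++ [seq (ex t + 2 * p, t.2) | t <- LG] ++ [seq (ex t, t.2) | t <- LH]); split.
  move=> t; rewrite !mem_cat => /or4P[] /mapP[[[r s] Q] _ ->]; rewrite /ex /=.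
  - by exists r, s, 0%N; rewrite mulr0 addr0.
  - by exists r, s, 1%N; rewrite mulr1.
  - by exists r, s, 2%N; rewrite (mulrC p).
  - by exists r, s, 0%N; rewrite mulr0 addr0.
have xp (a : R) : 0 <= a -> uO (fun _ xi => xi `^ a) 0 by move=> a0; apply: uO_le a0 (@uO_powR R a).
have c2 : uO (fun _ _ => - 2 : R) 0 by exact: (expandable_bounded e0 (expandable_cst _ _)).
have H1 := uOM c2 (uOM HG (xp p (ltW p0))).
have H2 := uOM HG (xp (2 * p) (mulr_ge0 (ler0n _ _) (ltW p0))).
rewrite ?addr0 ?add0r in H1 H2.
apply: uO_ext (uOD (uOD (uOD HG H1) H2) HH).
near=> xi => c c1.
have xi0 : 0 < xi by near: xi; exact: near0_gt0.
have -> : Fpn p n c xi = Gpn p n c xi + - 2 * (Gpn p n c xi * xi `^ p) + Gpn p n c xi * xi `^ (2 * p) + Hpn p n c xi.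
  by move: c c1; near: xi; exact: Fpn_GH.
rewrite !big_cat /= !big_map /=.
have exE L : gen_poly (p - n) L c xi = \sum_(t <- L) monomial t.2 (ex t) c xi by [].
rewrite !exE; clearbody ex; clear exE H1 H2 HG HH.
have E (a : R) : \sum_(t <- LG) monomial t.2 (ex t + a) c xi = (\sum_(t <- LG) monomial t.2 (ex t) c xi) * xi `^ a.
  rewrite mulr_suml; apply: eq_bigr => t _.
  by rewrite /monomial powRD ?(gt_eqF xi0) ?implybT// mulrA.
have -> : \sum_(t <- LG) monomial (- 2 *: t.2) (ex t + p) c xi = - 2 * ((\sum_(t <- LG) monomial t.2 (ex t) c xi) * xi `^ p).
  by rewrite -E mulr_sumr; apply: eq_bigr => t _; rewrite /monomial hornerZ -mulrA.
rewrite (E (2 * p)); ring.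
Unshelve. all: by end_near. Qed.

(** Terms with exponent at least lambda_N go into the error; every smaller exponent is lambda_i for
    one i < N, and terms with equal exponents are added up. The polynomials still depend on N. *)
Lemma Fpn_level N : exists P : nat -> {poly R},
  uO (fun c xi => Fpn p n c xi - \sum_(i < N) monomial (P i) (lam i) c xi) (lam N).
Proof.
have [L [LE HL]] := Fpn_approx (Num.truncn (lam N)).+1.
exists (fun i => \sum_(t <- L | t.1 == lam i) t.2).
have HL' : uO (fun c xi => Fpn p n c xi - \sum_(t <- L) monomial t.2 t.1 c xi) (lam N).
  by apply: uO_le HL; rewrite ltW// truncnS_gt.
have HT : uO (fun c xi => \sum_(t <- L | lam N <= t.1) monomial t.2 t.1 c xi) (lam N).
  by apply: uO_sum => t tN; apply: uO_le tN (uO_monomial _ _).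
apply: uO_eq (uOD HL' HT) => c xi.
have -> : \sum_(i < N) monomial (\sum_(t <- L | t.1 == lam i) t.2) (lam i) c xi
  = \sum_(t <- L | t.1 < lam N) monomial t.2 t.1 c xi.
  transitivity (\sum_(i < N) \sum_(t <- L) (if t.1 == lam i then monomial t.2 t.1 c xi else 0)).
    apply: eq_bigr => i _; rewrite -big_mkcond /= /monomial horner_sum mulr_suml.
    by apply: eq_bigr => t /eqP ->.
  rewrite exchange_big /= [RHS]big_mkcond /= big_seq [RHS]big_seq; apply: eq_bigr => t tL.
  have [k ->] := lambda_surj (LE t tL); rewrite lambda_ltn; case: ltnP => kN.
    rewrite (bigD1 (Ordinal kN))//= eqxx big1 ?addr0// => i ik.
    rewrite ifF//; apply: contraNF ik => /eqP /lambda_inj E; by apply/eqP/val_inj.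
  rewrite big1// => i _; rewrite ifF//; apply/negP => /eqP /lambda_inj E.
  by have := ltn_ord i; rewrite -E ltnNge kN.
rewrite (bigID (fun t => lam N <= t.1)) /=.
have -> : \sum_(t <- L | ~~ (lam N <= t.1)) monomial t.2 t.1 c xi = \sum_(t <- L | t.1 < lam N) monomial t.2 t.1 c xi.
  by apply: eq_bigl => t; rewrite ltNge.
by ring.
Qed.

Lemma uO_slice (f : R -> R -> R) M c : -1 <= c <= 1 -> uO f M -> uO (fun _ xi => f c xi) M.
Proof.
move=> c1 [C HC]; exists C; near=> xi => _ _.
by move: c c1; near: xi.
Unshelve. all: by end_near. Qed.

(* The lowest nonzero term would dominate the others. *)
Lemma powR_indep N (a : nat -> R) :
  uO (fun _ xi => \sum_(i < N) a i * xi `^ lam i) (lam N) -> forall i, (i < N)%N -> a i = 0.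
Proof.
move=> H i; elim/ltn_ind: i => i IH iN.
have H2 : uO (fun _ xi => \sum_(j < N | (i < j)%N) a j * xi `^ lam j) (lam i.+1).
  apply: uO_sum => j ij; apply: uO_le (lambda_le ij) _.
  by apply: uO_eq (uO_monomial (a j)%:P (lam j)) => c xi; rewrite /monomial hornerC.
have H3 : uO (fun _ xi => a i * xi `^ lam i) (lam i.+1).
  have H2' := uOM (uO_monomial (- 1)%:P 0) H2; rewrite add0r in H2'.
  apply: uO_eq (uOD (uO_le (lambda_le iN) H) H2') => c xi.
  rewrite /monomial hornerC powRr0 mulr1 mulN1r.
  rewrite (bigID (fun j : 'I_N => (i < j)%N)) /= addrAC subrr add0r.
  rewrite (bigD1 (Ordinal iN)) /= ?ltnn// big1 ?addr0// => j /andP[ji jN].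
  rewrite -leqNgt in ji; rewrite IH ?mul0r// ltn_neqAle ji andbT.
  by apply: contraNneq jN => E; apply/eqP/val_inj.
have H4 := uOM H3 (@uO_powR R (- lam i)).
have H5 : uO (fun _ _ => a i) (lam i.+1 - lam i).
  apply: uO_ext H4; near=> xi => c _.
  have xi0 : 0 < xi by near: xi; exact: near0_gt0.
  by rewrite -mulrA -powRD ?(gt_eqF xi0) ?implybT// subrr powRr0 mulr1.
have := uO_cvg H5; rewrite subr_gt0 lambda_lt// => /(_ isT 0).
rewrite lerN10 ler01 => /(_ isT) H6.
by have := cvg_unique _ H6 (cvg_cst (a i)); move=> ->.
Unshelve. all: by end_near. Qed.

(** Cutting the level N expansion after index i and comparing it with level i + 1 at a fixed c,
    independence of the powers makes the coefficients agree on [-1, 1]. Hence the diagonal choice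
    serves every N. *)
Lemma Fpn_coef : exists P : nat -> {poly R}, forall N,
  uO (fun c xi => Fpn p n c xi - \sum_(i < N) monomial (P i) (lam i) c xi) (lam N).
Proof.
have [Pl HPl] := choice Fpn_level.
exists (fun i => Pl i.+1 i) => N.
suff E i c : (i < N)%N -> -1 <= c <= 1 -> (Pl N i).[c] = (Pl i.+1 i).[c].
  apply: uO_ext (HPl N); near=> xi => c c1; congr (_ - _); apply: eq_bigr => i _.
  by rewrite /monomial E.
move=> iN c1; apply/eqP; rewrite -subr_eq0; apply/eqP.
apply: (@powR_indep i.+1 (fun j => (Pl N j).[c] - (Pl i.+1 j).[c])) => //.
apply: (@uO_slice (fun c xi => \sum_(i0 < i.+1) ((Pl N i0).[c] - (Pl i.+1 i0).[c]) * xi `^ lam i0)) => //.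
have H1 := HPl i.+1; have H2 := HPl N.
have H3 : uO (fun c xi => \sum_(j < N | (i < j)%N) monomial (Pl N j) (lam j) c xi) (lam i.+1).
  by apply: uO_sum => j ij; apply: uO_le (lambda_le ij) (uO_monomial _ _).
have H2' := uOM (uO_monomial (- 1)%:P 0) (uOD (uO_le (lambda_le iN) H2) H3); rewrite add0r in H2'.
apply: uO_eq (uOD H1 H2') => c' xi.
rewrite {2}/monomial hornerC powRr0 mulr1 mulN1r.
rewrite (bigID (fun j : 'I_N => (i < j)%N)) /=.
rewrite (_ : \sum_(i0 < N | ~~ (i < i0)%N) _ = \sum_(j < i.+1) monomial (Pl N j) (lam j) c' xi).
  under [RHS]eq_bigr => j _ do rewrite mulrBl.
  by rewrite sumrB /monomial; ring.
rewrite [RHS](big_ord_widen N (fun j => monomial (Pl N j) (lam j) c' xi) iN).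
by apply: eq_bigl => j; rewrite -leqNgt ltnS.
Unshelve. all: by end_near. Qed.

End expansion_coefficients.

(** * Continuous remainders, uniqueness, identification with [expansion] *)

Section expansion_remainders.
Variable (R : realType) (p n : R).
Hypotheses (n0 : 0 < n) (np : n <= p).
Let e0 : 0 <= p - n. Proof. by rewrite subr_ge0. Qed.
Let p0 : 0 < p. Proof. exact: lt_le_trans np. Qed.
Local Notation lam := (lambda p n).

(** The quantity is (c - xi)^2 + (1 - c^2), which vanishes only for xi = c = 1 or xi = c = -1: the
    first is the excluded point, the second has xi < 0. *)
Lemma Edom_gt0 (c xi : R) : Edom (c, xi) -> 0 < 1 - 2 * c * xi + xi ^+ 2.
Proof.
move=> [/= /andP[c1 c2] [xi0 ne]].
have : 0 <= (c - xi) ^+ 2 + (1 - c ^+ 2) by rewrite addr_ge0 ?sqr_ge0//; nra.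
rewrite (_ : (c - xi) ^+ 2 + _ = 1 - 2 * c * xi + xi ^+ 2); last by ring.
rewrite le_eqVlt => /predU1P[q0|//].
have c21 : 0 <= 1 - c ^+ 2 by nra.
have cx0 := sqr_ge0 (c - xi).
have E1 : (c - xi) ^+ 2 = 0 by nra.
have E2 : 1 - c ^+ 2 = 0 by nra.
move/eqP: E1; rewrite sqrf_eq0 subr_eq0 => /eqP cx.
exfalso; apply: ne; rewrite -cx in xi0 *.
by have -> : c = 1 by nra.
Qed.

Lemma Fpn_cvg_pos (c xi : R) : Edom (c, xi) -> 0 < xi ->
  Fpn p n x.1 x.2 @[x --> (c, xi)] --> Fpn p n c xi.
Proof.
move=> Ex xi0; have q0 := Edom_gt0 Ex.
have cc : fst x @[x --> (c, xi)] --> c by exact: cvg_fst.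
have cx : snd x @[x --> (c, xi)] --> xi by exact: cvg_snd.
have k (a : R) : (fun _ : R * R => a) x @[x --> (c, xi)] --> a by exact: cvg_cst.
have sq (f : R * R -> R) (l : R) : f x @[x --> (c, xi)] --> l -> f x ^+ 2 @[x --> (c, xi)] --> l ^+ 2.
  by move=> fl; apply: cvgM.
have cq : (1 - 2 * x.1 * x.2 + x.2 ^+ 2) @[x --> (c, xi)] --> 1 - 2 * c * xi + xi ^+ 2.
  apply: cvgD; last exact: sq.
  apply: cvgB => //; apply: cvgM => //; exact: cvgM.
have D0 : 0 < (1 - 2 * c * xi + xi ^+ 2) `^ (p / 2) + xi `^ (p - n) * (1 - 2 * c * xi + xi ^+ 2) `^ (n / 2).
  by rewrite addr_gt0 ?mulr_gt0 ?powR_gt0.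
pose F (x : R * R) := let q := 1 - 2 * x.1 * x.2 + x.2 ^+ 2 in
  (1 - x.1 ^+ 2) / (q `^ (p / 2) + x.2 `^ (p - n) * q `^ (n / 2)) ^+ 2
    * ((1 - x.2 `^ p) ^+ 2 / q + ((1 - q `^ (p / 2)) / x.2) ^+ 2).
have -> : Fpn p n c xi = F (c, xi) by rewrite /Fpn (gt_eqF xi0).
have cF : F x @[x --> (c, xi)] --> F (c, xi).
  rewrite /F /=; apply: cvgM.
    apply: cvgM; first by apply: cvgB => //; exact: sq.
    apply: cvgV; first by rewrite expf_neq0// gt_eqF.
    apply: sq; apply: cvgD; first exact: cvg_powR.
    by apply: cvgM; exact: cvg_powR.
  apply: cvgD.
    apply: cvgM; last by apply: cvgV => //; rewrite gt_eqF.
    by apply: sq; apply: cvgB => //; exact: cvg_powR.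
  apply: sq; apply: cvgM; last by apply: cvgV => //; rewrite gt_eqF.
  by apply: cvgB => //; exact: cvg_powR.
apply: cvg_trans cF; apply: near_eq_cvg; near=> x; rewrite /Fpn ifF//; apply/negbTE; near: x.
by apply: (cvgr_neq0 xi) cx _; rewrite gt_eqF.
Unshelve. all: by end_near. Qed.

(** Ties the separate clause of [Fpn] at xi = 0 to the formula for xi > 0, which identifies the
    coefficient of order 0 with F_pn(c, 0). *)
Lemma Fpn_cvg0 (c : R) : -1 <= c <= 1 -> Fpn p n c xi @[xi --> (0:R)^'+] --> Fpn p n c 0.
Proof.
move=> c1.
have cx : (fun xi : R => xi) xi @[xi --> (0:R)^'+] --> (0 : R).
  by apply: cvg_at_right_filter; exact: cvg_id.
have k (a : R) : (fun _ : R => a) x @[x --> (0 : R)^'+] --> a by exact: cvg_cst.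
have cw : wq c xi @[xi --> (0:R)^'+] --> 0.
  have : wq c xi @[xi --> (0:R)^'+] --> 2 * c * 0 - 0 * 0.
    by apply: cvgB; [apply: cvgM|exact: cvgM].
  by rewrite !mulr0 subr0.
have c1w (a : R) : (1 - wq c xi) `^ a @[xi --> (0:R)^'+] --> (1 : R).
  rewrite [X in _ --> X](_ : 1 = (1 - 0) `^ a); last by rewrite subr0 powR1.
  by apply: cvg_powR; [rewrite subr0|apply: cvgB => //; exact: k].
have cp (a : R) : 0 < a -> xi `^ a @[xi --> (0:R)^'+] --> 0 by exact: powR_cvg0.
(* The limit is 1 for p > n and 1/4 for p = n. *)
have cY : Ypn p n c xi @[xi --> (0:R)^'+] --> (1 + 3 * delta p n)^-1.
  rewrite /delta -subr_eq0 /Ypn; case: eqP => [_|/eqP en].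
    rewrite mulr1 (_ : (1 + 3)^-1 = 1 / 4) ?mul1r//; by field.
  have e1 : 0 < p - n by rewrite lt0r en.
  rewrite mulr0 addr0 invr1 [X in _ --> X](_ : 1 = (1 - - (0 * 1)) `^ (- 2)); last first.
    by rewrite mul0r oppr0 subr0 powR1.
  apply: cvg_powR; first by rewrite mul0r oppr0 subr0.
  apply: cvgB => //; apply: cvgN; apply: cvgM; [exact: cp|exact: c1w].
have cG : Gpn p n c xi @[xi --> (0:R)^'+] --> (1 - c ^+ 2) * 1 * (1 + 3 * delta p n)^-1 * 1.
  by apply: cvgM; [apply: cvgM => //; apply: cvgM|] => //; exact: c1w.
have cH : Hpn p n c xi @[xi --> (0:R)^'+] --> (1 - c ^+ 2) * 1 * (1 + 3 * delta p n)^-1 * ((2 * c - 0) * powquo (p / 2) 0) ^+ 2.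
  apply: cvgM; first by apply: cvgM => //; apply: cvgM => //; exact: c1w.
  have cl : (2 * c - xi) * powquo (p / 2) (wq c xi) @[xi --> (0:R)^'+] --> (2 * c - 0) * powquo (p / 2) 0.
    apply: cvgM; first exact: cvgB.
    by apply: (cvg_comp _ _ cw); apply: powquo_continuous; rewrite divr_ge0// ltW.
  exact: cvgM.
set V := (1 + 3 * delta p n)^-1 in cY cG cH *.
have cF : Gpn p n c xi + - 2 * (Gpn p n c xi * xi `^ p) + Gpn p n c xi * xi `^ (2 * p) + Hpn p n c xi @[xi --> (0:R)^'+] -->
    (1 - c ^+ 2) * 1 * V * 1 + - 2 * ((1 - c ^+ 2) * 1 * V * 1 * 0) + (1 - c ^+ 2) * 1 * V * 1 * 0
    + (1 - c ^+ 2) * 1 * V * ((2 * c - 0) * powquo (p / 2) 0) ^+ 2.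
  apply: cvgD => //; apply: cvgD; last by apply: cvgM => //; apply: cp; rewrite mulr_gt0.
  by apply: cvgD => //; apply: cvgM => //; apply: cvgM => //; exact: cp.
have -> : Fpn p n c 0 = (1 - c ^+ 2) * 1 * V * 1 + - 2 * ((1 - c ^+ 2) * 1 * V * 1 * 0) + (1 - c ^+ 2) * 1 * V * 1 * 0
    + (1 - c ^+ 2) * 1 * V * ((2 * c - 0) * powquo (p / 2) 0) ^+ 2.
  by rewrite /Fpn eqxx /powquo eqxx -/V; field.
apply: cvg_trans cF; apply: near_eq_cvg; near=> xi.
rewrite (_ : Fpn p n c xi = Gpn p n c xi + - 2 * (Gpn p n c xi * xi `^ p) + Gpn p n c xi * xi `^ (2 * p) + Hpn p n c xi)//.
by move: c c1 {cw c1w cY cG cH}; near: xi; exact: Fpn_GH.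
Unshelve. all: by end_near. Qed.

(** A remainder that is continuous at (c, 0) is bounded as xi tends to 0, so the two partial sums up
    to j differ by O(xi^lambda_(j+1)), and the powers are independent to that order. *)
Lemma expansion_unique (PR PR' : (nat -> R -> R) * (nat -> R * R -> R)) :
  is_expansion p n PR -> is_expansion p n PR' ->
  forall j c, -1 <= c <= 1 -> PR.1 j c = PR'.1 j c.
Proof.
move=> [_ cR HR] [_ cR' HR'] j c c1.
have bound (Q : R * R -> R) : {within @Edom R, continuous Q} -> uO (fun _ xi => Q (c, xi)) 0.
  move=> /subspace_continuousP /(_ (c, 0)) => H.
  have Ec : Edom (c, 0 : R).
    by split => //; split => //= -[_ /eqP]; rewrite eq_sym oner_eq0.
  move: (H Ec) => /cvgrPdist_lt /(_ 1 ltr01) {}H.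
  have cpair : (fun xi : R => (c, xi)) xi @[xi --> (0:R)^'+] --> (c, 0 : R).
    apply: (@cvg_pair _ _ _ _ (nbhs c) (nbhs (0 : R))); first exact: cvg_cst.
    by apply: cvg_at_right_filter; exact: cvg_id.
  have H2 : \forall xi \near (0:R)^'+, Edom (c, xi) -> `|Q (c, 0) - Q (c, xi)| < 1.
    exact: (cpair _ H).
  exists (1 + `|Q (c, 0)|); near=> xi => _ _.
  have xi0 : 0 < xi by near: xi; exact: near0_gt0.
  have xi1 : xi < 1 by near: xi; exact: near0_lt.
  have Ex : Edom (c, xi).
    by split => //; split; [exact: ltW|move=> [_ E]; rewrite E ltxx in xi1].
  have : `|Q (c, 0) - Q (c, xi)| < 1 by move: Ex; near: xi.
  rewrite powRr0 mulr1 => H3.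
  have := lerB_dist (Q (c, xi)) (Q (c, 0)); rewrite (distrC (Q (c, xi))) => H4.
  lra.
have b1 := bound _ (cR j); have b2 := bound _ (cR' j).
apply/eqP; rewrite -subr_eq0; apply/eqP.
apply: (@powR_indep R p n n0 np j.+1 (fun i => PR.1 i c - PR'.1 i c)) => //.
have b1' := uOM (uO_monomial (- 1)%:P 0) b1; rewrite addr0 in b1'.
have b3 := uOM (uOD b2 b1') (@uO_powR R (lam j.+1)).
rewrite ?addr0 ?add0r in b3.
apply: uO_ext b3; near=> xi => c' _.
have xi0 : 0 < xi by near: xi; exact: near0_gt0.
have xi1 : xi < 1 by near: xi; exact: near0_lt.
have Ex : Edom (c, xi).
  by split => //; split; [exact: ltW|move=> [_ E]; rewrite E ltxx in xi1].
have := HR j c xi Ex; rewrite (HR' j c xi Ex) => E.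
under [RHS]eq_bigr => i _ do rewrite mulrBl.
rewrite sumrB /monomial hornerC powRr0 mulr1 mulrDl.
by move: E => /(congr1 (fun t => t - PR.2 j.+1 (c, xi) * xi `^ lam j.+1 - \sum_(i < j.+1) PR'.1 i c * xi `^ lam i)); rewrite addrK; lra.
Unshelve. all: by end_near. Qed.

Lemma expansion_exists : exists PR, is_expansion p n PR /\
  forall j, exists Q : {poly R}, forall c, PR.1 j c = Q.[c].
Proof.
have [P HP] := Fpn_coef n0 np.
pose S N c xi := \sum_(i < N) monomial (P i) (lam i) c xi.
(* At xi = 0 the remainder of index j has to take the value P_j(c), the limit of the quotient. *)
pose Rr (j : nat) (x : R * R) := if x.2 == 0 then (P j).[x.1] else
  (Fpn p n x.1 x.2 - S j x.1 x.2) / x.2 `^ lam j.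
exists (fun j c => (P j).[c], Rr); split; last by move=> j; exists (P j).
have F0 c : -1 <= c <= 1 -> Fpn p n c 0 = (P 0%N).[c].
  move=> c1.
  have l1 : 0 < lam 1%N by rewrite -[ltLHS](lambda_0 n0 np) lambda_lt.
  have H1 := uO_cvg (HP 1%N) l1 c1.
  have H2 : Fpn p n c xi - (P 0%N).[c] @[xi --> (0:R)^'+] --> Fpn p n c 0 - (P 0%N).[c].
    by apply: cvgB; [exact: Fpn_cvg0|exact: cvg_cst].
  have H3 : Fpn p n c xi - (P 0%N).[c] @[xi --> (0:R)^'+] --> (0 : R).
    apply: cvg_trans H1; apply: near_eq_cvg; near=> xi.
    by rewrite big_ord1 /monomial lambda_0// powRr0 mulr1.
  have E : Fpn p n c 0 - (P 0%N).[c] = 0 by exact: (cvg_unique _ H2 H3).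
  by apply/eqP; rewrite -subr_eq0; apply/eqP.
split => /=.
- by move=> j; apply: continuous_subspaceT; exact: continuous_horner.
- move=> j; apply/subspace_continuousP => -[c xi] Ex.
  change (Rr j.+1 x @[x --> within (@Edom R) (nbhs (c, xi))] --> Rr j.+1 (c, xi)).
  have [/= c1 [xi0 _]] := Ex.
  move: xi0; rewrite le_eqVlt => /predU1P[xi0|xi0]; last first.
    apply: cvg_within_filter.
    have cx : snd x @[x --> (c, xi)] --> xi by exact: cvg_snd.
    have cc : fst x @[x --> (c, xi)] --> c by exact: cvg_fst.
    have -> : Rr j.+1 (c, xi) = (Fpn p n c xi - S j.+1 c xi) / xi `^ lam j.+1 by rewrite /Rr /= gt_eqF.
    have cF : (Fpn p n x.1 x.2 - S j.+1 x.1 x.2) / x.2 `^ lam j.+1 @[x --> (c, xi)] -->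
        (Fpn p n c xi - S j.+1 c xi) / xi `^ lam j.+1.
      apply: cvgM; last by apply: cvgV; [rewrite gt_eqF// powR_gt0|exact: cvg_powR].
      apply: cvgB; first exact: Fpn_cvg_pos.
      apply: cvg_sumr => i _; apply: cvgM; last exact: cvg_powR.
      by apply: (cvg_comp _ _ cc); exact: continuous_horner.
    apply: cvg_trans cF; apply: near_eq_cvg; near=> x; rewrite /Rr ifF//; apply/negbTE; near: x.
    by apply: (cvgr_neq0 xi) cx _; rewrite gt_eqF.
  rewrite -xi0 in Ex *.
  have -> : Rr j.+1 (c, 0) = (P j.+1).[c] by rewrite /Rr /= eqxx.
  (* One more term is split off: R_(j+1) = P_(j+1) + g, where g = O(xi^(lambda_(j+2) -
     lambda_(j+1))) uniformly in c. The uniformity yields joint continuity at (c, 0). *)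
  pose g (c xi : R) := (Fpn p n c xi - S j.+2 c xi) * xi `^ (- lam j.+1).
  have gO : uO g (lam j.+2 - lam j.+1) by exact: uOM (HP j.+2) (@uO_powR R _).
  have lj : 0 < lam j.+2 - lam j.+1 by rewrite subr_gt0 lambda_lt.
  apply/cvgrPdist_lt => eps eps0.
  have eps2 : 0 < eps / 2 by rewrite divr_gt0.
  have cP : (P j.+1).[x.1] @[x --> (c, 0 : R)] --> (P j.+1).[c].
    have cc : fst x @[x --> (c, 0 : R)] --> c by exact: cvg_fst.
    by apply: (cvg_comp _ _ cc); exact: continuous_horner.
  move/cvgrPdist_lt : cP => /(_ _ eps2) cP.
  have gs := uO_near0 gO lj (near0_norm_lt eps2).
  have gs2 : \forall xi \near (0 : R), 0 < xi -> forall c, -1 <= c <= 1 -> `|g c xi| < eps / 2 by exact: gs.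
  have gs3 : \forall x \near (c, 0 : R), 0 < x.2 -> forall c, -1 <= c <= 1 -> `|g c x.2| < eps / 2.
    have cx : snd x @[x --> (c, 0 : R)] --> (0 : R) by exact: cvg_snd.
    exact: (cx _ gs2).
  apply: filterS2 cP gs3 => -[c' xi'] /= Hp Hg [/= c'1 [xi'0 _]].
  rewrite /Rr /=; case: eqVneq => [_|xin0]; first by apply: lt_trans Hp _; lra.
  have xip : 0 < xi' by rewrite lt0r xin0.
  have -> : (Fpn p n c' xi' - S j.+1 c' xi') / xi' `^ lam j.+1 = (P j.+1).[c'] + g c' xi'.
    rewrite /g /S [in RHS]big_ord_recr /= powRN /monomial; field.
    by rewrite gt_eqF// powR_gt0.
  rewrite opprD addrA; apply: le_lt_trans (ler_normB _ _) _.
  by have := Hg xip c' c'1; lra.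
- move=> m c xi Ex; have [/= c1 [xi0 _]] := Ex.
  move: xi0; rewrite le_eqVlt => /predU1P[<-|xi0].
    rewrite powR0 ?mulr0 ?addr0; last by rewrite gt_eqF// -[ltLHS](lambda_0 n0 np) lambda_lt.
    rewrite big_ord_recl big1 ?addr0 => [|i _]; last first.
      by rewrite powR0 ?mulr0// gt_eqF// -[ltLHS](lambda_0 n0 np) lambda_lt.
    by rewrite lambda_0// powRr0 mulr1 F0.
  rewrite /Rr /= gt_eqF// divfK; last by rewrite gt_eqF// powR_gt0.
  by rewrite /S /monomial addrC subrK.
Unshelve. all: by end_near. Qed.

Lemma expansionP : is_expansion p n (expansion p n).
Proof.
have [PR [HPR _]] := expansion_exists.
by rewrite /expansion; case: xgetP => // /(_ PR).
Qed.

Lemma Ppn_poly j : exists Q : {poly R}, forall c, -1 <= c <= 1 -> Ppn p n j c = Q.[c].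
Proof.
have [PR [HPR /(_ j)[Q HQ]]] := expansion_exists.
exists Q => c c1; rewrite -HQ; apply: expansion_unique => //; exact: expansionP.
Qed.

End expansion_remainders.

(** * Estimates of the series *)

Section Gtrunc.
Variables (R : realType) (p n rho : R).
Local Notation v := (rvec R).

Lemma ler_fsumr (I : choiceType) (A : set I) (F G : I -> R) : finite_set A ->
  (forall i, A i -> F i <= G i) -> \sum_(i \in A) F i <= \sum_(i \in A) G i.
Proof.
move=> fA FG; rewrite !fsbig_finite// big_seq [leRHS]big_seq; apply: ler_sum => i.
by rewrite in_fset_set// inE => /FG.
Qed.

Lemma zball_sub_finite d (A : set 'rV[int]_d) : finite_set (A `&` zball rho).
Proof. by apply: finite_setIr; exact: zball_finite. Qed.

Definition trunc_set d (k : 'rV[int]_d) : set 'rV[int]_d :=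
  Z0k k `&` [set h | znorm R h < rho \/ znorm R (k - h) < rho].

Lemma reflect_bij d (k : 'rV[int]_d) (P : set 'rV[int]_d) :
  set_bij [set h | P (k - h)] P (fun h => k - h).
Proof.
split => //.
- by move=> a b _ _ /(congr1 (fun h => k - h)); rewrite !subKr.
- by move=> h Ph; exists (k - h); rewrite /= subKr.
Qed.

Lemma trunc_set_finite d (k : 'rV[int]_d) : finite_set (trunc_set k).
Proof.
apply: finite_setIr; rewrite (_ : mkset _ = zball rho `|` (fun h => k - h) @` zball rho).
  by rewrite finite_setU; split; [|apply: finite_image]; exact: zball_finite.
apply/seteqP; split => h /=.
  by case=> hr; [left|right; exists (k - h) => //; rewrite subKr].
by case=> [hr|[l lr <-]]; [left|right; rewrite subKr].
Qed.

(** The indices with |h| >= rho have |k - h| < rho and are reflected by h |-> k - h. After the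
    reflection their condition reads rho <= |k - h|, equality included, in accordance with H(0) =
    1. *)
Lemma Gtrunc_heaviside d (k : 'rV[int]_d) :
  Gtrunc p n rho k = 4 * \sum_(h \in Z0k k `&` zball rho)
    (gterm p n k h (k - h) + heaviside (znorm R (k - h) - rho) * gterm p n k (k - h) h).
Proof.
rewrite /Gtrunc; congr (_ * _).
rewrite fsbig_split; last exact: zball_sub_finite.
rewrite [LHS](fsbigID (zball rho)); last exact: trunc_set_finite.
congr (_ + _).
  congr (\big[_/_]_(_ \in _) _); apply/seteqP; split => h /=; first by case=> -[].
  by case=> h0 hr; split => //; split => //; left.
set Q := (X in \sum_(_ \in X) _ = _).
rewrite (reindex_fsbig _ _ _ _ (reflect_bij k Q)).
transitivity (\sum_(h \in Z0k k `&` zball rho `&` [set h | rho <= znorm R (k - h)]) gterm p n k (k - h) h).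
  rewrite (_ : [set h | Q (k - h)] = Z0k k `&` zball rho `&` [set h | rho <= znorm R (k - h)]).
    by apply: eq_fsbigr => h _; rewrite subKr.
  rewrite /Q; apply/seteqP; split => h /=.
    rewrite subKr /zball /=; move=> [[[k1 k2] hr] /negP]; rewrite -leNgt => k3.
    split => //; split; last by case: hr => // hr; rewrite leNgt hr in k3.
    split; last by rewrite eq_sym -subr_eq0.
    by apply: contra_neq k2 => ->; rewrite subr0.
  rewrite subKr /zball /= => -[[[h0 hk] hr] lr]; split; last by apply/negP; rewrite -leNgt.
  split; last by right.
  split; first by rewrite subr_eq0 eq_sym.
  by apply: contra_neq h0 => E; rewrite -(subKr k h) E subrr.
rewrite fsbig_mkcondr; apply: eq_fsbigr => h _.
rewrite /heaviside subr_lt0; case: (ltP (znorm R (k - h)) rho) => lr.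
  by rewrite mul0r ifF//; apply/negP => /set_mem /=; rewrite leNgt lr.
by rewrite mul1r ifT//; apply/mem_set.
Qed.

Lemma Gtrunc_far d (k : 'rV[int]_d) : 0 < rho -> 2 * rho <= znorm R k ->
  Gtrunc p n rho k = 4 * \sum_(h \in @Z0 d `&` zball rho)
    (gterm p n k h (k - h) + 1 * gterm p n k (k - h) h).
Proof.
move=> r0 kr; rewrite Gtrunc_heaviside; congr (_ * _).
rewrite (_ : Z0k k `&` zball rho = @Z0 d `&` zball rho).
  apply: eq_fsbigr => h /set_mem [_ /= hr]; rewrite /heaviside ifF//.
  by apply/negP; rewrite subr_lt0 => lr; have := znormB_ge R h k; move: hr; rewrite /zball /=; lra.
apply/seteqP; split => h /=; first by case=> -[].
case=> h0 hr; split => //; split => //.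
by apply/eqP => hk; move: hr; rewrite /zball /= hk; lra.
Qed.

Lemma Gtrunc_ge0 d (k : 'rV[int]_d) : 0 <= Gtrunc p n rho k.
Proof. by rewrite mulr_ge0// fsumr_ge0// => h _; exact: gterm_ge0. Qed.

Lemma Gtrunc_Fpn d (k : 'rV[int]_d) : k != 0 -> Gtrunc p n rho k <=
  4 * \sum_(h \in Z0k k `&` zball rho) 1 / znorm R h `^ (2 * n - 2)
    * Fpn p n (cos (angle (v h) (v k))) (znorm R h / znorm R k).
Proof.
move=> k0; rewrite Gtrunc_heaviside ler_wpM2l//; apply: ler_fsumr; first exact: zball_sub_finite.
move=> h [[h0 hk] _]; apply: le_trans (gterm_Fpn _ _ k0 h0 hk).
rewrite lerD2l ler_piMl ?gterm_ge0// /heaviside; by case: ifP.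
Qed.

Lemma znorm_isometry d (N : 'M[int]_d) (h : 'rV[int]_d) : N *m N^T = 1%:M ->
  znorm R (h *m N) = znorm R h.
Proof.
move=> NN; rewrite /znorm /rnorm !dotv_mulmx /rvec map_mxM trmx_mul mulmxA -(mulmxA (map_mx _ h)).
by rewrite map_trmx -map_mxM NN map_mx1 mulmx1.
Qed.

(** h |-> h N carries the index set of k onto that of k N, and every factor of [gterm] is
    invariant. *)
Lemma Gtrunc_isometry d (N : 'M[int]_d) (k : 'rV[int]_d) : N *m N^T = 1%:M ->
  Gtrunc p n rho (k *m N) = Gtrunc p n rho k.
Proof.
move=> NN; have NN' : N^T *m N = 1%:M by exact: mulmx1C.
rewrite /Gtrunc; apply: (congr1 ( *%R 4)).
rewrite [LHS](@reindex_fsbig _ _ _ _ _ (fun h => h *m N) (trunc_set k)).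
  apply: eq_fsbigr => h _; by rewrite -mulmxBl /gterm (Pnorm_isometry _ _ _ NN) !(znorm_isometry _ NN).
have inj : injective (fun h : 'rV[int]_d => h *m N).
  by move=> a b /(congr1 (fun x => x *m N^T)); rewrite -!mulmxA NN !mulmx1.
split.
- move=> h [[h0 hk] hr]; split => /=; last by rewrite -mulmxBl !znorm_isometry.
  split; first by apply: contra_neq h0 => E; apply: inj; rewrite mul0mx.
  by apply: contra_neq hk => /inj.
- by move=> a b _ _; exact: inj.
- move=> h [[h0 hk] hr]; exists (h *m N^T); last by rewrite -mulmxA NN' mulmx1.
  have hE : h = h *m N^T *m N by rewrite -mulmxA NN' mulmx1.
  split => /=; last by rewrite -(znorm_isometry _ NN) -(znorm_isometry (k - _) NN) mulmxBl -!hE.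
  split; first by apply: contra_neq h0 => E; rewrite hE E mul0mx.
  by apply: contra_neq hk => E; rewrite hE E.
Qed.

Lemma Gtrunc_reflv d (r : 'I_d) (k : 'rV[int]_d) : Gtrunc p n rho (reflv r k) = Gtrunc p n rho k.
Proof.
pose D : 'rV[int]_d := \row_j (if j == r then - 1 else 1).
have -> : reflv r k = k *m diag_mx D.
  apply/rowP => j; rewrite mul_mx_diag !mxE; case: ifP => _; by rewrite ?mulr1 ?mulrN1.
apply: Gtrunc_isometry; rewrite tr_diag_mx mulmx_diag.
rewrite -diag_const_mx; congr diag_mx; apply/rowP => j; rewrite !mxE.
by case: ifP; rewrite ?mulr1 ?mulrNN ?mulr1.
Qed.

Lemma Gtrunc_perm d (s : 'S_d) (k : 'rV[int]_d) : Gtrunc p n rho (col_perm s k) = Gtrunc p n rho k.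
Proof.
rewrite col_permE; apply: Gtrunc_isometry.
by rewrite tr_perm_mx -perm_mxM mulgV perm_mx1.
Qed.

End Gtrunc.

(** * The full series: splitting, upper bound, strict lower bound *)

Section Gfull.
Variables (R : realType) (p n rho : R).
Local Notation v := (rvec R).
Local Open Scope ereal_scope.

Lemma esumZl_le (I : choiceType) (A : set I) (c : R) (a : I -> \bar R) : (0 <= c)%R ->
  (forall i, 0 <= a i) -> \esum_(i in A) (c%:E * a i) <= c%:E * \esum_(i in A) a i.
Proof.
move=> c0 a0; apply: ge_ereal_sup => _ [X XA <-].
rewrite -ge0_mule_fsumr// lee_wpmul2l ?lee_fin//.
by apply: ereal_sup_ubound; exists X.
Qed.

Definition far_set d (k : 'rV[int]_d) : set 'rV[int]_d :=
  Z0k k `&` ~` [set h | (znorm R h < rho)%R \/ (znorm R (k - h) < rho)%R].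

Lemma Gfull_split d (k : 'rV[int]_d) :
  Gfull p n k = (Gtrunc p n rho k)%:E + 4%:E * \esum_(h in far_set k) (gterm p n k h (k - h))%:E.
Proof.
have g0 (h : 'rV[int]_d) : 0 <= (gterm p n k h (k - h))%:E :> \bar R by rewrite lee_fin gterm_ge0.
rewrite /Gfull (esumID [set h | (znorm R h < rho)%R \/ (znorm R (k - h) < rho)%R])//.
rewrite -/(far_set k) esum_fset//; last exact: trunc_set_finite.
rewrite ge0_muleDr; last 2 first.
- by apply: fsume_ge0.
- by apply: esum_ge0.
by rewrite fsumEFin ?EFinM//; exact: trunc_set_finite.
Qed.

(** On the far set both |h| and |k - h| are at least rho. Each of the two summands in [gterm_le]
    therefore contributes at most the whole tail, the second after the reflection h |-> k - h; this
    doubles C_pn / 8. *)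
Lemma far_sum_le d (k : 'rV[int]_d) : (1 < n)%R -> (n <= p)%R ->
  \esum_(h in far_set k) (gterm p n k h (k - h))%:E <=
  (Cpn p n / 4)%:E * \esum_(h in [set h : 'rV[int]_d | (rho <= znorm R h)%R]) (znorm R h `^ (- (2 * n - 2)))%:E.
Proof.
move=> n1 np.
have [C0 _] := cpn_max n1 np.
set A := [set h : 'rV[int]_d | (rho <= znorm R h)%R].
pose w (h : 'rV[int]_d) : \bar R := (znorm R h `^ (- (2 * n - 2)))%:E.
have w0 h : 0 <= w h by rewrite lee_fin powR_ge0.
have C8 : (0 <= Cpn p n / 8)%R by rewrite divr_ge0.
apply: (@le_trans _ _ (\esum_(h in far_set k) ((Cpn p n / 8)%:E * (w h + w (k - h)%R)))).
  apply: le_esum => h [[h0 hk] _]; rewrite -EFinD -EFinM lee_fin opprB.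
  exact: gterm_le.
apply: le_trans (esumZl_le _ C8 _) _; first by move=> h; rewrite adde_ge0.
rewrite esumD// (_ : (Cpn p n / 4)%R = (Cpn p n / 8 * 2)%R); last by field.
rewrite [X in _ <= X * _]EFinM -muleA lee_wpmul2l ?lee_fin// mule_natl mule2n.
have sub (B : set 'rV[int]_d) (f : 'rV[int]_d -> \bar R) : B `<=` A -> (forall h, 0 <= f h) ->
    \esum_(h in B) f h <= \esum_(h in A) f h.
  move=> BA f0; rewrite [leRHS](esumID B)//.
  by rewrite (_ : A `&` B = B) ?leeDl ?esum_ge0//; apply/setIidr.
apply: leeD.
  apply: sub => // h [_ /= H]; rewrite /A /= leNgt; apply/negP => hr; apply: H; by left.
rewrite (@reindex_esum R _ _ _ _ _ (fun h => w (k - h)%R) (reflect_bij k (far_set k))).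
rewrite [leLHS](eq_esum (b := w)); last by move=> h _; rewrite subKr.
apply: sub => // h [_ /=]; rewrite subKr => H; rewrite /A /= leNgt; apply/negP => hr; apply: H; by right.
Qed.

Lemma Gfull_le d (k : 'rV[int]_d) : (2 <= d)%N -> (d%:R / 2 + 1 < n)%R -> (n <= p)%R ->
  (2 * Num.sqrt d%:R < rho)%R -> Gfull p n k <= (Gtrunc p n rho k + dG p n rho d)%:E.
Proof.
case: d k => [//|d] k d2 hn np hrho.
(* The condition n > d/2 + 1 is what makes the sum of |h|^(2-2n) converge. *)
have dn : (d.+1%:R < 2 * n - 2)%R by lra.
have n1 : (1 < n)%R by have := ler0n R d.+1; lra.
have [C0 _] := cpn_max n1 np.
rewrite (Gfull_split k) (EFinD (Gtrunc p n rho k)); apply: leeD => //.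
apply: (@le_trans _ _ (4%:E * ((Cpn p n / 4)%:E * \esum_(h in [set h : 'rV[int]_d.+1 | (rho <= znorm R h)%R]) (znorm R h `^ (- (2 * n - 2)))%:E))).
  by rewrite lee_wpmul2l ?lee_fin//; exact: far_sum_le.
rewrite muleA -EFinM (_ : (4 * (Cpn p n / 4))%R = Cpn p n); last by field.
have T := @lattice_tail R d (2 * n - 2) rho d2 dn hrho.
apply: (le_trans (lee_wpmul2l _ T)); first by rewrite lee_fin.
rewrite -EFinM lee_fin le_eqVlt; apply/predU1P; left.
rewrite /dG /= mulrA; congr (_ * _)%R.
  by rewrite mulrCA !mulrA; congr (_ / _)%R; ring.
apply: eq_bigr => i _; congr (_ * (_ / (_ * _ `^ _)))%R; ring.
Qed.

(* h = N e_i with |N| large and N k_i <= 0 is not parallel to k, and |k - h| > |k|. *)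
Lemma far_sum_gt0 d (k : 'rV[int]_d) : (2 <= d)%N -> (0 < p)%R -> k != 0%R ->
  0 < \esum_(h in far_set k) (gterm p n k h (k - h))%:E.
Proof.
move=> d2 p0 k0.
have [j kj] : exists j, k 0%R j != 0%R.
  apply: contrapT => H; move/eqP: k0; apply; apply/rowP => j; rewrite mxE.
  by apply/eqP; apply: contrapT => /negP kj; apply: H; exists j.
(* As d >= 2 there is a second coordinate; k_j nonzero with j different from i keeps h, a multiple
   of e_i, from being parallel to k. *)
have [i ij] : exists i : 'I_d, i != j.
  have : (0 < #|[set~ j]%SET|)%N by rewrite cardsC1 card_ord; case: d d2 {k k0 j kj} => [|[]].
  by move=> /card_gt0P[t]; rewrite !inE => tj; exists t.
pose m := (Num.truncn `|rho|%R).+1.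
(* The sign gives |k - h|^2 >= |k|^2 + m^2, so |k - h| is at least m >= rho and exceeds |k|. *)
pose N : int := if (0 <= k 0%R i)%R then (- m%:Z)%R else m%:Z.
have Nm : (N%:~R ^+ 2 = m%:R ^+ 2 :> R)%R.
  by rewrite /N; case: ifP => _; rewrite ?intrN ?sqrrN.
have m0 : (0 < m%:R :> R)%R by rewrite ltr0n.
have rm : (rho <= m%:R)%R.
  by apply: le_trans (ler_norm _) _; rewrite ltW// truncnS_gt.
have Nk : (N%:~R * (k 0 i)%:~R <= 0 :> R)%R.
  rewrite -intrM lerz0 /N; case: ifPn => ki; first by rewrite mulNr oppr_le0 mulr_ge0.
  by rewrite mulr_ge0_le0// ltW// ltNge.
pose h : 'rV[int]_d := (N *: delta_mx 0 i)%R.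
have vh x : (dotv (v h) x = N%:~R * x 0 i)%R.
  rewrite /dotv (bigD1 i)//= big1 ?addr0; last first.
    by move=> t ti; rewrite !mxE (negbTE ti) andbF mulr0 mul0r.
  by rewrite !mxE !eqxx mulr1.
have hi : (v h 0 i = N%:~R)%R by rewrite !mxE !eqxx mulr1.
have ki : (v k 0 i = (k 0 i)%:~R)%R by rewrite mxE.
have hh : (dotv (v h) (v h) = m%:R ^+ 2)%R by rewrite vh hi -expr2.
have kk : ((k 0 i)%:~R ^+ 2 < dotv (v k) (v k))%R.
  rewrite /dotv (bigD1 i)//= (bigD1 j) 1?eq_sym//= !mxE -!expr2 ltrDl.
  rewrite ltr_pwDl//; first by rewrite lt0r sqr_ge0 sqrf_eq0 intr_eq0 kj.
  by apply: sumr_ge0 => t _; rewrite -expr2 sqr_ge0.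
set K2 := dotv (v k) (v k) in kk.
set x := ((k 0 i)%:~R : R)%R in kk Nk ki.
have K20 : (0 < K2)%R by apply: le_lt_trans kk; exact: sqr_ge0.
have ll : (dotv (v (k - h)) (v (k - h)) = K2 - 2 * (N%:~R * x) + m%:R ^+ 2)%R.
  rewrite rvecB !(dotvBl, dotvBr) (dotvC (v k)) hh vh ki -/K2; ring.
have zh : znorm R h = m%:R by rewrite /znorm /rnorm hh sqrtr_sqr gtr0_norm.
have zl : (m%:R <= znorm R (k - h))%R.
  rewrite -(ler_pXn2r (ltn0Sn 1)) ?nnegrE ?znorm_ge0// /znorm rnorm_sqr ll; lra.
have zkl : (znorm R k < znorm R (k - h))%R.
  rewrite -(ltr_pXn2r (ltn0Sn 1)) ?nnegrE ?znorm_ge0// /znorm !rnorm_sqr ll -/K2.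
  have : (0 < m%:R ^+ 2 :> R)%R by rewrite exprn_gt0. 
  lra.
have P0 : (0 < Pnorm R h (k - h))%R.
  apply: Pnorm_gt0.
    have li : (v (k - h) 0 i = x - N%:~R)%R by rewrite !mxE !eqxx mulr1 rmorphB.
    rewrite hh ll vh li exprMn Nm ltr_pM2l ?exprn_gt0//.
    rewrite (_ : (x - N%:~R) ^+ 2 = x ^+ 2 - 2 * (N%:~R * x) + N%:~R ^+ 2)%R; last by ring.
    by rewrite Nm; lra.
  rewrite subrKC rvecB dotvBr (dotvC _ (v h)) vh ki -/K2; apply/negP => /eqP; lra.
have g0 : (0 < gterm p n k h (k - h))%R.
  have H0 : (0 < znorm R h)%R by rewrite zh.
  have L0 : (0 < znorm R (k - h))%R by apply: lt_le_trans zl.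
  rewrite /gterm divr_gt0//; last by rewrite exprn_gt0// addr_gt0// mulr_gt0// powR_gt0.
  apply: mulr_gt0; last by rewrite exprn_gt0.
  rewrite lt0r sqr_ge0 sqrf_eq0 subr_eq0 andbT lt_eqF//.
  by rewrite gt0_ltr_powR ?nnegrE ?znorm_ge0.
apply: (@lt_le_trans _ _ (gterm p n k h (k - h))%:E); first by rewrite lte_fin.
apply: esum_ge; exists [set h].
  split; first exact: finite_set1.
  move=> _ ->; split; last by move=> [] /=; rewrite ltNge ?zh ?rm// (le_trans rm zl).
  split; first by rewrite -(znorm_gt0 R) zh.
  by rewrite eq_sym -subr_eq0 -(znorm_gt0 R); apply: lt_le_trans zl.
by rewrite fsbig_set1.
Qed.

End Gfull.

(** * The maxima over compact sets, and the polynomials on the sphere *)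

Section Gfrak.
Variables (R : realType) (d : nat) (p n rho mu : R) (m : nat).
Hypotheses (n0 : 0 < n) (np : n <= p) (rho0 : 0 < rho) (mu1 : 1 < mu).
Local Notation v := (rvec R).
Local Notation A := (@Z0 d `&` @zball R d rho).

Lemma cos_angle (x y : 'rV[R]_d) : cos (angle x y) = dotv x y / (rnorm x * rnorm y).
Proof. by rewrite /angle acosK// in_itv /= cos_bound. Qed.

Lemma calP_poly j : exists Q : {poly R}, (forall c, -1 <= c <= 1 -> Ppn p n j c = Q.[c]) /\
  forall u : 'rV[R]_d, sphere u -> calP p n rho j u =
    \sum_(h \in A) Q.[dotv (v h) u / znorm R h] / znorm R h `^ (2 * n - 2 - lambda p n j).
Proof.
have [Q HQ] := Ppn_poly n0 np j; exists Q; split => // u u1.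
apply: eq_fsbigr => h _; rewrite cos_angle (_ : rnorm u = 1)// mulr1 HQ//.
by have := cos_bound (v h) u; rewrite (_ : rnorm u = 1)// mulr1.
Qed.

Section mpoly.
Import (canonicals, coercions) mpoly.
Lemma calP_mpoly j : exists q : mpoly.mpoly d R, forall u : 'rV[R]_d, sphere u ->
  calP p n rho j u = mpoly.meval (fun i => u 0 i) q.
Proof.
have [Q [_ HQ]] := calP_poly j.
(* On the sphere the cosine of the angle of h and u is this linear form in u. *)
pose L (h : 'rV[int]_d) : mpoly.mpoly d R :=
  \sum_(r < d) (v h 0 r / znorm R h) *: mpoly.mpolyX R (mpoly.mnm1 r).
exists (\sum_(h \in A) (znorm R h `^ (2 * n - 2 - lambda p n j))^-1 *:
   \sum_(i < size Q) Q`_i *: L h ^+ i).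
move=> u u1; rewrite HQ// !fsbig_finite; try exact: zball_sub_finite.
rewrite raddf_sum; apply: eq_bigr => h _; rewrite /= mpoly.mevalZ mulrC; congr (_ * _).
rewrite horner_coef raddf_sum; apply: eq_bigr => i _; rewrite /= mpoly.mevalZ rmorphXn; congr (_ * _ ^+ _).
rewrite /= raddf_sum /dotv mulr_suml; apply: eq_bigr => r _.
by rewrite /= mpoly.mevalZ mpoly.mevalXU mulrAC.
Qed.

End mpoly.

Lemma sphere_compact : compact (@sphere R d).
Proof.
apply: bounded_closed_compact.
  exists 1; split; first exact: num_real.
  move=> M M1 u u1 /=.
  have u1' : rnorm u = 1 by exact: u1.
  apply: (@le_trans _ _ 1); last exact: ltW.
  rewrite [leLHS]mx_normrE; apply/bigmax_leP; split => // -[a b] _ /=.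
  by rewrite ord1 -u1' rnorm_coord.
have cN : continuous (fun u : 'rV[R]_d => dotv u u).
  move=> u; apply: (@cvg_sumr _ _ _ (nbhs u)) => r _; apply: cvgM; exact: coord_continuous.
rewrite (_ : @sphere R d = (fun u : 'rV[R]_d => dotv u u) @^-1` [set 1]).
  by apply: closed_comp => [x _|]; [exact: cN|exact: closed_eq].
apply/seteqP; split => u; rewrite /sphere /=.
  by move=> u1; rewrite -rnorm_sqr u1 expr1n.
by move=> u1; rewrite /rnorm u1 sqrtr1.
Qed.

(** The expression maximized in [Gfrak], with P_pnj replaced by a polynomial and eps by its positive
    part. It is continuous everywhere and unchanged on the compact set in question. *)
Definition gfrak_fun (Q : nat -> {poly R}) (x : 'rV[R]_d * R) : R :=
  \sum_(j < m.+1) Num.max x.2 0 `^ lambda p n j *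
     (\sum_(h \in A) (Q j).[dotv (v h) x.1 / znorm R h] / znorm R h `^ (2 * n - 2 - lambda p n j))
  + Num.max x.2 0 `^ lambda p n m.+1 * (Wpn p n mu m * Zpn p n rho d m).

Lemma gfrak_fun_continuous Q : continuous (gfrak_fun Q).
Proof.
move=> [u e].
have cu : fst x @[x --> (u, e)] --> u by exact: cvg_fst.
have ce : snd x @[x --> (u, e)] --> e by exact: cvg_snd.
have cp j : Num.max x.2 0 `^ lambda p n j @[x --> (u, e)] --> Num.max e 0 `^ lambda p n j.
  have l0 : 0 <= lambda p n j by exact: lambda_ge0.
  exact: (cvg_comp _ _ ce (@powR_max_continuous R _ l0 e)).
apply: cvgD; last by apply: cvgM => //; exact: cvg_cst.
apply: cvg_sumr => j _; apply: cvgM => //.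
have [s Hs] : exists s : seq 'rV[int]_d, forall F : 'rV[int]_d -> R, \sum_(h \in A) F h = \sum_(h <- s) F h.
  by eexists => F; rewrite fsbig_finite//; exact: zball_sub_finite.
under eq_fun do rewrite Hs.
rewrite Hs; apply: cvg_sumr => h _; apply: cvgM; last exact: cvg_cst.
have cd : dotv (v h) x.1 / znorm R h @[x --> (u, e)] --> dotv (v h) u / znorm R h.
  apply: cvgM; last exact: cvg_cst.
  apply: cvg_sumr => r _; apply: cvgM; first exact: cvg_cst.
  exact: (cvg_comp _ _ cu (@coord_continuous _ _ _ 0 r u)).
by apply: (cvg_comp _ _ cd); exact: continuous_horner.
Qed.

Lemma Gfrak_ub (u : 'rV[R]_d) (eps : R) : sphere u -> 0 <= eps <= 1 / (mu * rho) ->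
  4 * (\sum_(j < m.+1) eps `^ lambda p n j * calP p n rho j u
         + eps `^ lambda p n m.+1 * (Wpn p n mu m * Zpn p n rho d m)) <= Gfrak p n rho mu d m.
Proof.
move=> su heps; rewrite /Gfrak ler_wpM2l//.
have [Q HQ] := choice calP_poly.
pose K : set ('rV[R]_d * R) := @sphere R d `*` `[0, 1 / (mu * rho)]%classic.
have K0 : K !=set0 by exists (u, eps); split; rewrite //= in_itv.
have cK : compact K by apply: compact_setX; [exact: sphere_compact|exact: segment_compact].
have E w e : sphere w -> 0 <= e <= 1 / (mu * rho) ->
   \sum_(j < m.+1) e `^ lambda p n j * calP p n rho j w
         + e `^ lambda p n m.+1 * (Wpn p n mu m * Zpn p n rho d m) = gfrak_fun Q (w, e).
  move=> sw /andP[e0 _]; rewrite /gfrak_fun /= (max_idPl e0); congr (_ + _).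
  by apply: eq_bigr => j _; rewrite (HQ j).2.
have [_ _ [_ M]] := maximum_image K0 cK (continuous_subspaceT (@gfrak_fun_continuous Q)).
rewrite E//; have := M (u, eps); rewrite (_ : gfrak_fun Q @` K = [set \sum_(j < m.+1) e `^ lambda p n j * calP p n rho j w
         + e `^ lambda p n m.+1 * (Wpn p n mu m * Zpn p n rho d m)
      | w in @sphere R d & e in `[0, 1 / (mu * rho)]]).
  by apply; split; rewrite //= in_itv.
apply/seteqP; split.
  move=> _ [[w e] [/= sw he] <-]; exists w => //; exists e => //.
  by rewrite E//; move: he; rewrite in_itv.
move=> _ [w sw [e he <-]]; exists (w, e) => //.
by rewrite E//; move: he; rewrite /= in_itv.
Qed.

Lemma Wpn_ub (c xi : R) : -1 <= c <= 1 -> 0 <= xi <= 1 / mu -> Rpn p n m.+1 c xi <= Wpn p n mu m.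
Proof.
move=> c1 hxi.
pose K : set (R * R) := `[-1, 1]%classic `*` `[0, 1 / mu]%classic.
have K0 : K !=set0 by exists (c, xi); split; rewrite /= in_itv.
have cK : compact K by apply: compact_setX; exact: segment_compact.
have mu0 : 0 < mu by exact: lt_trans ltr01 mu1.
(* mu > 1 keeps xi <= 1/mu < 1, away from the excluded point (1, 1). *)
have KE : K `<=` @Edom R.
  move=> [a b] [/=]; rewrite !in_itv /= => a1 /andP[b0 b1]; split => //; split => // -[_ b11].
  by move: b1; rewrite b11 ler_pdivlMr// mul1r leNgt mu1.
have [_ cR _] := expansionP n0 np.
have cRK := continuous_subspaceW KE (cR m).
have [_ _ [_ M]] := maximum_image K0 cK cRK.
have := M (c, xi); rewrite (_ : (expansion p n).2 m.+1 @` K = [set Rpn p n m.+1 c xi | c in `[-1, 1] & xi in `[0, 1 / mu]]).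
  by apply; split; rewrite /= in_itv.
apply/seteqP; split.
  by move=> _ [[a b] [/= ha hb] <-]; exists a => //; exists b.
by move=> _ [a ha [b hb <-]]; exists (a, b).
Qed.

End Gfrak.

(** * The truncated sum for |k| >= mu rho *)

Section large_k.
Variables (R : realType) (d : nat) (p n rho mu : R) (m : nat).
Hypotheses (n0 : 0 < n) (np : n <= p) (rho0 : 0 < rho) (mu1 : 1 < mu).
Local Notation v := (rvec R).
Local Notation A := (@Z0 d `&` @zball R d rho).

Definition expansion_bound (k : 'rV[int]_d) : R :=
  4 * \sum_(j < m.+1) calP p n rho j (khat R k) / znorm R k `^ lambda p n j
  + 4 * (Wpn p n mu m * Zpn p n rho d m / znorm R k `^ lambda p n m.+1).

Variable k : 'rV[int]_d.
Hypothesis hk : mu * rho <= znorm R k.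

Let mu0 : 0 < mu. Proof. exact: lt_trans ltr01 mu1. Qed.

Lemma large_k_gt : rho < znorm R k.
Proof. by apply: lt_le_trans hk; rewrite ltr_pMl. Qed.

Let K0 : 0 < znorm R k. Proof. exact: lt_trans large_k_gt. Qed.
Let k0 : k != 0. Proof. by rewrite -(znorm_gt0 R). Qed.

Lemma khat_sphere : sphere (khat R k).
Proof. by rewrite /sphere /= /khat rnormZ gtr0_norm ?invr_gt0// mulVf// gt_eqF. Qed.

Lemma Z0k_ball : Z0k k `&` zball rho = A.
Proof.
apply/seteqP; split => h /=; first by case=> -[].
case=> h0 hr; split => //; split => //.
by apply/eqP => E; move: hr; rewrite /zball /= E ltNge ltW// large_k_gt.
Qed.

Lemma large_k_term (h : 'rV[int]_d) : A h ->
  1 / znorm R h `^ (2 * n - 2) * Fpn p n (cos (angle (v h) (v k))) (znorm R h / znorm R k)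
  <= \sum_(j < m.+1) (Ppn p n j (cos (angle (v h) (khat R k))) / znorm R h `^ (2 * n - 2 - lambda p n j)) / znorm R k `^ lambda p n j
   + Wpn p n mu m * (1 / znorm R h `^ (2 * n - 2 - lambda p n m.+1)) / znorm R k `^ lambda p n m.+1.
Proof.
move=> [h0 hr]; have H0 : 0 < znorm R h by rewrite znorm_gt0.
set c := cos _; set xi := znorm R h / znorm R k.
have -> : cos (angle (v h) (khat R k)) = c.
  rewrite /c !cos_angle (_ : rnorm (khat R k) = 1); last exact: khat_sphere.
  rewrite /khat dotvZr mulr1 -!/(znorm R _); field; by rewrite !gt_eqF.
have c1 : -1 <= c <= 1 by rewrite /c cos_geN1 cos_le1.
have xi0 : 0 < xi by rewrite divr_gt0.
have xi1 : xi <= 1 / mu.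
  rewrite ler_pdivlMr// mulrC /xi mulrA ler_pdivrMr// mul1r.
  by apply: le_trans hk; rewrite ler_pM2l// ltW.
have Ex : Edom (c, xi).
  split => //; split; first exact: ltW.
  by move=> [_ E]; move: xi1; rewrite E ler_pdivlMr// mul1r leNgt mu1.
have [_ _ HE] := expansionP n0 np.
rewrite (HE m c xi Ex) mulrDr mulr_sumr.
(* As xi = |h| / |k|, a factor xi^l lowers the exponent of |h| in the denominator by l and leaves
   |k|^(-l). *)
have key t l : 1 / znorm R h `^ t * xi `^ l = 1 / znorm R h `^ (t - l) / znorm R k `^ l.
  rewrite /xi powRM ?invr_ge0 ?(ltW H0) ?(ltW K0)// -(powR_inv1 (ltW K0)) -powRrM mulN1r powRN.
  rewrite powRB ?(gt_eqF H0) ?implybT//.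
  have := powR_gt0 l H0; have := powR_gt0 l K0; have := powR_gt0 t H0.
  move: (znorm R h `^ t) (znorm R k `^ l) (znorm R h `^ l) => a b e a0 b0 e0.
  by field; rewrite !gt_eqF.
apply: lerD.
  rewrite le_eqVlt; apply/predU1P; left; apply: eq_bigr => j _.
  by rewrite mulrCA key /Ppn !mulrA mulr1.
rewrite mulrCA key -!mulrA ler_wpM2r ?mulr_ge0 ?invr_ge0 ?powR_ge0//.
by apply: Wpn_ub => //; rewrite (ltW xi0).
Qed.

Lemma Gtrunc_expansion : Gtrunc p n rho k <= expansion_bound k.
Proof.
apply: le_trans (Gtrunc_Fpn _ _ _ k0) _.
rewrite Z0k_ball /expansion_bound -mulrDr ler_wpM2l//.
apply: le_trans (ler_fsumr (zball_sub_finite _ _) large_k_term) _.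
rewrite /calP /Zpn !fsbig_finite; try exact: zball_sub_finite.
rewrite big_split /= exchange_big /= le_eqVlt; apply/predU1P; left; congr (_ + _).
  apply: eq_bigr => j _; rewrite fsbig_finite; last exact: zball_sub_finite.
  by rewrite mulr_suml.
by rewrite mulr_sumr mulr_suml.
Qed.

Lemma expansion_bound_Gfrak : expansion_bound k <= Gfrak p n rho mu d m.
Proof.
(* The bound is the expression of [Gfrak] at the point u = [khat R k], eps = 1 / |k|. *)
have e0 : 0 <= (znorm R k)^-1 <= 1 / (mu * rho).
  by rewrite invr_ge0 ltW//= mul1r lef_pV2 ?posrE ?mulr_gt0.
apply: le_trans (Gfrak_ub m n0 np khat_sphere e0).
rewrite /expansion_bound -mulrDr le_eqVlt; apply/predU1P; left; congr (_ * _).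
have key l : (znorm R k)^-1 `^ l = (znorm R k `^ l)^-1.
  by rewrite -(powR_inv1 (ltW K0)) -powRrM mulN1r powRN.
by rewrite key mulrC; congr (_ + _); apply: eq_bigr => j _; rewrite key mulrC.
Qed.

End large_k.

Theorem proposition7p1 (R : realType) (d : nat) (hd : (2 <= d)%N)
    (p n : R) (hpn : n <= p) (hn : d%:R / 2 + 1 < n)
    (rho : R) (hrho : 2 * Num.sqrt d%:R < rho)
    (mu : R) (hmu : 1 < mu) (m : nat) :
  (forall k : 'rV[int]_d, k != 0 -> (0 < Gfull p n k < +oo)%E)
  /\ (forall k : 'rV[int]_d, k != 0 ->
        ((Gtrunc p n rho k)%:E < Gfull p n k)%E
        /\ (Gfull p n k <= (Gtrunc p n rho k + dG p n rho d)%:E)%E)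
  /\ (forall k : 'rV[int]_d, k != 0 ->
        Gtrunc p n rho k =
          4 * \sum_(h \in Z0k k `&` zball rho)
                (gterm p n k h (k - h)
                 + heaviside (znorm R (k - h) - rho) * gterm p n k (k - h) h))
  /\ (forall k : 'rV[int]_d, k != 0 -> 2 * rho <= znorm R k ->
        Gtrunc p n rho k =
          4 * \sum_(h \in @Z0 d `&` zball rho)
                (gterm p n k h (k - h) + 1 * gterm p n k (k - h) h))
  /\ (forall (r : 'I_d) (s : 'S_d) (k : 'rV[int]_d), k != 0 ->
        Gtrunc p n rho (reflv r k) = Gtrunc p n rho k
        /\ Gtrunc p n rho (col_perm s k) = Gtrunc p n rho k)
  /\ (forall k : 'rV[int]_d, k != 0 ->
        Gtrunc p n rho k <=
          4 * \sum_(h \in Z0k k `&` zball rho)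
                1 / znorm R h `^ (2 * n - 2)
                * Fpn p n (cos (angle (rvec R h) (rvec R k)))
                          (znorm R h / znorm R k))
  /\ (forall k : 'rV[int]_d, mu * rho <= znorm R k ->
        let B := 4 * \sum_(j < m.+1)
                       calP p n rho j (khat R k) / znorm R k `^ lambda p n j
                 + 4 * (Wpn p n mu m * Zpn p n rho d m
                        / znorm R k `^ lambda p n m.+1) in
        Gtrunc p n rho k <= B /\ B <= Gfrak p n rho mu d m)
  /\ (forall j : nat, exists q : mpoly.mpoly d R,
        forall u : 'rV[R]_d, sphere u ->
          calP p n rho j u = mpoly.meval (fun i => u 0 i) q)
  /\ (ereal_sup [set Gfull p n k | k in @Z0 d] <=
        (Num.max
           (maximum [set Gtrunc p n rho k | k in @Z0 d `&` zball (mu * rho)])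
           (Gfrak p n rho mu d m)
         + dG p n rho d)%:E)%E.
Proof.
have d0 : 0 < d%:R :> R by rewrite ltr0n; exact: leq_trans hd.
have n1 : 1 < n by lra.
have n0 : 0 < n by lra.
have p0 : 0 < p by exact: lt_le_trans hpn.
have sd : 0 < Num.sqrt d%:R :> R by rewrite sqrtr_gt0.
have rho0 : 0 < rho by lra.
have mu0 : 0 < mu by lra.
have Glow (k : 'rV[int]_d) : k != 0 -> ((Gtrunc p n rho k)%:E < Gfull p n k)%E.
  move=> k0; rewrite (Gfull_split p n rho k) lteDl// mule_gt0//.
  exact: far_sum_gt0.
have Gup (k : 'rV[int]_d) : (Gfull p n k <= (Gtrunc p n rho k + dG p n rho d)%:E)%E.
  exact: Gfull_le.
split.
  move=> k k0; apply/andP; split.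
    by apply: le_lt_trans (Glow k k0); rewrite lee_fin Gtrunc_ge0.
  by apply: le_lt_trans (Gup k) _; rewrite ltry.
split; first by move=> k k0; split; [exact: Glow|exact: Gup].
split; first by move=> k _; exact: Gtrunc_heaviside.
split; first by move=> k _; exact: Gtrunc_far.
split; first by move=> r s k _; split; [exact: Gtrunc_reflv|exact: Gtrunc_perm].
split; first by move=> k; exact: Gtrunc_Fpn.
split.
  by move=> k hk; split; [exact: Gtrunc_expansion|exact: expansion_bound_Gfrak].
split; first by move=> j; exact: calP_mpoly.
apply: ge_ereal_sup => _ [k k0 <-]; apply: le_trans (Gup k) _.
rewrite lee_fin lerD2r le_max.
have [kmu|kmu] := ltP (znorm R k) (mu * rho); last first.
  apply/orP; right; apply: le_trans (Gtrunc_expansion m n0 hpn rho0 hmu kmu) _.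
  exact: expansion_bound_Gfrak.
apply/orP; left.
have fin : finite_set (@Z0 d `&` @zball R d (mu * rho)) by exact: zball_sub_finite.
have [_ M] : ([set Gtrunc p n rho k | k in @Z0 d `&` zball (mu * rho)] `&`
   ubound [set Gtrunc p n rho k | k in @Z0 d `&` zball (mu * rho)])
   (maximum [set Gtrunc p n rho k | k in @Z0 d `&` zball (mu * rho)]).
  apply: maximumP.
  (* A greatest value over the finite ball, obtained as a least value of the negatives. *)
  have [|x [y yA <-] Hx] := @finite_set_min R ((fun k => - Gtrunc p n rho k) @` (@Z0 d `&` zball (mu * rho))) (finite_image _ fin).
    by exists (- Gtrunc p n rho k), k.
  exists (Gtrunc p n rho y); split; first by exists y.
  by move=> _ [z zA <-]; rewrite -lerN2; apply: Hx; exists z.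
by apply: M; exists k.
Qed.
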